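(* Let $(J,\gamma)$ be a real metrised Jordan algebra of dimension $n$, let $\mathcal Y\subset J$ be the connected component of $\mathbf 0$ in the set of elements $a \in J$ such that $-a$ is quasi-regular, let $\mathcal D=\mathcal Y\times\mathbb R\subset J\times\mathbb R$, and let $\Delta$ be the ($n$-dimensional, involutive) distribution on $\mathcal D$ given by the kernel of the $1$-form $\zeta$ defined at $(x,\alpha)\in\mathcal D$ by $$\zeta(u,\mu)=\gamma\big(u,(-x)^{(-1)}\big)-\mu,\qquad (u,\mu)\in J\times\mathbb R.$$ Let $M$ be a maximal integral manifold of $\Delta$, equipped with the constant transversal vector field $\xi=(\mathbf 0,1)$. Then $M$ is a homogeneous, symmetric, analytic, non-degenerate, affine complete graph immersion with parallel cubic form. Moreover, with $\pi:J\times\mathbb R\to J$ the canonical projection, the restriction $\pi|_M$ is a covering map of the domain $\mathcal Y\subset J$, and different sheets of the covering are related by a translation parallel to the vector $\xi$.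
   Context: Jordan algebras. A real Jordan algebra is a finite-dimensional real vector space with a commutative bilinear product $\bullet$ satisfying $x\bullet(x^2\bullet y)=x^2\bullet(x\bullet y)$; $L_x$ denotes multiplication by $x$. A trace form is a symmetric bilinear form $\gamma$ with $\gamma(u\bullet v,w)=\gamma(u,v\bullet w)$; $(J,\gamma)$ is metrised if $\gamma$ is a non-degenerate trace form on $J$. The unital hull $\hat J$ is $\mathbb R\times J$ with product $(\alpha,u)\hat\bullet(\beta,v)=(\alpha\beta,\alpha v+\beta u+u\bullet v)$, a unital Jordan algebra with unit $\hat e=(1,\mathbf 0)$. In a unital Jordan algebra with unit $e$, $y$ is the inverse of $x$ if $x\bullet y=e$ and $L_x,L_y$ commute (it is unique if it exists). An element $a\in J$ is quasi-regular if $(1,-a)$ is invertible in $\hat J$; then $(1,-a)^{-1}=(1,-b)$ for a unique $b\in J$, called the quasi-inverse of $a$ and denoted $a^{(-1)}$. Graph immersions. A graph immersion is a smooth hypersurface immersion $f:\Omega\to\mathbb A^{n+1}$ of an $n$-manifold equipped with a constant transversal vector field $\xi$. With $D$ the flat connection of the ambient affine space, $D_X f_*Y=f_*(\nabla_XY)+h(X,Y)\xi$ defines the induced connection $\nabla$ and the affine fundamental form $h$. It is non-degenerate if $h$ is non-degenerate; then $\hat\nabla$ is the Levi-Civita connection of the affine (pseudo-)metric $h$ and $C=\nabla h$ is the cubic form. ''Parallel cubic form'' means $\hat\nabla C=0$. ''Affine complete'' means that the affine metric $h$ is (geodesically) complete. ''Homogeneous'' means that a group of affine transformations of the ambient space acts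 on $M$ transitively and by isometries of $h$; ''symmetric'' means that around each point of $M$ there is an isometry of $h$ fixing the point, with differential $-\mathrm{Id}$ there. *)

(* Defs.v *)
From HB Require Import structures.
From mathcomp Require Import all_boot all_order all_algebra.
From mathcomp Require Import sesquilinear.
From mathcomp Require Import all_classical all_reals all_analysis.

Set Implicit Arguments.
Unset Strict Implicit.
Unset Printing Implicit Defensive.

Import Order.TTheory GRing.Theory Num.Theory.
Import numFieldNormedType.Exports.

Local Open Scope classical_set_scope.
Local Open Scope ring_scope.

(* All norms on a finite-dimensional real vector space are equivalent, so a
   normedModType with a finite basis is just a finite-dimensional space with
   its canonical topology and differential calculus. *)
Definition has_dim (R : realType) (E : normedModType R) (n : nat) : Prop :=
  exists b : 'I_n -> E,
    forall x, exists! t : 'rV[R]_n, x = \sum_(i < n) t 0 i *: b i.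

Section Jordan.
Context {R : realType} {J : normedModType R}.

Definition jordan_product (mul : J -> J -> J) : Prop :=
  commutative mul /\
  forall x y, mul x (mul (mul x x) y) = mul (mul x x) (mul x y).

Definition nondegenerate_form (h : J -> J -> R) : Prop :=
  forall u, (forall v, h u v = 0) -> u = 0.

Definition trace_form (mul : J -> J -> J) (gamma : J -> J -> R) : Prop :=
  (forall u v, gamma u v = gamma v u) /\
  forall u v w, gamma (mul u v) w = gamma u (mul v w).

Definition metrised_jordan (mul : J -> J -> J) (gamma : J -> J -> R) : Prop :=
  [/\ jordan_product mul, trace_form mul gamma & nondegenerate_form gamma].

Definition jordan_inverse (T : Type) (mul : T -> T -> T) (e x y : T) : Prop :=
  mul x y = e /\ forall z, mul x (mul y z) = mul y (mul x z).

Definition hull_mul (mul : J -> J -> J) (p q : R * J) : R * J :=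
  (p.1 * q.1, p.1 *: q.2 + q.1 *: p.2 + mul p.2 q.2).

Definition quasi_regular (mul : J -> J -> J) (a : J) : Prop :=
  exists y : R * J, jordan_inverse (hull_mul mul) (1, 0) (1, - a) y.

(* Junk value 0 if [a] is not quasi-regular. *)
Definition quasi_inverse (mul : J -> J -> J) (a : J) : J :=
  xget 0 [set b | jordan_inverse (hull_mul mul) (1, 0) (1, - a) (1, - b)].

Definition quasi_domain (mul : J -> J -> J) : set J :=
  connected_component [set a | quasi_regular mul (- a)] 0.

Definition zeta (mul : J -> J -> J) (gamma : J -> J -> R)
    (p w : J * R^o) : R :=
  gamma w.1 (quasi_inverse mul (- p.1)) - w.2.

End Jordan.

Section Calculus.
Context {R : realType}.

(* On an open subset of a finite-dimensional space this is the usual class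
   C^k: for k > 0 the clause on directional derivatives makes the differential
   of class C^(k-1). *)
Fixpoint Ck_on (E F : normedModType R) (k : nat) (U : set E) (f : E -> F) :
    Prop :=
  match k with
  | 0 => forall x, U x -> {for x, continuous f}
  | k'.+1 => (forall x, U x -> differentiable f x) /\
             forall v : E, Ck_on k' U (fun x => 'D_v f x)
  end.

Definition smooth_on (E F : normedModType R) (U : set E) (f : E -> F) : Prop :=
  forall k, Ck_on k U f.

Definition multilinear (E F : normedModType R) (k : nat)
    (m : ('I_k -> E) -> F) : Prop :=
  forall (i : 'I_k) (v : 'I_k -> E),
    linear (fun u : E => m (fun j => if j == i then u else v j)).

Definition analytic_on (E F : normedModType R) (U : set E) (f : E -> F) :
    Prop :=
  forall x, U x -> exists (m : forall k, ('I_k -> E) -> F) (C rho r : R),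
    [/\ 0 < r, forall k, multilinear (@m k),
        forall k (v : 'I_k -> E),
          `|m k v| <= C * rho ^+ k * \prod_(i < k) `|v i|
      & forall v, `|v| < r ->
          series (fun k => m k (fun=> v)) @ \oo --> f (x + v)].

End Calculus.

Section Manifolds.
Context {R : realType} {E : normedModType R}.

(* [cmap] and [cinv] are total functions with meaningless values outside
   [cdom] and [cimg] respectively. *)
Record chart (M : topologicalType) := Chart {
  cdom : set M;
  cimg : set E;
  cmap : M -> E;
  cinv : E -> M;
  cdom_open : open cdom;
  cimg_open : open cimg;
  cmap_img : forall p, cdom p -> cimg (cmap p);
  cinv_dom : forall x, cimg x -> cdom (cinv x);
  cmapK : forall p, cdom p -> cinv (cmap p) = p;
  cinvK : forall x, cimg x -> cmap (cinv x) = x;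
  cmap_continuous : forall p, cdom p -> {for p, continuous cmap};
  cinv_continuous : forall x, cimg x -> {for x, continuous cinv} }.

Definition coord_dom (M N : topologicalType) (c : chart M) (d : chart N)
    (phi : M -> N) : set E :=
  [set x | cimg c x /\ cdom d (phi (cinv c x))].

Definition coord (M N : topologicalType) (c : chart M) (d : chart N)
    (phi : M -> N) : E -> E :=
  fun x => cmap d (phi (cinv c x)).

Definition charts_cover (M : topologicalType) (A : set (chart M)) : Prop :=
  forall p : M, exists2 c, A c & cdom c p.

Definition smooth_compatible (M : topologicalType) (A B : set (chart M)) :
    Prop :=
  forall c d, A c -> B d -> smooth_on (coord_dom c d id) (coord c d id).

End Manifolds.

Arguments chart {R} E M.

(* A manifold modelled on [E]; its dimension is that of [E].  The atlas need
   not be maximal. *)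
Record smoothManifold (R : realType) (E : normedModType R) := SmoothManifold {
  mcarrier :> topologicalType;
  atlas : set (chart E mcarrier);
  manifold_hausdorff : hausdorff_space mcarrier;
  manifold_second_countable : @second_countable mcarrier;
  atlas_cover : charts_cover atlas;
  atlas_smooth : smooth_compatible atlas atlas }.

Section SmoothMaps.
Context {R : realType} {E V : normedModType R}.
Implicit Types M N : smoothManifold E.

Definition smooth_map M N (phi : M -> N) : Prop :=
  continuous phi /\
  forall c d, atlas c -> atlas d ->
    smooth_on (coord_dom c d phi) (coord c d phi).

Definition diffeomorphism M (phi : M -> M) : Prop :=
  smooth_map phi /\
  exists psi : M -> M, [/\ smooth_map psi, cancel phi psi & cancel psi phi].

Definition immersion M (f : M -> V) : Prop :=
  forall c, atlas c ->
    smooth_on (cimg c) (f \o cinv c) /\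
    forall x, cimg c x -> injective ('d (f \o cinv c) x).

(* [f] is analytic for some analytic structure underlying the smooth one. *)
Definition analytic_immersion M (f : M -> V) : Prop :=
  immersion f /\
  exists B : set (chart E M),
    [/\ charts_cover B,
        forall c d, B c -> B d -> analytic_on (coord_dom c d id) (coord c d id),
        smooth_compatible (@atlas R E M) B,
        smooth_compatible B (@atlas R E M)
      & forall c, B c -> analytic_on (cimg c) (f \o cinv c)].

(* [D] is the domain of the distribution [Delta]. *)
Definition integral_manifold (D : set V) (Delta : V -> set V)
    M (f : M -> V) : Prop :=
  [/\ [set: M] !=set0 /\ connected [set: M],
      immersion f, injective f, range f `<=` D
    & forall c x, atlas c -> cimg c x ->
        range ('d (f \o cinv c) x) = Delta (f (cinv c x))].

Definition maximal_integral_manifold (D : set V) (Delta : V -> set V)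
    M (f : M -> V) : Prop :=
  integral_manifold D Delta f /\
  forall N (g : N -> V), integral_manifold D Delta g ->
    range f `<=` range g -> range g = range f.

End SmoothMaps.

(* The geometry of a hypersurface immersion is expressed in a local
   parametrization [F], with coordinate vectors of [E] standing for the
   corresponding coordinate (constant) vector fields. *)
Section LocalGeometry.
Context {R : realType} {E V : normedModType R}.
Variables (xi : V) (F : E -> V).

Definition tangential_part (x : E) (z : V) : E :=
  xget 0 [set w | exists t : R, z = 'd F x w + t *: xi].

Definition transversal_part (x : E) (z : V) : R :=
  xget 0 [set t | exists w : E, z = 'd F x w + t *: xi].

(* The Gauss formula D_u (F_* v) = F_* (nabla_u v) + h(u, v) xi. *)
Definition induced_conn (x u v : E) : E :=
  tangential_part x ('D_u (fun y => 'd F y v) x).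

Definition affine_form (x u v : E) : R :=
  transversal_part x ('D_u (fun y => 'd F y v) x).

(* (nabla_w h)(u, v) *)
Definition cubic_form (x w u v : E) : R :=
  'D_w (fun y => affine_form y u v : R^o) x
  - affine_form x (induced_conn x w u) v
  - affine_form x u (induced_conn x w v).

(* The torsion-free connection with nabla h = 0; at each point these two
   conditions determine the Christoffel symbols if h is non-degenerate. *)
Definition is_levi_civita_at (x : E) (G : E -> E -> E) : Prop :=
  (forall u v, G u v = G v u) /\
  forall w u v, 'D_w (fun y => affine_form y u v : R^o) x =
    affine_form x (G w u) v + affine_form x u (G w v).

Definition levi_civita (x : E) : E -> E -> E :=
  xget (fun _ _ => 0) [set G | is_levi_civita_at x G].

(* (hat-nabla_w C)(u1, u2, u3) *)
Definition levi_civita_cubic (x w u1 u2 u3 : E) : R :=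
  'D_w (fun y => cubic_form y u1 u2 u3 : R^o) x
  - cubic_form x (levi_civita x w u1) u2 u3
  - cubic_form x u1 (levi_civita x w u2) u3
  - cubic_form x u1 u2 (levi_civita x w u3).

End LocalGeometry.

Section GraphImmersions.
Context {R : realType} {E V : normedModType R}.
Variables (M : smoothManifold E) (xi : V) (f : M -> V).

(* V is the direct sum of the tangent hyperplane and the line of [xi]. *)
Definition graph_immersion : Prop :=
  immersion f /\
  forall c x, atlas c -> cimg c x ->
    (forall w, 'd (f \o cinv c) x w <> xi) /\
    forall z, exists (w : E) (t : R), z = 'd (f \o cinv c) x w + t *: xi.

Definition nondegenerate_immersion : Prop :=
  forall c x, atlas c -> cimg c x ->
    nondegenerate_form (affine_form xi (f \o cinv c) x).

Definition parallel_cubic_form : Prop :=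
  forall c x, atlas c -> cimg c x ->
    forall w u1 u2 u3, levi_civita_cubic xi (f \o cinv c) x w u1 u2 u3 = 0.

Definition geodesic (g : R^o -> M) : Prop :=
  continuous g /\
  forall c, atlas c ->
    let x : R^o -> E := cmap c \o g in
    smooth_on [set t | cdom c (g t)] x /\
    forall t, cdom c (g t) ->
      derive1 (derive1 x) t
      + levi_civita xi (f \o cinv c) (x t) (derive1 x t) (derive1 x t) = 0.

Definition affine_complete : Prop :=
  forall c p (v : E), atlas c -> cdom c p ->
    exists g : R^o -> M,
      [/\ geodesic g, g 0 = p & derive1 (cmap c \o g : R^o -> E) 0 = v].

Definition affine_isometry (phi : M -> M) : Prop :=
  diffeomorphism phi /\
  forall c d x, atlas c -> atlas d -> coord_dom c d phi x ->
    forall u v : E,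
      affine_form xi (f \o cinv d) (coord c d phi x)
        ('d (coord c d phi) x u) ('d (coord c d phi) x v) =
      affine_form xi (f \o cinv c) x u v.

Definition affine_transformation (T : V -> V) : Prop :=
  exists (L : {linear V -> V}) (b : V),
    bijective L /\ forall z, T z = L z + b.

Definition transformation_group (G : set (V -> V)) : Prop :=
  [/\ G id,
      forall S T, G S -> G T -> G (S \o T)
    & forall T, G T -> exists S, [/\ G S, cancel S T & cancel T S]].

Definition homogeneous_immersion : Prop :=
  exists (G : set (V -> V)) (act : (V -> V) -> M -> M),
    [/\ transformation_group G /\ G `<=` affine_transformation,
        act id = id /\
        forall S T, G S -> G T -> act (S \o T) = act S \o act T,
        forall T, G T -> forall p, f (act T p) = T (f p),
        forall T, G T -> affine_isometry (act T)
      & forall p q, exists2 T, G T & act T p = q].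

Definition symmetric_immersion : Prop :=
  forall p, exists s : M -> M,
    [/\ affine_isometry s, s p = p
      & forall c, atlas c -> cdom c p ->
          forall u : E, 'd (coord c c s) (cmap c p) u = - u].

End GraphImmersions.

Section Coverings.
Context {M B : topologicalType}.

(* [W] is an open set of the total space mapped homeomorphically onto [U]. *)
Definition sheet (p : M -> B) (U : set B) (W : set M) : Prop :=
  [/\ open W, p @` W = U
    & exists s : B -> M,
        [/\ {within U, continuous s}, forall x, U x -> W (s x) /\ p (s x) = x
          & forall m, W m -> s (p m) = m]].

Definition covering_map (p : M -> B) (Y : set B) : Prop :=
  [/\ continuous p, range p = Y
    & forall y, Y y -> exists U : set B,
        [/\ open U, U y, U `<=` Y
          & exists S : set (set M),
              [/\ forall W, S W -> sheet p U W,
                  forall W W', S W -> S W' -> W `&` W' !=set0 -> W = W'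
                & p @^-1` U = \bigcup_(W in S) W]]].

End Coverings.

(* The sheets over a connected open set are the connected components of its
   preimage, hence do not depend on a choice of trivialization. *)
Definition sheets_translated (R : realType) (M B : topologicalType)
    (V : normedModType R) (p : M -> B) (f : M -> V) (xi : V) : Prop :=
  forall (U : set B) (W W' : set M), open U -> connected U ->
    sheet p U W -> sheet p U W' ->
    exists t : R, f @` W' = [set z + t *: xi | z in f @` W].

(* Main.v *)
Require Import Defs.
From HB Require Import structures.
From mathcomp Require Import all_boot all_order all_algebra.
From mathcomp Require Import sesquilinear.
From mathcomp Require Import all_classical all_reals all_analysis.
From mathcomp Require Import ring lra.

Set Implicit Arguments.
Unset Strict Implicit.
Unset Printing Implicit Defensive.

Import Order.TTheory GRing.Theory Num.Theory.
Import numFieldNormedType.Exports.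

Local Open Scope classical_set_scope.
Local Open Scope ring_scope.

(* For [x] in the domain [Y] put [b(x) = (-x)^(-1)]. The pairs [(x, b)] with
   [x - b = x b] and [L_x, L_b] commuting are permuted by affine maps
   [(x, b) |-> (a + g x, a' + g' b)] with [g'] inverse adjoint to [g]; these are
   obtained as flows of the vector fields [c + c x + [L_p, L_q] x], and they act
   transitively on [Y] because their orbits are open and closed. So everything
   about [b] reduces to its Taylor expansion [b(x) = x - x^2 + x^3 - ...] at [0]:
   smoothness, the second fundamental form [gamma(v, db(u))] of a leaf
   [F = (x, alpha)], its cubic form [gamma(v, d^2 b(w, u))], the difference tensor
   [- u v] of the Levi-Civita connection at [0], and the local primitives of the
   closed form [gamma(dx, b)].

   Near a point of a leaf, the leaf is the graph of a local primitive. By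
   maximality it contains the whole graph over the ball on which the primitive is
   defined: otherwise one glues the graph to the leaf. Hence any map into
   [Y x R] that is locally of the form "graph of a primitive" and meets the leaf
   at one point lifts continuously to the leaf. This gives the covering property, and
   the action on the leaf of any automorphism [(x, alpha) |-> (phi x, +-alpha + E x)]
   of the distribution with one point of the leaf mapped into the leaf. The affine
   maps above yield homogeneity, the map [(x, alpha) |-> (-b(x), gamma(x, b(x)) - alpha)]
   yields the symmetry over [0], and the orbits of the flows of [u + u x] are
   geodesics of arbitrary initial velocity, defined for all times. *)

(** * Finite-dimensional calculus *)

(** In the unital hull, [(1, x)] and [(1, -b)] are inverse to each other, and the affine maps of the
    overview are linear maps of the hull preserving the hyperplane [1 + J]. Generating them by flows
    spares the quadratic representation and its fundamental formula: the defects of the relation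
    between [x] and [b] satisfy a linear homogeneous differential equation, so they vanish once they
    vanish at the start, and the linearized Jordan identity is enough. The adjoint condition makes
    the form invariant up to an exact term, since [gamma(g dx, a' + g' b) = gamma(dx, b) + d gamma(g
    x, a')]. On the side of the leaves the obstacle is that maximality compares a leaf with
    arbitrary abstract integral manifolds and speaks only of ranges. Gluing must therefore produce a
    Hausdorff, second countable manifold with smooth transition maps. A leaf also has its own
    topology, possibly finer than that of its range, so a lift is first shown to be continuous into
    the leaf, and smooth only afterwards. *)

Definition lin_of (R : realType) (E F : lmodType R) (f : E -> F)
    (hf : linear f) : {linear E -> F} :=
  HB.pack f (GRing.isLinear.Build R E F *:%R f hf).

Section PlainLinear.
Context {R : realType} {E F : lmodType R} {f : E -> F} (hf : linear f).
Let f' := lin_of hf.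

Lemma linZ a x : f (a *: x) = a *: f x. Proof. exact: (linearZ_LR f'). Qed.
Lemma linD : {morph f : x y / x + y}. Proof. exact: (linearD f'). Qed.
Lemma linB : {morph f : x y / x - y}. Proof. exact: (linearB f'). Qed.
Lemma linN : {morph f : x / - x}. Proof. exact: (linearN f'). Qed.
Lemma lin0 : f 0 = 0. Proof. exact: (linear0 f'). Qed.
Lemma lin_sum I (r : seq I) (P : pred I) (G : I -> E) :
  f (\sum_(i <- r | P i) G i) = \sum_(i <- r | P i) f (G i).
Proof. exact: (linear_sum f'). Qed.

End PlainLinear.

Record fbasis (R : realType) (E : normedModType R) (n : nat) := FBasis {
  fb : 'I_n -> E;
  fc : 'I_n -> {linear E -> R^o};
  fbK : forall x, x = \sum_(i < n) fc i x *: fb i;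
  fcb : forall i j, fc i (fb j) = (i == j)%:R }.

(** Choice picks coordinates; their uniqueness makes them linear and dual to the basis. *)
Lemma has_dim_fbasis (R : realType) (E : normedModType R) n :
  has_dim E n -> inhabited (fbasis E n).
Proof.
move=> [b hb].
have /choice[c hc] : forall x, exists t : 'rV[R]_n, x = \sum_(i < n) t 0 i *: b i.
  by move=> x; have [t [ht _]] := hb x; exists t.
have cU x (t : 'rV[R]_n) : x = \sum_(i < n) t 0 i *: b i -> t = c x.
  by move=> xt; have [s [_ su]] := hb x; rewrite -(su _ xt) (su _ (hc x)).
have clin : forall i, linear (fun x => c x 0 i : R^o).
  move=> i a u v; suff -> : c (a *: u + v) = a *: c u + c v by rewrite !mxE.
  apply/esym/cU; rewrite {1}(hc u) {1}(hc v) scaler_sumr -big_split /=.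
  by apply: eq_bigr => j _; rewrite !mxE scalerDl scalerA.
have cb i j : c (b j) 0 i = (i == j)%:R.
  rewrite -(cU (b j) (\row_k (k == j)%:R)) ?mxE//.
  rewrite (bigD1 j)//= big1 ?addr0 ?mxE ?eqxx ?scale1r// => k /negPf kj.
  by rewrite mxE kj scale0r.
by constructor; exists b (fun i => lin_of (clin i)).
Qed.

Section FiniteDim.
Context {R : realType} {E : normedModType R} {n : nat} (B : fbasis E n).

Let L (t : 'rV[R]_n) : E := \sum_(i < n) t 0 i *: fb B i.

Let fcL t i : fc B i (L t) = t 0 i.
Proof.
rewrite /L linear_sum (bigD1 i)//= big1 ?addr0.
  by rewrite linearZ fcb eqxx; exact: mulr1.
by move=> j ji; rewrite linearZ fcb eq_sym (negPf ji); exact: mulr0.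
Qed.

Let L_linear : linear L.
Proof.
move=> a u v; rewrite /L scaler_sumr -big_split /=; apply: eq_bigr => i _.
by rewrite !mxE scalerDl scalerA.
Qed.

Let le_mx_norm (t : 'rV[R]_n) i : `|t 0 i| <= `|t|.
Proof.
rewrite [leRHS]/Num.norm /= mx_normrE.
exact: (@le_bigmax _ _ _ 0 (fun ij : 'I_1 * 'I_n => `|t ij.1 ij.2|) (0, i)).
Qed.

Let L_bounded t : `|L t| <= (\sum_(i < n) `|fb B i|) * `|t|.
Proof.
apply: (le_trans (ler_norm_sum _ _ _)); rewrite mulr_suml; apply: ler_sum => i _.
by rewrite normrZ mulrC; apply: ler_wpM2l => //; exact: le_mx_norm.
Qed.

Let L_continuous : continuous L.
Proof.
apply: (@bounded_linear_continuous _ _ _ (lin_of L_linear)).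
apply/linear_boundedP; near=> r => x; apply: (le_trans (L_bounded x)).
by apply: ler_wpM2r => //; near: r; exact: nbhs_pinfty_ge.
Unshelve. all: by end_near. Qed.

(** Equivalence of norms: [|L t|] attains a positive minimum on the compact unit sphere of
    coordinate vectors, and its inverse bounds the coordinates. The continuity of linear maps rests
    on this. *)
Lemma fc_bounded : exists2 C, 0 < C & forall i x, `|fc B i x : R| <= C * `|x|.
Proof.
pose K := [set t : 'rV[R]_n | `|t| = 1].
have [K0|K0] := pselect (K !=set0); last first.
  (* If the sphere is empty, there is no nonzero coordinate vector and any constant works. *)
  exists 1 => // i x; have [x0|x0] := eqVneq (fc B i x : R) 0.
    by rewrite x0 normr0 mul1r.
  exfalso; apply: K0; pose t := \row_j (fc B j x : R).
  have t0 : `|t| != 0.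
    by rewrite normr_eq0; apply: contra x0 => /eqP/rowP/(_ i); rewrite !mxE => ->.
  by exists (`|t|^-1 *: t); rewrite /K /= normrZ normfV normr_id mulVf.
have Kc : compact K.
  apply: bounded_closed_compact.
    by exists 1; split => [|M M1 t]; rewrite ?num_real// /K /= => ->; exact: ltW.
  rewrite (_ : K = (fun t => `|t|) @^-1` [set 1])//.
  by apply: closed_comp; [move=> *; exact: norm_continuous|exact: closed_eq].
have [|t0 /set_mem tK tmin] := @compact_EVT_min _ R (fun t => `|L t|) K K0 Kc.
  apply: continuous_subspaceT => t.
  by apply: continuous_comp; [exact: L_continuous|exact: norm_continuous].
have Lt0 : 0 < `|L t0|.
  rewrite normr_gt0; apply/eqP => Lt0; move: tK; rewrite /K /=.
  suff -> : t0 = 0 by rewrite normr0 => /esym/eqP; rewrite oner_eq0.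
  by apply/rowP => i; rewrite mxE -fcL Lt0 linear0.
exists (`|L t0|^-1); first by rewrite invr_gt0.
move=> i x; pose t := \row_j (fc B j x : R).
have Ltx : L t = x by rewrite [RHS](fbK B); apply: eq_bigr => j _; rewrite mxE.
have -> : (fc B i x : R) = t 0 i by rewrite mxE.
apply: (le_trans (le_mx_norm t i)); rewrite mulrC ler_pdivlMr//.
have [->|tn0] := eqVneq t 0; first by rewrite normr0 mul0r.
have nt0 : `|t| != 0 by rewrite normr_eq0.
have /tmin : `|t|^-1 *: t \in K.
  by apply/mem_set; rewrite /K /= normrZ normfV normr_id mulVf.
rewrite (linZ L_linear) Ltx normrZ normfV normr_id.
by rewrite ler_pdivlMl ?normr_gt0.
Qed.

Lemma lin_bounded (F : normedModType R) (f : E -> F) : linear f ->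
  exists2 C, 0 < C & forall x, `|f x| <= C * `|x|.
Proof.
move=> lf; have [C C0 hC] := fc_bounded.
exists (1 + \sum_(i < n) C * `|f (fb B i)|).
  by rewrite ltr_wpDr// sumr_ge0// => i _; rewrite mulr_ge0// ltW.
move=> x; rewrite {1}(fbK B x) (lin_sum lf).
apply: (le_trans (ler_norm_sum _ _ _)).
rewrite mulrDl mul1r ler_wpDl// mulr_suml; apply: ler_sum => i _.
by rewrite (linZ lf) normrZ /= mulrAC ler_wpM2r.
Qed.

Lemma lin_continuous (F : normedModType R) (f : E -> F) : linear f -> continuous f.
Proof.
move=> lf; have [C C0 hC] := lin_bounded lf.
apply: (@bounded_linear_continuous _ _ _ (lin_of lf)).
apply/linear_boundedP; near=> r => x; apply: (le_trans (hC x)).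
by apply: ler_wpM2r => //; near: r; exact: nbhs_pinfty_ge.
Unshelve. all: by end_near. Qed.



(** The ball is the continuous image of the closed set of its coordinate vectors, which is bounded
    by [fc_bounded]. *)
Lemma norm_ball_compact (r : R) : compact [set x : E | `|x| <= r].
Proof.
have [C C0 hC] := fc_bounded.
pose K := [set t : 'rV[R]_n | `|L t| <= r].
have -> : [set x : E | `|x| <= r] = L @` K.
  apply/seteqP; split => [x /= xr|_ [t tK <-]//].
  have Lx : L (\row_j (fc B j x : R)) = x.
    by rewrite [RHS](fbK B); apply: eq_bigr => j _; rewrite mxE.
  by exists (\row_j (fc B j x : R)) => //; rewrite /K /= Lx.
apply: continuous_compact; first exact/continuous_subspaceT.
apply: bounded_closed_compact.
  exists (C * r); split; first exact: num_real.
  move=> M CM t tK; apply: le_trans (ltW CM); rewrite [leLHS]/Num.norm /= mx_normrE.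
  have r0 : 0 <= r by apply: le_trans tK.
  apply/bigmax_leP; split=> [|[i j] _ /=]; first by rewrite mulr_ge0// ltW.
  rewrite (ord1 i) -fcL; apply: (le_trans (hC _ _)).
  by apply: ler_wpM2l; [exact: ltW|exact: tK].
rewrite (_ : K = (fun t => `|L t|) @^-1` [set x | x <= r])//.
apply: closed_comp; last exact: closed_le.
by move=> t _; apply: continuous_comp; [exact: L_continuous|exact: norm_continuous].
Qed.

(** In coordinates [f] is a square matrix with trivial kernel, hence invertible. *)
Lemma lin_inj_bij (f : E -> E) : linear f -> (forall x, f x = 0 -> x = 0) ->
  exists g : E -> E, [/\ linear g, cancel f g & cancel g f].
Proof.
move=> lf f0; have fi : injective f.
  move=> x y fxy; apply/eqP; rewrite -subr_eq0; apply/eqP/f0.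
  by rewrite (linB lf) fxy subrr.
pose A : 'M[R]_n := \matrix_(i, j) (fc B j (f (fb B i)) : R).
have LA t : L (t *m A) = f (L t).
  rewrite {2}/L (lin_sum lf) [LHS](fbK B) [RHS](fbK B); apply: eq_bigr => i _.
  congr (_ *: _); rewrite fcL mxE linear_sum; apply: eq_bigr => j _.
  by rewrite (linZ lf) linearZ mxE.
have Li s : L s = 0 -> s = 0.
  by move=> Ls; apply/rowP => i; rewrite mxE -fcL Ls linear0.
have Lsurj x : exists t, L t = x.
  exists (\row_j (fc B j x : R)); rewrite [RHS](fbK B).
  by apply: eq_bigr => j _; rewrite mxE.
have uA : A \in unitmx.
  rewrite -row_free_unit -kermx_eq0; apply/eqP/row_matrixP => i; rewrite row0.
  have kA : row i (kermx A) *m A = 0 by rewrite -row_mul mulmx_ker row0.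
  by apply/Li/f0; rewrite -LA kA /L big1// => j _; rewrite mxE scale0r.
have fs y : exists x, f x = y.
  by have [s <-] := Lsurj y; exists (L (s *m invmx A)); rewrite -LA mulmxKV.
have [g gK] := choice fs.
exists g; split; last by move=> y; rewrite gK.
- by move=> a u v; apply: fi; rewrite lf !gK.
- by move=> x; apply: fi; rewrite gK.
Qed.

End FiniteDim.

(** * Differentials through estimates *)

Section Differentials.
Context {R : realType}.
Implicit Types E F G H : normedModType R.

Lemma is_diff_near E F (f df : E -> F) x : linear df -> continuous df ->
  (forall e : R, 0 < e ->
     \forall h \near 0, `|f (x + h) - f x - df h| <= e * `|h|) ->
  is_diff x f df.
Proof.
move=> ldf cdf H; pose D := lin_of ldf.
have fD : f \o shift x = cst (f x) + (D : E -> F) +o_ (0 : E) id.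
  apply/eqaddoP => e e0; have := H e e0; apply: filterS => h.
  by rewrite !fctE /= opprD addrA addrC [h + x]addrC addrC.
have dE : 'd f x = D :> (E -> F) by apply: diff_unique.
apply: DiffDef => //; apply/diff_locallyP; rewrite dE; split => //.
Qed.

Lemma is_diff_nearP E F (f df : E -> F) x (e : R) : is_diff x f df -> 0 < e ->
  \forall h \near 0, `|f (x + h) - f x - df h| <= e * `|h|.
Proof.
move=> [/diff_locallyP[_ fD] dE] e0.
have /eqaddoP/(_ _ e0) := fD; apply: filterS => h.
by rewrite !fctE dE /= opprD addrA addrC [h + x]addrC addrC.
Qed.

Lemma is_diff_near_eq E F (f g df : E -> F) x :
  (\forall y \near x, f y = g y) -> is_diff x f df -> is_diff x g df.
Proof.
move=> fg fD; have [dfx dE] := fD; apply: is_diff_near.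
- by rewrite -dE; exact: linearP.
- by rewrite -dE; exact: diff_continuous.
move=> e e0; have H := is_diff_nearP fD e0.
have fgx : f x = g x := nbhs_singleton fg.
have fg0 : \forall h \near 0, f (x + h) = g (x + h) by move/nbhs0P : fg.
near=> h; rewrite -(near fg0 h)// -fgx; near: h.
Unshelve. all: by end_near. Qed.

Lemma differentiable_near_eq E F (f g : E -> F) x :
  (\forall y \near x, f y = g y) -> differentiable f x -> differentiable g x.
Proof.
by move=> fg /differentiableP fd; have [] := is_diff_near_eq fg fd.
Qed.

Lemma is_diff_lin E F (f : E -> F) x : linear f -> continuous f -> is_diff x f f.
Proof.
move=> lf cf; apply: is_diff_near => // e e0; near=> h.
by rewrite (linD lf) addrAC addrK subrr normr0; apply: mulr_ge0 => //; exact: ltW.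
Unshelve. all: by end_near. Qed.

Definition bilin E F G (b : E -> F -> G) :=
  [/\ forall y, linear (b^~ y), forall x, linear (b x)
    & continuous (fun p : E * F => b p.1 p.2)].

Definition bilin_of E F G (b : E -> F -> G) (hb : bilin b) : {bilinear E -> F -> G} :=
  HB.pack b (bilinear_isBilinear.Build R E F G _ _ b
    (let: And3 hl hr _ := hb in (hl, hr) : bilinear_for
      (GRing.Scale.Law.clone _ _ *:%R _) (GRing.Scale.Law.clone _ _ *:%R _) b)).

Lemma bilin_scale F : bilin (fun (a : R) (v : F) => a *: v).
Proof.
split => [v a u w|v a u w|p]; first by rewrite scalerDl scalerA.
- by rewrite scalerDr !scalerA mulrC.
- exact: scale_continuous.
Qed.

Lemma bilin_is_diff E F G H (b : E -> F -> G) (u du : H -> E) (v dv : H -> F) x :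
  bilin b -> is_diff x u du -> is_diff x v dv ->
  is_diff x (fun y => b (u y) (v y)) (fun w => b (u x) (dv w) + b (du w) (v x)).
Proof.
move=> hb Du Dv; have [_ _ cb] := hb.
have Db : is_diff (u x, v x) (fun q : E * F => b q.1 q.2)
    (fun q => b (u x) q.2 + b q.1 (v x)).
  apply: DiffDef; first exact: (@differentiable_bilin _ _ _ _ (bilin_of hb)).
  exact: (@diff_bilin _ _ _ _ (bilin_of hb) (u x, v x)).
have Duv : is_diff x (fun y => (u y, v y)) (fun w => (du w, dv w)).
  exact: is_diff_pair.
exact: (@is_diff_comp _ _ _ _ (fun y => (u y, v y)) _ (fun q : E * F => b q.1 q.2)).
Qed.

Lemma fbasis_bilin E F G n m (B : fbasis E n) (B' : fbasis F m) (b : E -> F -> G) :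
  (forall y, linear (b^~ y)) -> (forall x, linear (b x)) -> bilin b.
Proof.
move=> hl hr; split => // p.
have -> : (fun p => b p.1 p.2) =
    (fun p : E * F => \sum_(i < n) (fc B i p.1 : R) *: b (fb B i) p.2).
  apply/funext => q; rewrite [in LHS](fbK B q.1) (lin_sum (hl _)).
  by apply: eq_bigr => i _; rewrite (linZ (hl _)).
have cB i : continuous (fc B i : E -> R^o).
  by apply: (lin_continuous B); exact: linearP.
have cb i : continuous (b (fb B i)) by apply: (lin_continuous B').
apply: cvg_big => [|i _]; first exact: add_continuous.
apply: cvgZ.
  exact: (cvg_comp (fun q : E * F => q.1) (fc B i) cvg_fst (cB i p.1)).
exact: (cvg_comp (fun q : E * F => q.2) (b (fb B i)) cvg_snd (cb i p.2)).
Qed.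

End Differentials.

(** * Maps of class C^k *)

Section CkCalculus.
Context {R : realType}.
Implicit Types (E F G H : normedModType R) (k : nat).

Lemma Ck_eq E F k (U : set E) (f g : E -> F) : open U ->
  (forall x, U x -> f x = g x) -> Ck_on k U f -> Ck_on k U g.
Proof.
move=> oU; elim: k f g => [|k IH] f g fg /=; last first.
  move=> [df cf]; have fgn x : U x -> \forall y \near x, f y = g y.
    by move=> Ux; near do apply: fg; exact: open_nbhs_nbhs.
  split=> [x Ux|v]; first exact: differentiable_near_eq (fgn x Ux) (df x Ux).
  apply: IH (cf v) => x Ux; apply: near_eq_derive; exact: fgn.
move=> cf x Ux; apply: cvg_trans; last by rewrite -(fg x Ux); exact: cf.
by apply: near_eq_cvg; near do apply: fg; exact: open_nbhs_nbhs.
Unshelve. all: by end_near. Qed.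

Lemma Ck_continuous E F k (U : set E) (f : E -> F) : Ck_on k U f ->
  forall x, U x -> {for x, continuous f}.
Proof.
case: k => //= k [df _] x Ux; exact/differentiable_continuous/df.
Qed.

Lemma Ck_leS E F k (U : set E) (f : E -> F) : Ck_on k.+1 U f -> Ck_on k U f.
Proof.
elim: k f => [f|k IH f [df cf]]; first exact: Ck_continuous.
by split => // v; apply: IH; exact: cf.
Qed.

Lemma Ck_sub E F k (U V : set E) (f : E -> F) : V `<=` U ->
  Ck_on k U f -> Ck_on k V f.
Proof.
move=> VU; elim: k f => [f cf x /VU /cf //|k IH f [df cf]].
by split => [x /VU /df //|v]; apply: IH; exact: cf.
Qed.

Lemma Ck_local E F k (U : set E) (f : E -> F) :
  (forall x, U x -> exists2 V, V x & Ck_on k V f) -> Ck_on k U f.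
Proof.
elim: k f => [f H x /H[V Vx]|k IH f H]; first by apply.
split=> [x /H[V Vx [df _]]|v]; first exact: df.
by apply: IH => x /H[V Vx [_ cf]]; exists V => //; exact: cf.
Qed.

Lemma Ck_cst E F k (U : set E) (a : F) : Ck_on k U (fun=> a).
Proof.
elim: k a => [a x Ux|k IH a]; first exact: cvg_cst.
split=> [x Ux|v]; first exact: differentiable_cst.
have -> : (fun x => 'D_v (fun=> a) x) = fun=> 0.
  by apply/funext => x; exact: derive_cst.
exact: IH.
Qed.

Lemma Ck_lin E F k (U : set E) (f : E -> F) : linear f -> continuous f ->
  Ck_on k U f.
Proof.
move=> lf cf; case: k => [x _|k]; first exact: cf.
have D x : is_diff x f f by exact: is_diff_lin.
split=> [x _|v]; first by have [] := D x.
rewrite (_ : (fun x => _) = fun=> f v); first exact: Ck_cst.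
by apply/funext => x; have [dx dE] := D x; rewrite (deriveE v dx) dE.
Qed.

Lemma Ck_id E k (U : set E) : Ck_on k U id.
Proof. by apply: Ck_lin => // x; exact: cvg_id. Qed.

Lemma Ck_D E F k (U : set E) (f g : E -> F) : open U ->
  Ck_on k U f -> Ck_on k U g -> Ck_on k U (fun x => f x + g x).
Proof.
move=> oU; elim: k f g => [f g cf cg x Ux|k IH f g [df cf] [dg cg]].
  by apply: cvgD; [exact: cf|exact: cg].
split=> [x Ux|v]; first by apply: differentiableD; [exact: df|exact: dg].
apply: (Ck_eq oU (f := fun x => 'D_v f x + 'D_v g x)); last exact: (IH _ _ (cf v) (cg v)).
by move=> x Ux; rewrite -deriveD//; apply: diff_derivable; [exact: df|exact: dg].
Qed.

Lemma Ck_sum E F k (U : set E) (I : Type) (r : seq I) (f : I -> E -> F) : open U ->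
  (forall i, Ck_on k U (f i)) -> Ck_on k U (fun x => \sum_(i <- r) f i x).
Proof.
move=> oU H; elim: r => [|i r IH].
  by rewrite (_ : (fun x => _) = fun=> 0); [exact: Ck_cst|apply/funext => x; exact: big_nil].
rewrite (_ : (fun x => _) = fun x => f i x + \sum_(j <- r) f j x); first exact: Ck_D.
by apply/funext => x; rewrite big_cons.
Qed.

Lemma Ck_bilin E F G H k (U : set H) (b : E -> F -> G) (u : H -> E) (v : H -> F) :
  bilin b -> open U -> Ck_on k U u -> Ck_on k U v ->
  Ck_on k U (fun x => b (u x) (v x)).
Proof.
move=> hb oU; elim: k u v => [u v cu cv x Ux|k IH u v Cu Cv].
  have [_ _ cb] := hb.
  apply: (cvg_comp (fun y => (u y, v y)) (fun p => b p.1 p.2) _ (cb (u x, v x))).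
  by apply: cvg_pair; [exact: cu|exact: cv].
have [[du cu] [dv cv]] := (Cu, Cv).
have D x : U x -> is_diff x (fun y => b (u y) (v y))
    (fun w => b (u x) ('d v x w) + b ('d u x w) (v x)).
  by move=> Ux; apply: bilin_is_diff => //; exact/differentiableP/du || exact/differentiableP/dv.
split=> [x Ux|w]; first by have [] := D x Ux.
apply: (Ck_eq oU (f := fun x => b (u x) ('D_w v x) + b ('D_w u x) (v x))).
  move=> x Ux; have [d E1] := D x Ux.
  by rewrite (deriveE _ d) E1 !deriveE//; [exact: du|exact: dv].
apply: Ck_D => //.
  by apply: IH; [exact: Ck_leS|exact: cv].
by apply: IH; [exact: cu|exact: Ck_leS].
Qed.

Lemma Ck_scale E F k (U : set E) (a : E -> R) (f : E -> F) : open U ->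
  Ck_on k U a -> Ck_on k U f -> Ck_on k U (fun x => a x *: f x).
Proof. by apply: Ck_bilin; exact: bilin_scale. Qed.

Lemma Ck_scaler E F k (U : set E) (a : R) (f : E -> F) : open U ->
  Ck_on k U f -> Ck_on k U (fun x => a *: f x).
Proof. by move=> oU; apply: Ck_scale => //; exact: Ck_cst. Qed.

Lemma Ck_N E F k (U : set E) (f : E -> F) : open U ->
  Ck_on k U f -> Ck_on k U (fun x => - f x).
Proof.
move=> oU /(Ck_scaler (-1) oU); apply: Ck_eq => // x _; exact: scaleN1r.
Qed.

Lemma Ck_B E F k (U : set E) (f g : E -> F) : open U ->
  Ck_on k U f -> Ck_on k U g -> Ck_on k U (fun x => f x - g x).
Proof. by move=> oU Cf Cg; apply: Ck_D => //; exact: Ck_N. Qed.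

Lemma Ck_V E k (U : set E) (f : E -> R) : open U -> (forall x, U x -> f x != 0) ->
  Ck_on k U f -> Ck_on k U (fun x => (f x)^-1).
Proof.
move=> oU f0; elim: k f f0 => [f f0 cf x Ux|k IH f f0 Cf].
  by apply: cvgV; [exact: f0|exact: cf].
have [df cf] := Cf; split=> [x Ux|v].
  by apply: differentiableV; [exact: df|exact: f0].
apply: (Ck_eq oU (f := fun x => - ((f x)^-1 *: ((f x)^-1 *: 'D_v f x)))).
  move=> x Ux; rewrite deriveV ?f0//; last by apply: diff_derivable; exact: df.
  by rewrite scalerA scaleNr expr2 invfM.
apply: Ck_N => //; apply: Ck_scale => //; first by apply: IH => //; exact: Ck_leS.
by apply: Ck_scale => //; [apply: IH => //; exact: Ck_leS|exact: cf].
Qed.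

Lemma Ck_lin_comp E F G k (U : set E) (l : F -> G) (f : E -> F) : open U ->
  linear l -> continuous l -> Ck_on k U f -> Ck_on k U (fun x => l (f x)).
Proof.
move=> oU ll cl; elim: k f => [f cf x Ux|k IH f [df cf]].
  by apply: continuous_comp; [exact: cf|exact: cl].
have D x : U x -> is_diff x (l \o f) (l \o 'd f x).
  move=> Ux; apply: is_diff_comp; first exact/differentiableP/df.
  exact: is_diff_lin.
split=> [x Ux|v]; first by have [] := D x Ux.
apply: (Ck_eq oU (f := fun x => l ('D_v f x))); last exact: (IH _ (cf v)).
by move=> x Ux; have [d E1] := D x Ux; rewrite (deriveE _ d) E1 deriveE//; exact: df.
Qed.

Lemma Ck_pair E F G k (U : set E) (f : E -> F) (g : E -> G) : open U ->
  Ck_on k U f -> Ck_on k U g -> Ck_on k U (fun x => (f x, g x)).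
Proof.
move=> oU Cf Cg.
apply: (Ck_eq oU (f := fun x => (f x, 0) + (0, g x))).
  by move=> x _; rewrite -[LHS]/(f x + 0, 0 + g x) addr0 add0r.
apply: Ck_D => //.
- apply: (@Ck_lin_comp _ _ (F * G)%type _ _ (fun y => (y, 0)) f) => //.
    by move=> a u v; rewrite -[RHS]/(a *: u + v, a *: 0 + 0) scaler0 addr0.
  by move=> x; apply: cvg_pair; [exact: cvg_id|exact: cvg_cst].
- apply: (@Ck_lin_comp _ _ (F * G)%type _ _ (fun y => (0, y)) g) => //.
    by move=> a u v; rewrite -[RHS]/(a *: 0 + 0, a *: u + v) scaler0 addr0.
  by move=> x; apply: cvg_pair; [exact: cvg_cst|exact: cvg_id].
Qed.

Lemma fc_continuous E n (B : fbasis E n) i : continuous (fc B i : E -> R^o).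
Proof. by apply: (lin_continuous B); exact: linearP. Qed.

(** By the chain rule, the derivative of the composite along [v] is the sum of the coordinates of
    [D_v f] times [D_(b_i) g] at [f x]; both factors are of class C^k by induction. The basis of [F]
    serves this expansion. *)
Lemma Ck_comp E F G n (B : fbasis F n) k (U : set E) (W : set F) (f : E -> F)
    (g : F -> G) : open U -> open W -> (forall x, U x -> W (f x)) ->
  Ck_on k U f -> Ck_on k W g -> Ck_on k U (fun x => g (f x)).
Proof.
move=> oU oW UW; elim: k f g UW => [f g UW cf cg x Ux|k IH f g UW Cf [dg cg]].
  by apply: continuous_comp; [exact: cf|apply/cg/UW].
have [df cf] := Cf; have D x : U x -> is_diff x (g \o f) ('d g (f x) \o 'd f x).
  move=> Ux; apply: is_diff_comp; first exact/differentiableP/df.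
  exact/differentiableP/dg/UW.
split=> [x Ux|v]; first by have [] := D x Ux.
apply: (Ck_eq oU (f := fun x => \sum_(i < n)
    (fc B i ('D_v f x) : R) *: 'D_(fb B i) g (f x))).
  move=> x Ux; have [d E1] := D x Ux; rewrite (deriveE _ d) E1 /=.
  rewrite [in RHS](fbK B ('d f x v)) linear_sum; apply: eq_bigr => i _.
  rewrite linearZ (deriveE v (df _ Ux)) deriveE//; exact/dg/UW.
apply: Ck_sum => // i; apply: Ck_scale => //.
  apply: (@Ck_lin_comp _ _ R^o _ _ (fc B i)) => //; [exact: linearP|exact: fc_continuous|exact: cf].
by apply: (IH f ('D_(fb B i) g)) => //; [exact: Ck_leS|exact: cg].
Qed.

Lemma Ck_coord E F n (B : fbasis F n) k (U : set E) (f : E -> F) : open U ->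
  (forall i, Ck_on k U (fun x => fc B i (f x) : R)) -> Ck_on k U f.
Proof.
move=> oU H.
rewrite (_ : f = fun x => \sum_(i < n) (fc B i (f x) : R) *: fb B i); last first.
  by apply/funext => x; rewrite -fbK.
by apply: Ck_sum => // i; apply: Ck_scale => //; exact: Ck_cst.
Qed.

Lemma Ck_M E k (U : set E) (f g : E -> R) : open U ->
  Ck_on k U f -> Ck_on k U g -> Ck_on k U (fun x => f x * g x).
Proof. exact: (@Ck_scale E R). Qed.

Lemma Ck_prod E k (U : set E) (I : Type) (r : seq I) (f : I -> E -> R) : open U ->
  (forall i, Ck_on k U (f i)) -> Ck_on k U (fun x => \prod_(i <- r) f i x).
Proof.
move=> oU H; elim: r => [|i r IH].
  by rewrite (_ : (fun x => _) = fun=> 1); [exact: Ck_cst|apply/funext => x; exact: big_nil].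
rewrite (_ : (fun x => _) = fun x => f i x * \prod_(j <- r) f j x); first exact: Ck_M.
by apply/funext => x; rewrite big_cons.
Qed.

Lemma Ck_det E k (U : set E) m (A : E -> 'M[R]_m) : open U ->
  (forall i j, Ck_on k U (fun x => A x i j)) -> Ck_on k U (fun x => \det (A x)).
Proof.
move=> oU H; apply: Ck_sum => // s; apply: Ck_M => //; first exact: Ck_cst.
exact: Ck_prod.
Qed.

(* Cramer's rule expresses the inverse through determinants. *)
Lemma Ck_inverse E F n (B : fbasis F n) k (U : set E) (A N : E -> F -> F) :
  open U -> (forall x, U x -> linear (A x)) ->
  (forall x, U x -> forall v, A x v = 0 -> v = 0) ->
  (forall x, U x -> forall v, A x (N x v) = v) ->
  (forall v, Ck_on k U (fun x => A x v)) -> forall v, Ck_on k U (fun x => N x v).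
Proof.
move=> oU lA iA AN CA v.
pose M x : 'M[R]_n := \matrix_(i, j) (fc B i (A x (fb B j)) : R).
have CM i j : Ck_on k U (fun x => M x i j).
  apply: (Ck_eq oU (f := fun x => fc B i (A x (fb B j)) : R)).
    by move=> x _; rewrite mxE.
  apply: (@Ck_lin_comp _ _ R^o _ _ (fc B i)) => //; first exact: linearP.
  exact: fc_continuous.
have MA x (t : 'cV[R]_n) : U x -> forall i,
    (M x *m t) i 0 = fc B i (A x (\sum_(j < n) t j 0 *: fb B j)).
  move=> Ux i; rewrite mxE (lin_sum (lA x Ux)) linear_sum; apply: eq_bigr => j _.
  by rewrite mxE (linZ (lA x Ux)) linearZ mulrC.
(* [kermx] is the left kernel, hence the transposition. *)
have uM x : U x -> M x \in unitmx.
  move=> Ux; rewrite -unitmx_tr -row_free_unit -kermx_eq0.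
  apply/eqP/row_matrixP => i; rewrite row0.
  set t := row i _; have tM : t *m (M x)^T = 0 by rewrite -row_mul mulmx_ker row0.
  have Mt : M x *m t^T = 0 by rewrite -[M x]trmxK -trmx_mul tM trmx0.
  have /(iA x Ux) t0 : A x (\sum_(j < n) t^T j 0 *: fb B j) = 0.
    rewrite [LHS](fbK B) big1// => j _.
    have := congr1 (fun s : 'cV[R]_n => s j 0) Mt; rewrite MA// mxE => ->.
    exact: scale0r.
  apply/rowP => j; rewrite [RHS]mxE.
  have := congr1 (fc B j) t0; rewrite linear0 linear_sum (bigD1 j)//= big1 ?addr0.
    by rewrite linearZ fcb eqxx [t^T _ _]mxE => h; rewrite -[LHS]mulr1.
  by move=> l lj; rewrite linearZ fcb eq_sym (negPf lj); exact: mulr0.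
apply: (@Ck_coord _ _ _ B _ _ (fun x => N x v) oU) => i; pose c : 'cV[R]_n := \col_j (fc B j v : R).
apply: (Ck_eq oU (f := fun x => (\det (M x))^-1 * \sum_(j < n) \adj (M x) i j * c j 0)).
  move=> x Ux; pose s : 'cV[R]_n := \col_j (fc B j (N x v) : R).
  have Ms : M x *m s = c.
    apply/colP => j; rewrite MA// mxE -[in RHS](AN x Ux v); congr (fc B j (A x _)).
    by rewrite [RHS](fbK B); apply: eq_bigr => l _; rewrite mxE.
  have <- : s i 0 = fc B i (N x v) by rewrite mxE.
  rewrite -(mulKmx (uM x Ux) s) Ms /invmx (uM x Ux) -scalemxAl !mxE.
  by congr (_ * _).
apply: Ck_M => //.
  apply: Ck_V => //; last exact: Ck_det.
  by move=> x Ux; rewrite -unitfE -unitmxE; exact: uM.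
apply: Ck_sum => // j; apply: Ck_M => //; last exact: Ck_cst.
apply: (Ck_eq oU (f := fun x => (-1) ^+ (j + i) * \det (row' j (col' i (M x))))).
  by move=> x _; rewrite mxE.
apply: Ck_M => //; first exact: Ck_cst.
apply: Ck_det => // a b; apply: (Ck_eq oU (f := fun x => M x (lift j a) (lift i b))) => //.
by move=> x _; rewrite !mxE.
Qed.

End CkCalculus.

(** * Connectedness *)

Section Connectedness.

(** The points of [A] that satisfy [P] form a relatively open and relatively closed set. Orbits,
    ranges and constants are spread over connected sets by this principle. *)
Lemma connected_ind (T : topologicalType) (A : set T) (P : T -> Prop) (x0 : T) :
  connected A -> (forall x, A x -> \forall y \near x, A y -> (P y <-> P x)) ->
  A x0 -> P x0 -> forall x, A x -> P x.
Proof.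
move=> cA loc Ax0 Px0; pose C1 := [set y | A y -> P y]°.
pose C2 := ~` [set y | A y -> ~ P y]°.
have AC1 : A `&` P = A `&` C1.
  apply/seteqP; split => [x [Ax Px]|x [Ax /nbhs_singleton /(_ Ax)]//].
  split=> //; apply: filterS (loc x Ax) => y H Ay; exact/(H Ay).
have AC2 : A `&` P = A `&` C2.
  apply/seteqP; split => [x [Ax Px]|x [Ax /= nx]]; split => //.
    by move=> /= /nbhs_singleton /(_ Ax).
  apply: contrapT => nPx; apply: nx.
  by apply: filterS (loc x Ax) => y H Ay Py; apply: nPx; exact/(H Ay).
have <- : A `&` P = A.
  apply: cA; first by exists x0.
  - by exists C1 => //; exact: open_interior.
  - by exists C2 => //; exact/open_closedC/open_interior.
by move=> x [].
Qed.

(** The ball is the union of the segments issuing from its centre. *)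
Lemma ball_connected (R : realType) (E : normedModType R) (x : E) (r : R) :
  connected (ball x r).
Proof.
have [r0|r0] := ltP 0 r; last first.
  suff -> : ball x r = set0 by exact: connected0.
  apply/seteqP; split => // y; rewrite -ball_normE /= => xy.
  by have := le_lt_trans (normr_ge0 _) (lt_le_trans xy r0); rewrite ltxx.
pose S (y : E) := (fun t : R => x + t *: (y - x)) @` `[0, 1].
have -> : ball x r = \bigcup_(y in ball x r) S y.
  apply/seteqP; split => [y xy|_ [y xy [t t01 <-]]].
    by exists y => //; exists 1; rewrite ?scale1r ?subrKC//= in_itv /= ler01 lexx.
  move: t01; rewrite /= in_itv /= => /andP[t0 t1].
  move: xy; rewrite -ball_normE /= opprD addrA subrr sub0r normrN normrZ distrC.
  by apply: le_lt_trans; rewrite ger0_norm// ler_piMl.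
apply: bigcup_connected.
  exists x => y _; exists 0; rewrite ?scale0r ?addr0//= in_itv /=.
  by rewrite lexx ler01.
move=> y _; apply: connected_continuous_connected; first exact: segment_connected.
apply: continuous_subspaceT => t; apply: cvgD; first exact: cvg_cst.
exact: scalel_continuous.
Qed.

End Connectedness.

(** * The mean value theorem on segments *)

Section MeanValue.
Context {R : realType} {E : normedModType R}.

Lemma segment_MVT (f : E -> R) (x v : E) :
  (forall t : R, 0 <= t <= 1 -> differentiable f (x + t *: v)) ->
  exists2 t : R, 0 < t < 1 & f (x + v) - f x = 'd f (x + t *: v) v.
Proof.
move=> df; pose g (t : R) : R := f (x + t *: v).
have Dl (t : R) : is_diff t (fun t : R => x + t *: v) (fun s => s *: v).
  apply: (@is_diff_eq _ _ _ _ ((0 : R -> E) + (fun s => s *: v))).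
    by apply/funext => s; rewrite fctE add0r.
have Dg (t : R) : 0 <= t <= 1 -> is_derive t 1 g ('d f (x + t *: v) v).
  move=> t01; have D : is_diff t g ('d f (x + t *: v) \o (fun s => s *: v)).
    by apply: is_diff_comp; exact/differentiableP/df.
  apply: DeriveDef; first by apply: diff_derivable; case: D.
  by case: D => d E1; rewrite (deriveE _ d) E1 /= scale1r.
have [||t t01] := @MVT R g (fun t => 'd f (x + t *: v) v) 0 1 ltr01.
- move=> t; rewrite in_itv /= => /andP[t0 t1]; apply: Dg; rewrite ltW// ltW//.
- apply: continuous_in_subspaceT => t; rewrite inE /= in_itv /= => t01.
  have [d _] := Dg _ t01; apply: differentiable_continuous.
  exact/derivable1_diffP.
move: t01; rewrite in_itv /= => t01; rewrite /g scale1r scale0r addr0 subr0 mulr1.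
by exists t.
Qed.

Lemma ball_segment (c x y : E) (r t : R) : ball c r x -> ball c r y ->
  0 <= t <= 1 -> ball c r (x + t *: (y - x)).
Proof.
rewrite -ball_normE /= => cx cy /andP[t0 t1].
have -> : c - (x + t *: (y - x)) = (1 - t) *: (c - x) + t *: (c - y).
  have -> : y - x = (c - x) - (c - y) by rewrite opprB [RHS]addrC addrA subrK.
  by rewrite opprD addrA scalerBr scalerBl scale1r opprB addrA addrAC.
apply: (le_lt_trans (ler_normD _ _)); rewrite !normrZ.
rewrite (ger0_norm t0) ger0_norm ?subr_ge0//.
have [t00|t00] := eqVneq t 0.
  by rewrite t00 mul0r addr0 subr0 mul1r.
have {}t00 : 0 < t by rewrite lt0r t00.
apply: (@lt_le_trans _ _ ((1 - t) * r + t * r)); last by rewrite -mulrDl subrK mul1r.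
by apply: ler_ltD; [rewrite ler_wpM2l ?subr_ge0// ltW|rewrite ltr_pM2l].
Qed.

Lemma ball_diff0 (f : E -> R) (c : E) (r : R) :
  (forall x, ball c r x -> is_diff x f 0) ->
  forall x y, ball c r x -> ball c r y -> f x = f y.
Proof.
move=> f0 x y cx cy.
have [t t01|t /andP[t0 t1]] := @segment_MVT f x (y - x).
  by have [] := f0 _ (ball_segment cx cy t01).
have [_ ->] : is_diff (x + t *: (y - x)) f 0.
  by apply/f0/ball_segment => //; rewrite !ltW.
by rewrite subrKC => /eqP; rewrite subr_eq0 => /eqP.
Qed.

End MeanValue.

(** * The inverse function theorem *)

Section InverseFunction.
Context {R : realType} {E : normedModType R} {n : nat} (B : fbasis E n).

(** Continuity of the partial derivatives keeps the differential on a small ball uniformly close to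
    the one at [x0]; the mean value theorem, valid for scalar functions only, is applied to each
    coordinate of [f]. *)
Lemma Ck1_strict (F : normedModType R) m (B' : fbasis F m) (U : set E)
    (f : E -> F) (x0 : E) (e : R) :
  open U -> U x0 -> Ck_on 1 U f -> 0 < e ->
  exists r : R, [/\ 0 < r, ball x0 r `<=` U & forall u v, ball x0 r u -> ball x0 r v ->
    `|f u - f v - 'd f x0 (u - v)| <= e * `|u - v|].
Proof.
move=> oU Ux0 [df cf] e0.
have [C C0 hC] := fc_bounded B; have [C' C'0 hC'] := fc_bounded B'.
pose b := 1 + \sum_(i < m) `|fb B' i|.
have b0 : 0 < b by rewrite ltr_wpDr// sumr_ge0.
(* [d] absorbs three losses: [n C] from expanding the direction in [B], [C'] from reading a
   coordinate, and [b] from reassembling the coordinates. *)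
have [d dE] : exists d, d = e / (b * C' * (1 + n%:R * C)) by eexists.
have nC : 0 <= n%:R * C by apply: mulr_ge0 => //; exact: ltW.
have c0 : 0 < 1 + n%:R * C by rewrite ltr_wpDr.
have d0 : 0 < d by rewrite dE divr_gt0// !mulr_gt0.
have near_d : \forall y \near x0, forall j : 'I_n,
    `|'D_(fb B j) f y - 'D_(fb B j) f x0| <= d.
  apply: filter_forall => j.
  have /cvgrPdist_le/(_ d d0) := cf (fb B j) x0 Ux0.
  by apply: filterS => y; rewrite distrC.
have /nbhs_ballP[r /= r0 hr] : nbhs x0 [set y | U y /\ forall j : 'I_n,
    `|'D_(fb B j) f y - 'D_(fb B j) f x0| <= d].
  by apply: filterI near_d; exact: open_nbhs_nbhs.
exists r; split => [//|y /hr[]//|u v ru rv].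
have est y w : ball x0 r y -> `|'d f y w - 'd f x0 w| <= n%:R * C * d * `|w|.
  move=> ry; have [Uy dy] := hr _ ry.
  have dsum z : U z -> 'd f z w = \sum_(j < n) (fc B j w : R) *: 'D_(fb B j) f z.
    move=> Uz; rewrite {1}(fbK B w) linear_sum; apply: eq_bigr => j _.
    by rewrite linearZ deriveE//; exact: df.
  rewrite !dsum// -sumrB.
  apply: (le_trans (ler_norm_sum _ _ _)).
  rewrite -!mulrA mulr_natl -[X in _ *+ X]card_ord -sumr_const.
  apply: ler_sum => j _; rewrite -scalerBr normrZ.
  by rewrite [leRHS]mulrCA [leRHS]mulrC; apply: ler_pM.
have coo i : `|fc B' i (f u - f v - 'd f x0 (u - v)) : R| <= C' * (n%:R * C * d * `|u - v|).
  have hi z : differentiable f z -> is_diff z (fun y => fc B' i (f y) : R) (fun w => fc B' i ('d f z w)).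
    move=> dy; apply: (@is_diff_comp _ _ _ _ f ('d f z) (fc B' i) (fc B' i)).
      exact: differentiableP.
    by apply: is_diff_lin; [exact: linearP|exact: fc_continuous].
  have bs t : 0 <= t <= 1 -> ball x0 r (v + t *: (u - v)) by exact: ball_segment.
  have [t t01|t t01] := @segment_MVT _ _ (fun y => fc B' i (f y) : R) v (u - v).
    by have /df /hi [] : U (v + t *: (u - v)) by have [] := hr _ (bs t t01).
  have t01' : 0 <= t <= 1 by case/andP: t01 => *; rewrite !ltW.
  have /df /hi [_ ->] : U (v + t *: (u - v)) by have [] := hr _ (bs t t01').
  rewrite subrKC => E1; rewrite !linearB /= in E1 *; rewrite E1 -!linearB.
  apply: (le_trans (hC' _ _)); apply: ler_wpM2l; first exact: ltW.
  by apply: le_trans (est _ _ (bs t t01')).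
rewrite [X in `|X|](fbK B'); apply: (le_trans (ler_norm_sum _ _ _)).
apply: (@le_trans _ _ (\sum_(i < m) C' * (n%:R * C * d * `|u - v|) * `|fb B' i|)).
  by apply: ler_sum => i _; rewrite normrZ; apply: ler_wpM2r.
rewrite -mulr_sumr; set s := \sum_(i < m) _.
have s0 : 0 <= s by exact: sumr_ge0.
have -> : e = d * (b * C' * (1 + n%:R * C)) by rewrite dE divfK// gt_eqF// !mulr_gt0.
have -> : C' * (n%:R * C * d * `|u - v|) * s = (d * `|u - v| * C') * ((n%:R * C) * s) by ring.
have -> : d * (b * C' * (1 + n%:R * C)) * `|u - v| = (d * `|u - v| * C') * ((1 + n%:R * C) * b) by ring.
apply: ler_wpM2l; first by rewrite !mulr_ge0// ltW.
by apply: ler_pM => //; rewrite /b ?lerDr// ler_wpDl.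
Qed.

(* A minimiser [u] of the residual [|y - Phi u|] on a compact ball must solve
   [Phi u = y], since the Newton step [u + (y - Phi u)] halves the residual. *)
Lemma strict_surjective (Phi : E -> E) (r : R) : 0 < r ->
  (forall u v, `|u| <= r -> `|v| <= r ->
     `|Phi u - Phi v - (u - v)| <= 2^-1 * `|u - v|) ->
  forall y, `|y - Phi 0| <= r / 8 -> exists2 u, `|u| <= r & Phi u = y.
Proof.
move=> r0 hP y hy; pose K := [set x : E | `|x| <= r].
have K0 : K !=set0 by exists 0; rewrite /K /= normr0 ltW.
have Lip u v : `|u| <= r -> `|v| <= r -> `|Phi u - Phi v| <= 2 * `|u - v|.
  move=> ur vr; rewrite -(subrK (u - v) (Phi u - Phi v)).
  apply: (le_trans (ler_normD _ _)); have := hP u v ur vr.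
  have := normr_ge0 (u - v); lra.
have [|u /set_mem ur umin] :=
    @compact_EVT_min E R (fun u => `|y - Phi u|) K K0 (@norm_ball_compact _ _ _ B r).
  apply/subspace_continuousP => u Ku; apply/cvgrPdist_le => e e0.
  have : \forall v \near within K (nbhs u), `|u - v| <= e / 2.
    apply: cvg_within; have /cvgrPdist_le := @cvg_id _ (nbhs u).
    by apply; rewrite divr_gt0.
  apply: filterS2 (withinT K (nbhs_filter u)) => v Kv uv.
  apply: (le_trans (ler_dist_dist _ _)); rewrite opprB addrC addrA subrK distrC.
  by apply: (le_trans (Lip _ _ Ku Kv)); rewrite mulrC -ler_pdivlMr.
set rho := y - Phi u; rewrite /K /= in ur.
have n0 : `|(0 : E)| <= r by rewrite normr0 ltW.
have rho8 : `|rho| <= r / 8.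
  by apply: le_trans hy; apply: umin; apply/mem_set.
(* Origin of the factor 8: [|u| <= |u|/2 + 2 r/8] gives [|u| <= r/2], so a Newton step of length at
   most [r/8] stays in the ball. *)
have u2 : `|u| <= r / 2.
  have := hP u 0 ur n0; rewrite subr0 => h.
  have : `|u| <= `|Phi u - Phi 0 - u| + `|Phi u - Phi 0|.
    rewrite -[X in X <= _]normrN -[X in `|X| <= _](addrK (Phi u - Phi 0)).
    by rewrite [- u + _]addrC; exact: ler_normB.
  have : `|Phi u - Phi 0| <= `|y - Phi 0| + `|rho|.
    by rewrite -[X in `|X| <= _](subrKA y) addrC -[Phi u - y]opprB; exact: ler_normB.
  by move=> h1 h2; lra.
have urho : `|u + rho| <= r by apply: (le_trans (ler_normD _ _)); lra.
have := hP (u + rho) u urho ur; rewrite [u + rho]addrC addrK => h.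
have /umin : u + rho \in K by apply/mem_set.
have -> : y - Phi (u + rho) = - (Phi (rho + u) - Phi u - rho).
  by rewrite [u + rho]addrC [RHS]opprB opprB addrA subrK.
rewrite normrN -/rho => h2.
have rho0 : `|rho| <= 0 by have := normr_ge0 rho; lra.
exists u => //; move: rho0; rewrite normr_le0 subr_eq0 => /eqP.
by move=> ->.
Qed.

(** Composition with the inverse [N] of the differential, whose norm is at most [C], makes the
    strict estimate with tolerance [1/(2C)] into a perturbation of the identity by 1/2. Openness
    then comes from [strict_surjective], and the inverse has Lipschitz constant [2C]. *)
Lemma local_inverse (U : set E) (f : E -> E) (x0 : E) :
  open U -> U x0 -> Ck_on 1 U f -> injective ('d f x0) ->
  (forall W, nbhs x0 W -> nbhs (f x0) (f @` W)) /\
  exists r C : R, [/\ 0 < r, 0 < C, ball x0 r `<=` U &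
    forall u v, ball x0 r u -> ball x0 r v -> `|u - v| <= C * `|f u - f v|].
Proof.
move=> oU Ux0 cf dfi.
have [N [Nlin NK KN]] : exists N, [/\ linear N, cancel ('d f x0) N & cancel N ('d f x0)].
  apply: (lin_inj_bij B); first exact: linearP.
  by move=> x h; apply: dfi; rewrite h linear0.
have [C C0 hC] := lin_bounded B Nlin.
have e0 : 0 < (2 * C)^-1 by rewrite invr_gt0 mulr_gt0.
have [r [r0 rU hr]] := Ck1_strict B oU Ux0 cf e0.
have key u v : ball x0 r u -> ball x0 r v ->
    `|N (f u) - N (f v) - (u - v)| <= 2^-1 * `|u - v|.
  move=> ru rv; rewrite -[X in _ - X]NK -!(linB Nlin).
  apply: (le_trans (hC _)); rewrite -ler_pdivlMl//.
  by apply: (le_trans (hr _ _ ru rv)); rewrite invfM [2^-1 * C^-1]mulrC -mulrA.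
split; last first.
  exists r, (2 * C); split => //; first by rewrite mulr_gt0.
  move=> u v ru rv; have h := key u v ru rv.
  have : `|u - v| <= `|N (f u) - N (f v) - (u - v)| + `|N (f u) - N (f v)|.
    rewrite -[X in X <= _]normrN -[X in `|X| <= _](addrK (N (f u) - N (f v))).
    by rewrite [- (u - v) + _]addrC; exact: ler_normB.
  by have := hC (f u - f v); rewrite (linB Nlin) => h1 h2; lra.
move=> W /nbhs_ballP[s /= s0 sW]; pose q := Num.min s r / 2.
have q0 : 0 < q by rewrite divr_gt0// lt_min s0 r0.
have qs : q < s by rewrite ltr_pdivrMr// gt_min; apply/orP; left; lra.
have qr : q < r by rewrite ltr_pdivrMr// gt_min; apply/orP; right; lra.
pose Phi u := N (f (x0 + u)).
have inb t u : q < t -> `|u| <= q -> ball x0 t (x0 + u).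
  move=> qt uq; rewrite -ball_normE /= opprD addrA subrr sub0r normrN.
  exact: le_lt_trans qt.
have hPhi u v : `|u| <= q -> `|v| <= q ->
    `|Phi u - Phi v - (u - v)| <= 2^-1 * `|u - v|.
  move=> uq vq; have := key _ _ (inb _ _ qr uq) (inb _ _ qr vq).
  by have -> : x0 + u - (x0 + v) = u - v by rewrite opprD addrACA subrr add0r.
have surj := strict_surjective q0 hPhi.
apply/nbhs_ballP; exists (q / 8 / C) => /=; first by rewrite divr_gt0// divr_gt0// ltr0n.
move=> z; rewrite -ball_normE /= distrC => hz.
have [|u uq Nu] := surj (N z).
  rewrite /Phi addr0 -(linB Nlin); apply: (le_trans (hC _)).
  by rewrite mulrC -ler_pdivlMr// ltW.
exists (x0 + u); first by apply/sW/inb.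
by rewrite -[LHS]KN -[RHS]KN; congr ('d f x0 _).
Qed.

(* A continuous right inverse is differentiable, with differential
   [N (sigma y)], and this formula bootstraps its regularity. *)
Lemma Ck_right_inverse (U O : set E) (f sigma : E -> E) k :
  open U -> (forall k, Ck_on k U f) -> (forall x, U x -> injective ('d f x)) ->
  open O -> (forall y, O y -> U (sigma y)) -> (forall y, O y -> f (sigma y) = y) ->
  (forall y, O y -> {for y, continuous sigma}) -> Ck_on k O sigma.
Proof.
move=> oU cf dfi oO OU fs cs.
have /choice[N hN] : forall x, exists N, U x ->
    [/\ linear N, cancel ('d f x) N & cancel N ('d f x)].
  move=> x; have [Ux|nUx] := pselect (U x); last by exists id.
  have [N hN] : exists N, [/\ linear N, cancel ('d f x) N & cancel N ('d f x)].
    apply: (lin_inj_bij B); first exact: linearP.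
    by move=> v h; apply: (dfi x Ux); rewrite h linear0.
  by exists N.
have D y : O y -> is_diff y sigma (N (sigma y)).
  move=> Oy; have [Nlin NK KN] := hN _ (OU y Oy).
  have [C C0 hC] := lin_bounded B Nlin.
  apply: is_diff_near => //; first exact: (lin_continuous B).
  move=> e e0; have [_ [r [C' [r0 C'0 rU hr]]]] :=
    local_inverse oU (OU y Oy) (cf 1%N) (dfi _ (OU y Oy)).
  (* The tolerance is divided by the bound [C] of [N] and by the Lipschitz constant [C'] of
     [sigma]. *)
  have d0 : 0 < e / (C * C') by rewrite divr_gt0// mulr_gt0.
  have [s [s0 sU hs]] := Ck1_strict B oU (OU y Oy) (cf 1%N) d0.
  have nO : \forall h \near 0, O (y + h) by apply: (proj1 (nbhs0P O y)); exact: open_nbhs_nbhs.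
  have nb t : 0 < t -> \forall h \near 0, ball (sigma y) t (sigma (y + h)).
    move=> t0; apply: (proj1 (nbhs0P (fun z => ball (sigma y) t (sigma z)) y)).
    by apply: (cs y Oy); exact: nbhsx_ballx.
  near=> h.
  have Oh : O (y + h) by near: h.
  have rh : ball (sigma y) r (sigma (y + h)) by near: h; exact: nb.
  have sh : ball (sigma y) s (sigma (y + h)) by near: h; exact: nb.
  have := hr _ _ rh (ballxx _ r0); rewrite !fs// [y + h]addrC addrK => k1.
  have := hs _ _ sh (ballxx _ s0); rewrite !fs// [y + h]addrC addrK.
  set w := sigma (h + y) - sigma y => k2.
  rewrite -/w.
  have -> : w - N (sigma y) h = - N (sigma y) (h - 'd f (sigma y) w).
    by rewrite (linB Nlin) NK opprB.
  rewrite normrN; apply: (le_trans (hC _)).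
  rewrite -ler_pdivlMl//; apply: (le_trans k2).
  apply: (@le_trans _ _ (e / (C * C') * (C' * `|h|))).
    by apply: ler_wpM2l; [exact: ltW|exact: k1].
  rewrite (_ : _ * _ = C^-1 * (e * `|h|))//; field.
  by rewrite !gt_eqF.
have dE y v : O y -> 'd f (sigma y) v = 'D_v f (sigma y).
  by move=> /OU Us; rewrite deriveE//; have [df _] := cf 1%N; exact: df.
have CN k' v : Ck_on k' U (fun x => N x v).
  apply: (@Ck_inverse _ E E n B k' U (fun x => 'd f x) N oU).
  - by move=> x _; exact: linearP.
  - by move=> x Ux w h; apply: (dfi x Ux); rewrite h linear0.
  - by move=> x Ux w; have [_ _ ->] := hN x Ux.
  - move=> w; have [df _] := cf 1%N.
    apply: (Ck_eq oU (f := 'D_w f)); last by have [_] := cf k'.+1; exact.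
    by move=> x Ux; rewrite deriveE//; exact: df.
elim: k => [|k IH]; first exact: cs.
split=> [y Oy|v]; first by have [] := D y Oy.
apply: (Ck_eq oO (f := fun y => N (sigma y) v)).
  by move=> y Oy; have [d E1] := D y Oy; rewrite (deriveE _ d) E1.
exact: (@Ck_comp _ _ _ _ _ B k O U sigma (fun x => N x v)).
Unshelve. all: by end_near. Qed.

End InverseFunction.

Section Coordinates.
Context {R : realType} {E : normedModType R} {n : nat} (B : fbasis E n).

Lemma fcD i x y : fc B i (x + y) = (fc B i x : R) + fc B i y.
Proof. exact: linearD. Qed.
Lemma fcB i x y : fc B i (x - y) = (fc B i x : R) - fc B i y.
Proof. exact: linearB. Qed.
Lemma fcN i x : fc B i (- x) = - (fc B i x : R).
Proof. exact: linearN. Qed.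
Lemma fcZ i a x : fc B i (a *: x) = a * (fc B i x : R).
Proof. exact: linearZ. Qed.
Lemma fc0 i : fc B i 0 = 0 :> R.
Proof. exact: linear0. Qed.
Lemma fcMn i x k : fc B i (x *+ k) = (fc B i x : R) *+ k.
Proof. exact: linearMn. Qed.
Definition fcE := (fcD, fcB, fcN, fcZ, fc0, fcMn).

Lemma fc_ext x y : (forall i, fc B i x = fc B i y :> R) -> x = y.
Proof.
by move=> H; rewrite (fbK B x) (fbK B y); apply: eq_bigr => i _; rewrite H.
Qed.

Lemma norm_fc : exists2 C, 0 < C & forall x, `|x| <= C * \sum_(i < n) `|fc B i x : R|.
Proof.
exists (1 + \sum_(i < n) `|fb B i|); first by rewrite ltr_wpDr// sumr_ge0.
move=> x; rewrite {1}(fbK B x); apply: (le_trans (ler_norm_sum _ _ _)).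
rewrite mulr_sumr; apply: ler_sum => i _; rewrite normrZ mulrC.
apply: ler_wpM2r => //; rewrite (bigD1 i)//= addrCA lerDl addr_ge0// sumr_ge0//.
Qed.

Lemma cvg_fc (T : Type) (F : set_system T) (FF : Filter F) (s : T -> E) (l : E) :
  (forall i, (fc B i (s x) : R) @[x --> F] --> (fc B i l : R)) -> s @ F --> l.
Proof.
move=> H; rewrite (fbK B l) (_ : s = fun x => \sum_(i < n) (fc B i (s x) : R) *: fb B i).
  apply: cvg_big => [|i _]; first exact: add_continuous.
  by apply: cvgZ; [exact: H|exact: cvg_cst].
by apply/funext => x; exact: fbK.
Qed.

(** Completeness is taken from [R]: each coordinate series converges absolutely, and the limits are
    reassembled along the basis. *)
Lemma series_norm_cvg (u : nat -> E) (a : nat -> R) :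
  (forall k, `|u k| <= a k) -> cvgn (series a) ->
  series u @ \oo --> limn (series u).
Proof.
move=> ua ca; have [C C0 hC] := fc_bounded B.
have ci i : cvgn (series (fun k => fc B i (u k) : R)).
  apply: normed_cvg.
  apply: (@series_le_cvg _ _ (fun k => C * a k)) => [k|k|k|] //=.
  - apply: mulr_ge0; first exact: ltW.
    by apply: le_trans (ua k).
  - by apply: (le_trans (hC _ _)); rewrite ler_pM2l.
  rewrite (_ : series _ = C \*: series a); first exact: is_cvgZr.
  by apply/funext => N; rewrite [RHS]mulr_sumr.
pose l : E := \sum_(i < n) limn (series (fun k => fc B i (u k) : R)) *: fb B i.
have fl i : fc B i l = limn (series (fun k => fc B i (u k) : R)).
  rewrite /l linear_sum (bigD1 i)//= big1 ?addr0.
    by rewrite linearZ fcb eqxx; exact: mulr1.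
  by move=> j ji; rewrite linearZ fcb eq_sym (negPf ji); exact: mulr0.
have ul : series u @ \oo --> l.
  apply: cvg_fc => i; rewrite fl.
  rewrite (_ : (fun x => _) = series (fun k => fc B i (u k) : R)); first exact: ci.
  by apply/funext => N; rewrite /series/= linear_sum.
by rewrite (cvg_lim _ ul).
Qed.

End Coordinates.

Lemma cvg_norm_le (R : realType) (E : normedModType R) (s : nat -> E) (l a : E) (e : R) :
  s @ \oo --> l -> (\forall N \near \oo, `|s N - a| <= e) -> `|l - a| <= e.
Proof.
move=> sl H; have : `|s N - a| @[N --> \oo] --> `|l - a|.
  by apply: cvg_norm; apply: cvgB => //; exact: cvg_cst.
by move=> /cvgr_to_le; apply.
Qed.

(** * Differentiable curves and Gronwall estimates *)

Section Curves.
Context {R : realType}.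
Implicit Types E F G : normedModType R.

(** The velocity is recorded as the differential [s *: v], so that the chain and product rules of
    [is_diff] apply as they stand. *)
Definition curve_diff F (y : R -> F) (t : R) (v : F) := is_diff t y (fun s => s *: v).

Lemma is_diff_congr E F (x : E) (f g df dg : E -> F) :
  f =1 g -> df =1 dg -> is_diff x f df -> is_diff x g dg.
Proof. by move=> /funext -> /funext ->. Qed.

Lemma is_diff_sum E F (x : E) (I : Type) (r : seq I) (f df : I -> E -> F) :
  (forall i, is_diff x (f i) (df i)) ->
  is_diff x (fun y => \sum_(i <- r) f i y) (fun w => \sum_(i <- r) df i w).
Proof.
move=> H; elim: r => [|i r IH].
  apply: is_diff_congr (is_diff_cst (0 : F) x); first by move=> y; rewrite big_nil.
  by move=> w; rewrite big_nil.
apply: is_diff_congr (is_diffD (H i) IH).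
  by move=> y; rewrite big_cons.
by move=> w; rewrite big_cons.
Qed.

Lemma curve_diffP F (y : R -> F) t v : is_derive t (1 : R) y v <-> curve_diff y t v.
Proof.
split=> [[d <-]|[d dE]].
  have /derivable1_diffP dy := d; apply: DiffDef => //; apply/funext => s.
  by rewrite deriveE// -{1}[s]mulr1 -[s * 1]/(s *: (1 : R)) linearZ.
by apply: DeriveDef; [exact/derivable1_diffP|rewrite deriveE// dE scale1r].
Qed.

Lemma curve_diff_derive1 F (y : R -> F) t v : curve_diff y t v -> derive1 y t = v.
Proof. by move=> /curve_diffP[_ <-]; rewrite derive1E. Qed.

Lemma curve_diff_cst F (a : F) t : curve_diff (fun=> a) t 0.
Proof.
by apply: is_diff_congr (is_diff_cst a t) => // s; rewrite scaler0.
Qed.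

Lemma curve_diff_eq F (y : R -> F) t v w : v = w -> curve_diff y t v -> curve_diff y t w.
Proof. by move=> ->. Qed.

Lemma curve_diffD F (y z : R -> F) t v w : curve_diff y t v -> curve_diff z t w ->
  curve_diff (fun s => y s + z s) t (v + w).
Proof.
move=> dy dz; apply: is_diff_congr (is_diffD dy dz) => // s.
by rewrite /= scalerDr.
Qed.

Lemma curve_diffN F (y : R -> F) t v : curve_diff y t v ->
  curve_diff (fun s => - y s) t (- v).
Proof.
move=> dy; apply: is_diff_congr (is_diffN dy) => // s.
by rewrite /= scalerN.
Qed.

Lemma curve_diffB F (y z : R -> F) t v w : curve_diff y t v -> curve_diff z t w ->
  curve_diff (fun s => y s - z s) t (v - w).
Proof. by move=> dy /curve_diffN; exact: curve_diffD. Qed.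

Lemma curve_diff_comp E F (y : R -> E) (f df : E -> F) t v :
  curve_diff y t v -> is_diff (y t) f df -> curve_diff (fun s => f (y s)) t (df v).
Proof.
move=> dy df'; apply: is_diff_congr (is_diff_comp dy df') => // s.
by have [_ <-] := df'; exact: linearZ.
Qed.

Lemma curve_diff_lin E F (y : R -> E) (l : E -> F) t v :
  linear l -> continuous l -> curve_diff y t v -> curve_diff (fun s => l (y s)) t (l v).
Proof.
by move=> ll cl dy; apply: (curve_diff_comp dy); exact: is_diff_lin.
Qed.

Lemma curve_diff_bilin E F G (b : E -> F -> G) (y : R -> E) (z : R -> F) t v w :
  bilin b -> curve_diff y t v -> curve_diff z t w ->
  curve_diff (fun s => b (y s) (z s)) t (b (y t) w + b v (z t)).
Proof.
move=> hb dy dz; have [hl hr _] := hb.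
apply: is_diff_congr (bilin_is_diff hb dy dz) => // s.
by rewrite (linZ (hr _)) (linZ (hl _)) scalerDr.
Qed.

Lemma curve_diff_continuous F (y : R -> F) t v : curve_diff y t v ->
  {for t, continuous y}.
Proof. by case=> d _; exact: differentiable_continuous. Qed.

Lemma curve_diff_shift F (y : R -> F) t s v : curve_diff y (s + t) v ->
  curve_diff (fun u => y (s + u)) t v.
Proof.
move=> dy.
have D : curve_diff (fun u : R => s + u : R) t (1 : R).
  apply: (@curve_diff_eq _ _ _ (0 + 1 : R)); first by rewrite add0r.
  apply: curve_diffD; first exact: curve_diff_cst.
  by apply: is_diff_congr (is_diff_id t) => // u; exact/esym/mulr1.
by have := curve_diff_comp D dy; rewrite scale1r.
Qed.

Lemma curve_diff_coord E n (B : fbasis E n) (y : R -> E) t v :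
  (forall i, curve_diff (fun s => fc B i (y s) : R) t (fc B i v : R)) -> curve_diff y t v.
Proof.
move=> H; rewrite /curve_diff (fbK B v).
rewrite (_ : y = fun s => \sum_(i < n) (fc B i (y s) : R) *: fb B i); last first.
  by apply/funext => s; exact: fbK.
have D i : is_diff t (fun s => (fc B i (y s) : R) *: fb B i)
    (fun s : R => s *: ((fc B i v : R) *: fb B i)).
  apply: (@curve_diff_lin R E _ (fun a : R => a *: fb B i) _ _ _ _ (H i)).
    by move=> a u w; rewrite scalerDl scalerA.
  by move=> a; exact: scalel_continuous.
apply: is_diff_congr (is_diff_sum (index_enum 'I_n) D) => // s.
by rewrite scaler_sumr.
Qed.

(* Gronwall: [e^(-K t) sum_i (w_i t)^2] is nonincreasing for large [K]. *)
Lemma gronwall_real (I : finType) (w dw : I -> R -> R) (C : R) :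
  (forall i t, curve_diff (w i) t (dw i t)) -> 0 <= C ->
  (forall i t, `|dw i t| <= C * \sum_j `|w j t|) -> (forall i, w i 0 = 0) ->
  forall i t, w i t = 0.
Proof.
move=> hw C0 hC w0 i t.
pose p s := \sum_j w j s ^+ 2; pose dp s := \sum_j (w j s * dw j s + dw j s * w j s).
have p_ge0 s : 0 <= p s by apply: sumr_ge0 => j _; exact: sqr_ge0.
have Dp s : curve_diff p s (dp s).
  rewrite /curve_diff (_ : (fun s0 => _) = fun a : R =>
      \sum_j a *: (w j s * dw j s + dw j s * w j s)); last first.
    by apply/funext => a; rewrite -scaler_sumr.
  apply: is_diff_sum => j.
  by apply: (@curve_diff_bilin R R R (fun a b => a * b)) => //; exact: (@bilin_scale R R).
(* From [2 |w_j| |w_l| <= w_j^2 + w_l^2], summed over all pairs. *)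
pose K := 2 * C * #|I|%:R.
have K0 : 0 <= K by rewrite !mulr_ge0.
have dpK s : `|dp s| <= K * p s.
  apply: (le_trans (ler_norm_sum _ _ _)).
  apply: (@le_trans _ _ (\sum_j \sum_l C * (w j s ^+ 2 + w l s ^+ 2))).
    apply: ler_sum => j _; rewrite [dw _ _ * _]mulrC -mulr2n -[X in `|X|]mulr_natr.
    rewrite !normrM (ger0_norm (ler0n _ 2)).
    apply: (@le_trans _ _ (`|w j s| * (C * \sum_l `|w l s|) * 2)).
      by apply: ler_wpM2r => //; apply: ler_wpM2l.
    rewrite mulrA [_ * C]mulrC -!mulrA -mulr_sumr; apply: ler_wpM2l => //.
    rewrite mulrA mulr_sumr mulr_suml; apply: ler_sum => l _.
    rewrite -(real_normK (num_real (w j s))) -(real_normK (num_real (w l s))).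
    by have := sqr_ge0 (`|w j s| - `|w l s|); nra.
  rewrite le_eqVlt; apply/orP; left; apply/eqP.
  under eq_bigr do rewrite -mulr_sumr big_split/= sumr_const.
  rewrite -mulr_sumr big_split /= sumr_const sumrMnl /K -/(p s) -[p s *+ _]mulr_natr.
  by move: (p s) (#|_|%:R : R) => a b; ring.
suff pt : p t = 0.
  have : w i t ^+ 2 <= p t by rewrite /p (bigD1 i)//= lerDl sumr_ge0// => j _; exact: sqr_ge0.
  rewrite pt => h; apply/eqP; rewrite -sqrf_eq0 eq_le h sqr_ge0//.
(* Rescaling [[0, t]] to [[0, 1]], with [|t|] in the exponent, treats both signs of [t] at once. *)
pose q (s : R) := p (s * t) * expR (- (K * `|t|) * s).
have Dq s : curve_diff q s ((t * dp (s * t) - K * `|t| * p (s * t)) * expR (- (K * `|t|) * s)).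
  have Ds : curve_diff (fun u : R => u * t) s t by apply: is_diff_congr (is_diff_scalel s t).
  have Dk : curve_diff (fun u : R => - (K * `|t|) * u) s (- (K * `|t|)).
    by apply: is_diff_congr (is_diff_scalel s (- (K * `|t|))) => // u; exact: mulrC.
  have /curve_diffP De := is_derive_expR (- (K * `|t|) * s).
  have D1 := curve_diff_comp Ds (Dp (s * t)); have D2 := curve_diff_comp Dk De.
  have := @curve_diff_bilin R R R (fun a b => a * b) _ _ _ _ _ (@bilin_scale R R) D1 D2.
  apply: curve_diff_eq; rewrite -[t *: _]/(t * _) -[- _ *: _]/(- _ * _); ring.
have [s _|s /andP[s0 s1]] := @segment_MVT R R q 0 1.
  by have [] := Dq (0 + s *: 1).
rewrite !add0r; have [_ ->] := Dq (s *: 1).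
have p0 : p 0 = 0 by rewrite /p big1// => j _; rewrite w0 expr0n.
rewrite scale1r /q mul0r mul1r p0 mul0r subr0 => hq.
have : p t * expR (- (K * `|t|) * 1) <= 0.
  rewrite hq; apply: mulr_le0_ge0; last exact: expR_ge0.
  have := dpK (s *: 1 * t); set a := dp _; set b := p _ => ab.
  rewrite subr_le0; apply: (le_trans (ler_norm _)); rewrite normrM [K * _]mulrC -mulrA.
  exact: ler_wpM2l.
by rewrite pmulr_lle0 ?expR_gt0// => h; apply/eqP; rewrite eq_le h p_ge0.
Qed.

(** The norm of [E] need not be differentiable; passing to coordinates replaces it by a sum of
    squares. *)
Lemma gronwall E n (B : fbasis E n) (I : finType) (y dy : I -> R -> E) (C : R) :
  (forall i t, curve_diff (y i) t (dy i t)) -> 0 <= C ->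
  (forall i t, `|dy i t| <= C * \sum_j `|y j t|) -> (forall i, y i 0 = 0) ->
  forall i t, y i t = 0.
Proof.
move=> hy C0 hC y0 i t.
have [D D0 hD] := fc_bounded B; have [D' D'0 hD'] := norm_fc B.
apply: (fc_ext (B := B)) => l; rewrite fc0.
apply: (@gronwall_real (I * 'I_n)%type (fun p s => fc B p.2 (y p.1 s) : R)
  (fun p s => fc B p.2 (dy p.1 s) : R) (D * C * D') _ _ _ _ (i, l)).
- move=> [j k] s; apply: (@curve_diff_lin E R^o) (hy j s); first exact: linearP.
  exact: fc_continuous.
- by apply: mulr_ge0; [apply: mulr_ge0 => //|]; exact: ltW.
- move=> [j k] s /=; apply: (le_trans (hD _ _)).
  rewrite -!mulrA; apply: ler_wpM2l; first exact: ltW.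
  apply: (le_trans (hC _ _)); apply: ler_wpM2l => //.
  rewrite -(pair_bigA _ (fun j k => `|fc B k (y j s) : R|)) mulr_sumr.
  by apply: ler_sum => j' _; exact: hD'.
- by move=> [j k] /=; rewrite y0 fc0.
Qed.

Lemma curve_const (y : R -> R) : (forall t, curve_diff y t 0) -> forall t, y t = y 0.
Proof.
move=> hy t; have [s _|s _] := @segment_MVT R R y 0 t; first by have [] := hy (0 + s *: t).
by have [_ ->] := hy (0 + s *: t); rewrite add0r scaler0 => /eqP; rewrite subr_eq0 => /eqP.
Qed.

End Curves.

(** * Exponential series of linear operators *)

Section ExponentialSeries.
Context {R : realType} {E : normedModType R} {n : nat} (B : fbasis E n).
Implicit Type A : E -> E.

(* [expsum m A x t] is the sum over [k] of [t^(k+m)/(k+m)! A^k x], an [m]-fold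
   iterated primitive of [t |-> e^(tA) x]. *)
Definition expcoef (m : nat) A (x : E) (j : nat) : E :=
  ((m <= j)%N%:R / j`!%:R) *: iter (j - m) A x.

Definition expsum (m : nat) A (x : E) (t : R) : E :=
  limn (series (fun j => t ^+ j *: expcoef m A x j)).

Lemma linear_iter A k : linear A -> linear (iter k A).
Proof. by move=> lA; elim: k => [|k IH] // a u v; rewrite !iterS IH lA. Qed.

Lemma iter_bound A (K : R) x k : 0 <= K -> (forall y, `|A y| <= K * `|y|) ->
  `|iter k A x| <= K ^+ k * `|x|.
Proof.
move=> K0 hK; elim: k => [|k IH]; first by rewrite expr0 mul1r.
by rewrite iterS exprS -mulrA; apply: (le_trans (hK _)); apply: ler_wpM2l.
Qed.

Lemma expcoef_bound m A x (K : R) j : 1 <= K -> (forall y, `|A y| <= K * `|y|) ->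
  `|expcoef m A x j| <= `|x| * (K ^+ j / j`!%:R).
Proof.
move=> K1 hK; have K0 : 0 <= K by exact: le_trans K1.
rewrite /expcoef normrZ; case: leqP => mj; last first.
  by rewrite mul0r normr0 mul0r !mulr_ge0// ?exprn_ge0// invr_ge0.
rewrite mul1r ger0_norm ?invr_ge0// mulrC mulrA; apply: ler_wpM2r; first by rewrite invr_ge0.
apply: (le_trans (iter_bound _ _ K0 hK)); rewrite mulrC; apply: ler_wpM2l => //.
by apply: ler_weXn2l => //; exact: leq_subr.
Qed.

Lemma lin_bounded1 A : linear A ->
  exists2 K : R, 1 <= K & forall y, `|A y| <= K * `|y|.
Proof.
move=> lA; have [K K0 hK] := lin_bounded B lA; exists (1 + K); first by rewrite lerDl ltW.
by move=> y; apply: (le_trans (hK y)); apply: ler_wpM2r => //; rewrite lerDr.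
Qed.

Lemma expsum_cvg m A x t : linear A ->
  series (fun j => t ^+ j *: expcoef m A x j) @ \oo --> expsum m A x t.
Proof.
move=> lA; have [K K1 hK] := lin_bounded1 lA.
apply: (series_norm_cvg B (a := fun j => `|x| * exp_coeff (`|t| * K) j)).
  move=> j; rewrite normrZ normrX; have h := expcoef_bound m x j K1 hK.
  apply: (@le_trans _ _ (`|t| ^+ j * (`|x| * (K ^+ j / j`!%:R)))).
    by apply: ler_wpM2l => //; exact: exprn_ge0.
  by rewrite /exp_coeff /= exprMn mulrCA !mulrA.
rewrite (_ : series _ = `|x| \*: series (exp_coeff (`|t| * K))).
  by apply: is_cvgZr; exact: is_cvg_series_exp_coeff.
by apply/funext => N; rewrite [RHS]mulr_sumr.
Qed.

Lemma expsum_unique m A x t l : linear A ->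
  series (fun j => t ^+ j *: expcoef m A x j) @ \oo --> l -> expsum m A x t = l.
Proof. by move=> lA h; apply: (cvg_unique _ _ h) => //; exact: expsum_cvg. Qed.

Lemma expsum_map m A L x t : linear A -> linear L ->
  (forall y, L (A y) = A (L y)) -> L (expsum m A x t) = expsum m A (L x) t.
Proof.
move=> lA lL LA; apply/esym/expsum_unique => //.
have -> : series (fun j => t ^+ j *: expcoef m A (L x) j) =
    L \o series (fun j => t ^+ j *: expcoef m A x j).
  apply/funext => N; rewrite /series/= (lin_sum lL); apply: eq_bigr => j _.
  rewrite /expcoef !(linZ lL); congr (_ *: (_ *: _)).
  by elim: (j - m)%N => //= k ->.
apply: continuous_cvg; last exact: expsum_cvg.
exact: (lin_continuous B lL).
Qed.

Lemma expsum_linear m A t : linear A -> linear (fun x => expsum m A x t).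
Proof.
move=> lA a u v; apply: expsum_unique => //.
have -> : series (fun j => t ^+ j *: expcoef m A (a *: u + v) j) = fun N =>
    a *: series (fun j => t ^+ j *: expcoef m A u j) N +
    series (fun j => t ^+ j *: expcoef m A v j) N.
  apply/funext => N; rewrite /series/= scaler_sumr -big_split /=.
  apply: eq_bigr => j _; rewrite /expcoef (linear_iter _ lA) !scalerDr.
  by rewrite !scalerA; congr (_ *: _ + _); ring.
by apply: cvgD; [apply: cvgZ; [exact: cvg_cst|]|]; exact: expsum_cvg.
Qed.

(** Splits off the term of index [j = m]. For [m = 0] this is [e^(tA) x = x + A y(t)] with [y] the
    primitive of [e^(tA) x], so that [expsum 1] solves [y' = x + A y]. *)
Lemma expsumS m A x t : linear A ->
  expsum m A x t = (t ^+ m / m`!%:R) *: x + A (expsum m.+1 A x t).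
Proof.
move=> lA; rewrite (expsum_map _ _ _ lA lA)//.
apply: expsum_unique => //.
apply: (@cvg_trans _ ((fun N => (t ^+ m / m`!%:R) *: x +
    series (fun j => t ^+ j *: expcoef m.+1 A (A x) j) N) @ \oo)); last first.
  by apply: cvgD; [exact: cvg_cst|exact: expsum_cvg].
apply: near_eq_cvg; near=> N.
have mN : (m < N)%N by near: N; exists m.+1.
rewrite /series/= [in RHS](bigD1_seq m)//= ?mem_index_iota ?iota_uniq//.
rewrite /expcoef leqnn subnn scalerA mul1r; congr (_ + _).
rewrite [in LHS](bigD1_seq m)//= ?mem_index_iota ?iota_uniq//.
rewrite ltnn mul0r scale0r scaler0 add0r; apply: eq_bigr => j jm.
congr (_ *: _); rewrite [(m <= j)%N]leq_eqVlt eq_sym (negPf jm) /=.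
case: ltnP => mj; last by rewrite !mul0r !scale0r.
by rewrite -iterSr subnSK.
Unshelve. all: by end_near. Qed.

Lemma expsum0 m A x : linear A -> expsum m A x 0 = (m == 0)%:R *: x.
Proof.
move=> lA; apply: expsum_unique => //; apply: cvg_near_cst; near=> N.
have N0 : (0 < N)%N by near: N; exists 1%N.
rewrite /series/= (bigD1_seq 0%N)//= ?mem_index_iota ?iota_uniq//.
rewrite big1 ?addr0; last by move=> j j0; rewrite expr0n (negPf j0) scale0r.
rewrite expr0 scale1r /expcoef leqn0; case: eqP => [->|_].
  by rewrite fact0 divr1.
by rewrite mul0r !scale0r.
Unshelve. all: by end_near. Qed.

Let fcoef i m A x (j : nat) : R := fc B i (expcoef m A x j).

Let fc_expsum i m A x t : linear A ->
  (fc B i (expsum m A x t) : R) = limn (pseries (fcoef i m A x) t) /\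
  cvgn (pseries (fcoef i m A x) t).
Proof.
move=> lA; suff h : pseries (fcoef i m A x) t @ \oo --> (fc B i (expsum m A x t) : R).
  by split; [exact/esym/cvg_lim|exact: cvgP h].
have -> : pseries (fcoef i m A x) t = (fc B i : E -> R) \o
    series (fun j => t ^+ j *: expcoef m A x j).
  apply/funext => N; rewrite /= /pseries /series /= linear_sum.
  by apply: eq_bigr => j _; rewrite fcZ mulrC.
by apply: continuous_cvg; [exact: fc_continuous|exact: expsum_cvg].
Qed.

Let pseries_diffsS i m A x : pseries_diffs (fcoef i m.+1 A x) = fcoef i m A x.
Proof.
apply/funext => j; rewrite /pseries_diffs /fcoef /expcoef !fcZ ltnS subSS.
by rewrite mulrA factS natrM invfM [_.+1%:R * (_ * _)]mulrCA mulVKf.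
Qed.

Let pseries_diffs0 i A x : pseries_diffs (fcoef i 0 A x) = fcoef i 0 A (A x).
Proof.
apply/funext => j; rewrite /pseries_diffs /fcoef /expcoef !fcZ !leq0n !subn0 -iterSr.
by rewrite !mul1r mulrA factS natrM invfM mulVKf.
Qed.

Lemma expsum_diffS m A x t : linear A ->
  curve_diff (expsum m.+1 A x) t (expsum m A x t).
Proof.
move=> lA; apply: (curve_diff_coord (B := B)) => i; apply/curve_diffP.
have [-> _] := fc_expsum i m x t lA.
have -> : (fun s => fc B i (expsum m.+1 A x s) : R) =
    fun s => limn (pseries (fcoef i m.+1 A x) s).
  by apply/funext => s; have [-> _] := fc_expsum i m.+1 x s lA.
rewrite -(pseries_diffsS i m A x).
(* The series and its first two derived series converge at [|t| + 1], beyond [|t|], which permits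
   termwise differentiation at [t]. *)
apply: (@pseries_snd_diffs _ _ (`|t| + 1)); last by rewrite [ltRHS]ger0_norm// ltrDl.
- by have [_] := fc_expsum i m.+1 x (`|t| + 1) lA.
- by rewrite pseries_diffsS; have [_] := fc_expsum i m x (`|t| + 1) lA.
rewrite pseries_diffsS; case: m => [|m].
  by rewrite pseries_diffs0; have [_] := fc_expsum i 0 (A x) (`|t| + 1) lA.
by rewrite pseries_diffsS; have [_] := fc_expsum i m x (`|t| + 1) lA.
Qed.

Lemma expsum_diff0 A x t : linear A ->
  curve_diff (expsum 0 A x) t (A (expsum 0 A x t)).
Proof.
move=> lA; rewrite (expsum_map _ _ _ lA lA)//.
apply: (curve_diff_coord (B := B)) => i; apply/curve_diffP.
have [-> _] := fc_expsum i 0 (A x) t lA.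
have -> : (fun s => fc B i (expsum 0 A x s) : R) =
    fun s => limn (pseries (fcoef i 0 A x) s).
  by apply/funext => s; have [-> _] := fc_expsum i 0 x s lA.
rewrite -(pseries_diffs0 i A x).
apply: (@pseries_snd_diffs _ _ (`|t| + 1)); last by rewrite [ltRHS]ger0_norm// ltrDl.
- by have [_] := fc_expsum i 0 x (`|t| + 1) lA.
- by rewrite pseries_diffs0; have [_] := fc_expsum i 0 (A x) (`|t| + 1) lA.
by rewrite !pseries_diffs0; have [_] := fc_expsum i 0 (A (A x)) (`|t| + 1) lA.
Qed.

Lemma expsum_diff1 A x t : linear A ->
  curve_diff (expsum 1 A x) t (x + A (expsum 1 A x t)).
Proof.
move=> lA; apply: (curve_diff_eq _ (expsum_diffS 0 x t lA)).
by rewrite (expsumS _ _ _ lA) expr0 fact0 divr1 scale1r.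
Qed.

End ExponentialSeries.

(** * Jordan algebras and flows *)

Section QuasiInverse.
Context {R : realType} {J : normedModType R} {n : nat} (B : fbasis J n).
Context (mul : J -> J -> J) (mul_linearl : forall y, linear (mul^~ y))
  (mul_linearr : forall x, linear (mul x)) (hJ : jordan_product mul).
Local Notation "x ** y" := (mul x y) (at level 40, left associativity).

Lemma mulJC x y : x ** y = y ** x. Proof. by case: hJ => h _; exact: h. Qed.
Lemma mulJDl x y z : (x + y) ** z = x ** z + y ** z. Proof. exact: linD (mul_linearl z) x y. Qed.
Lemma mulJDr x y z : z ** (x + y) = z ** x + z ** y. Proof. exact: linD. Qed.
Lemma mulJBl x y z : (x - y) ** z = x ** z - y ** z. Proof. exact: linB (mul_linearl z) x y. Qed.
Lemma mulJBr x y z : z ** (x - y) = z ** x - z ** y. Proof. exact: linB. Qed.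
Lemma mulJNl x z : (- x) ** z = - (x ** z). Proof. exact: linN (mul_linearl z) x. Qed.
Lemma mulJNr x z : z ** (- x) = - (z ** x). Proof. exact: linN. Qed.
Lemma mulJZl a x z : (a *: x) ** z = a *: (x ** z). Proof. exact: linZ (mul_linearl z) a x. Qed.
Lemma mulJZr a x z : z ** (a *: x) = a *: (z ** x). Proof. exact: linZ. Qed.
Lemma mulJ0l z : 0 ** z = 0. Proof. exact: lin0 (mul_linearl z). Qed.
Lemma mulJ0r z : z ** 0 = 0. Proof. exact: lin0. Qed.
Definition mulJE := (mulJDl, mulJDr, mulJBl, mulJBr, mulJNl, mulJNr, mulJZl,
  mulJZr, mulJ0l, mulJ0r).

Lemma mul_bilin : bilin mul.
Proof. exact: (fbasis_bilin B B mul_linearl mul_linearr). Qed.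

Ltac gen_mul := repeat match goal with
  | |- context [mul ?x ?y] => generalize (mul x y); intro end.

(** Proves linear consequences of equations between products: the products become atoms, and each
    coordinate is left to linear arithmetic. *)
Ltac jlra := gen_mul; intros; apply: (fc_ext (B := B)); let i := fresh "i" in intro i;
  repeat match goal with H : @eq ?T _ _ |- _ => unify T (NormedModule.sort J : Type);
    move: (congr1 (fun z : J => fc B i z : R) H); clear H end;
  rewrite !fcE; intros; lra.

(* Polarization: the symmetric trilinear form of a cubic form [f] is
   [f(a+b+c) - f(a+b) - f(b+c) - f(a+c) + f(a) + f(b) + f(c)]. *)
Lemma jordan_linearized a b c d :
  (a ** b) ** (c ** d) + (b ** c) ** (a ** d) + (a ** c) ** (b ** d) =
  c ** ((a ** b) ** d) + a ** ((b ** c) ** d) + b ** ((a ** c) ** d).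
Proof.
have [_ jord] := hJ.
move: (jord (a + b + c) d) (jord (a + b) d) (jord (a + c) d) (jord (b + c) d).
move: (jord a d) (jord b d) (jord c d).
rewrite !mulJDl !mulJDr !mulJDl !mulJDr (mulJC b a) (mulJC c a) (mulJC c b).
jlra.
Qed.

Definition inner_der p q u : J := p ** (q ** u) - q ** (p ** u).

(** The left side of the linearized Jordan identity for [(p, v, u; q)] is symmetric in [p] and [q];
    equating the two right sides is the Leibniz rule. *)
Lemma inner_derM p q u v :
  inner_der p q (u ** v) = inner_der p q u ** v + u ** inner_der p q v.
Proof.
have := jordan_linearized p v u q; have := jordan_linearized q v u p.
rewrite (mulJC v u) (mulJC u q) (mulJC v q) (mulJC u p) (mulJC v p) (mulJC q p).
rewrite (mulJC (p ** v) q) (mulJC (u ** v) q) (mulJC (p ** u) q).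
rewrite (mulJC (q ** v) p) (mulJC (u ** v) p) (mulJC (q ** u) p).
rewrite (mulJC (q ** v) (p ** u)) (mulJC (q ** u) (p ** v)).
rewrite /inner_der mulJBl mulJBr (mulJC (p ** (q ** u)) v) (mulJC (q ** (p ** u)) v).
jlra.
Qed.

(* [b] is the quasi-inverse of [- x]: in the hull, [(1,x)^-1 = (1,-b)]. *)
Definition qinv (x b : J) : Prop :=
  x - b = x ** b /\ forall u, x ** (b ** u) = b ** (x ** u).

Lemma qinvP x b : jordan_inverse (hull_mul mul) (1, 0) (1, x) (1, - b) <-> qinv x b.
Proof.
rewrite /jordan_inverse /hull_mul /=; split=> [[[e1 e2] h]|[e h]].
  have {}e1 : x - b = x ** b.
    apply/eqP; rewrite -subr_eq0 -{}e2 !scale1r mulJNr; apply/eqP.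
    by rewrite [- b + x]addrC.
  split=> // u; have := congr1 snd (h (0, u)).
  rewrite /= !mulr0 !scale0r !scale1r !addr0 !mulJE.
  by clear - B; jlra.
split.
  congr pair; first by rewrite mulr1.
  by rewrite !scale1r mulJNr -e [- b + x]addrC subrr.
move=> [a u]; rewrite /=; congr pair; rewrite ?mulJE ?h.
  rewrite (mulJC b x) !scale1r !mul1r; clear - B.
  have -> : a *: - b = - (a *: b) by rewrite scalerN.
  by move: (a *: b) (a *: x); jlra.
Qed.

End QuasiInverse.

Lemma bilin_bound (R : realType) (E F G : normedModType R) (b : E -> F -> G) :
  bilin b -> exists2 C, 0 < C & forall x y, `|b x y| <= C * `|x| * `|y|.
Proof. by move=> hb; have [_ _ cb] := hb; exact: (@bilinear_schwarz _ _ _ _ (bilin_of hb)). Qed.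

(** * Affine maps preserving quasi-inverse pairs *)

Section StructureMaps.
Context {R : realType} {J : normedModType R} {n : nat} (B : fbasis J n).
Context (mul : J -> J -> J) (mul_linearl : forall y, linear (mul^~ y))
  (mul_linearr : forall x, linear (mul x)) (hJ : jordan_product mul).
Context (gamma : J -> J -> R^o) (gamma_linearl : forall y, linear (gamma^~ y))
  (gamma_linearr : forall x, linear (gamma x)) (hgamma : trace_form mul gamma)
  (gamma_nd : nondegenerate_form gamma).
Local Notation "x ** y" := (mul x y) (at level 40, left associativity).

Let mC := mulJC hJ.
Let mDl := mulJDl mul_linearl.
Let mDr := mulJDr mul_linearr.
Let mBl := mulJBl mul_linearl.
Let mBr := mulJBr mul_linearr.
Let mNl := mulJNl mul_linearl.
Let mNr := mulJNr mul_linearr.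
Let mb := mul_bilin B mul_linearl mul_linearr.
Let derM := inner_derM B mul_linearl mul_linearr hJ.

Ltac gen_mul := repeat match goal with
  | |- context [mul ?x ?y] => generalize (mul x y); intro end.

Ltac jlra := gen_mul; intros; apply: (fc_ext (B := B)); let i := fresh "i" in intro i;
  repeat match goal with H : @eq ?T _ _ |- _ => unify T (NormedModule.sort J : Type);
    move: (congr1 (fun z : J => fc B i z : R) H); clear H end;
  rewrite !fcE; intros; lra.

Lemma inner_der_linear p q : linear (inner_der mul p q).
Proof.
move=> a u v; rewrite /inner_der !(mul_linearr q, mul_linearr p).
by rewrite opprD addrACA -scalerBr.
Qed.

(** On the hull, the generator [L_(0,c) + [L_p, L_q]] sends [(1, x)] to [(0, c + flow_op c p q x)].
    The companion [flow_op'] is minus the [gamma]-adjoint and governs [b]. *)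
Definition flow_op c p q x := c ** x + inner_der mul p q x.
Definition flow_op' c p q x := inner_der mul p q x - c ** x.

Lemma flow_op_linear c p q : linear (flow_op c p q).
Proof.
by move=> a u v; rewrite /flow_op inner_der_linear mul_linearr addrACA -scalerDr.
Qed.

Lemma flow_op'_linear c p q : linear (flow_op' c p q).
Proof.
move=> a u v; rewrite /flow_op' inner_der_linear mul_linearr.
by rewrite opprD addrACA -scalerBr.
Qed.

(* With [u = x - b - x b] and [K = [L_x, L_b]], the pair [(u, K)] solves the linear
   system [u' = K c + D u], [K' = [L_u, L_c] + [D, K]], and it vanishes at [0]. *)
Lemma flow_qinv c p q (x b : R -> J) :
  (forall t, curve_diff x t (c + flow_op c p q (x t))) ->
  (forall t, curve_diff b t (c + flow_op' c p q (b t))) ->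
  qinv mul (x 0) (b 0) -> forall t, qinv mul (x t) (b t).
Proof.
move=> dx db [u0 K0].
have [D [Dlin DM fE fE']] : exists D : J -> J, [/\ linear D,
    forall u v, D (u ** v) = D u ** v + u ** D v,
    forall y, flow_op c p q y = c ** y + D y & forall y, flow_op' c p q y = D y - c ** y].
  exists (inner_der mul p q); split => //; exact: inner_der_linear.
pose u t := x t - b t - x t ** b t; pose K t v := x t ** (b t ** v) - b t ** (x t ** v).
have Klin t : linear (K t) by exact: inner_der_linear.
have du t : curve_diff u t (K t c + D (u t)).
  apply: curve_diff_eq (curve_diffB (curve_diffB (dx t) (db t))
    (curve_diff_bilin mb (dx t) (db t))).
  rewrite fE fE' /K /u !(linB Dlin) DM !mDl !mDr !mNr.
  rewrite (mC (c ** x t) (b t)) (mC (x t) c) (mC (b t) c) (mC c (b t)).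
  move: (D (x t)) (D (b t)) => d1 d2; jlra.
have dK v t : curve_diff (K^~ v) t
    (u t ** (c ** v) - c ** (u t ** v) + D (K t v) - K t (D v)).
  have cst_v w : curve_diff (fun=> w : J) t 0 by exact: curve_diff_cst.
  apply: curve_diff_eq (curve_diffB
    (curve_diff_bilin mb (dx t) (curve_diff_bilin mb (db t) (cst_v v)))
    (curve_diff_bilin mb (db t) (curve_diff_bilin mb (dx t) (cst_v v)))).
  have := jordan_linearized B mul_linearl mul_linearr hJ (x t) (b t) c v.
  rewrite fE fE' /K /u !(linB Dlin) !DM !(mulJ0r mul_linearr) !add0r.
  move: (D (x t)) (D (b t)) (D v) => d1 d2 d3.
  rewrite !mDl !mDr !mNl !mNr ?mDl ?mDr ?mNr ?mNl (mC (x t) c) (mC (b t) c).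
  rewrite (mC (c ** x t) (b t ** v)) (mC (c ** b t) (x t ** v)).
  jlra.
have [C1 C10 hC1] := fc_bounded B; have [CD CD0 hCD] := lin_bounded B Dlin.
have [Cm Cm0 hCm] := bilin_bound mb.
(* Gronwall is applied to the finite family made of [u] (index [None]) and of [K] on the basis
   vectors. *)
pose y (i : option 'I_n) t := if i is Some j then K t (fb B j) else u t.
pose dy (i : option 'I_n) t := if i is Some j then
  u t ** (c ** fb B j) - c ** (u t ** fb B j) + D (K t (fb B j)) - K t (D (fb B j))
  else K t c + D (u t).
pose S t := \sum_i `|y i t|.
have S0 t : 0 <= S t by exact: sumr_ge0.
have yS i t : `|y i t| <= S t by rewrite /S (bigD1 i)//= lerDl sumr_ge0.
have KS t v : `|K t v| <= n%:R * (C1 * `|v| * S t).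
  rewrite {1}(fbK B v) (lin_sum (Klin t)); apply: (le_trans (ler_norm_sum _ _ _)).
  rewrite mulr_natl -[X in _ *+ X]card_ord -sumr_const; apply: ler_sum => j _.
  rewrite (linZ (Klin t)) normrZ; apply: ler_pM => //; exact: (yS (Some j) t).
pose Cj j := 2 * Cm ^+ 2 * `|c| * `|fb B j| + CD + n%:R * (C1 * `|D (fb B j)|).
have Cj0 j : 0 <= Cj j.
  rewrite /Cj !addr_ge0// ?mulr_ge0 ?exprn_ge0//; exact: ltW.
have bigC i t : `|dy i t| <= (n%:R * (C1 * `|c|) + CD + \sum_j Cj j) * S t.
  have e0 : 0 <= n%:R * (C1 * `|c|) by rewrite !mulr_ge0//; exact: ltW.
  have e1 : 0 <= \sum_j Cj j by exact: sumr_ge0.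
  case: i => [j|] /=; last first.
    apply: (@le_trans _ _ ((n%:R * (C1 * `|c|) + CD) * S t)).
      rewrite mulrDl; apply: (le_trans (ler_normD _ _)); apply: lerD.
        by rewrite -!mulrA; have := KS t c; rewrite -!mulrA.
      by apply: (le_trans (hCD _)); rewrite ler_pM2l//; exact: (yS None t).
    by apply: ler_wpM2r => //; rewrite lerDl.
  apply: (@le_trans _ _ (Cj j * S t)); last first.
    apply: ler_wpM2r => //; rewrite (bigD1 j)//= addrCA lerDl !addr_ge0//.
      exact: ltW.
    exact: sumr_ge0.
  rewrite /Cj !mulrDl; apply: (le_trans (ler_normB _ _)); apply: lerD; last first.
    by have := KS t (D (fb B j)); rewrite -!mulrA.
  apply: (le_trans (ler_normD _ _)); apply: lerD; last first.
    by apply: (le_trans (hCD _)); rewrite ler_pM2l//; exact: (yS (Some j) t).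
  apply: (le_trans (ler_normB _ _)); set e := fb B j.
  have uS : `|u t| <= S t by exact: (yS None t).
  have h1 : `|u t ** (c ** e)| <= Cm * S t * (Cm * `|c| * `|e|).
    apply: (le_trans (hCm _ _)); apply: ler_pM => //; first by rewrite mulr_ge0// ltW.
    by rewrite ler_pM2l.
  have h2 : `|c ** (u t ** e)| <= Cm * `|c| * (Cm * S t * `|e|).
    apply: (le_trans (hCm _ _)); apply: ler_wpM2l; first by rewrite mulr_ge0// ltW.
    by apply: (le_trans (hCm _ _)); apply: ler_wpM2r => //; rewrite ler_pM2l.
  apply: (le_trans (lerD h1 h2)); rewrite le_eqVlt; apply/orP; left; apply/eqP; ring.
have y0 i t : y i t = 0.
  apply: (gronwall B (dy := dy) (C := n%:R * (C1 * `|c|) + CD + \sum_j Cj j)) => //.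
  - by case=> [j|] s; [exact: dK|exact: du].
  - by rewrite !addr_ge0// ?sumr_ge0// ?mulr_ge0//; exact: ltW.
  - by case=> [j|] /=; [rewrite /K K0 subrr|rewrite /u u0 subrr].
move=> t; split; first by apply/eqP; rewrite -subr_eq0; apply/eqP/(y0 None t).
move=> v; apply/eqP; rewrite -subr_eq0 -/(K t v) (fbK B v) (lin_sum (Klin t)).
apply/eqP; rewrite big1// => j _; rewrite (linZ (Klin t)).
by rewrite [K t _](y0 (Some j) t) scaler0.
Qed.

(* The affine maps [x |-> a + g x], [b |-> a' + g' b] are the restrictions to
   [1 + J] of an element of the structure group of the hull and of its inverse
   adjoint. *)
Definition strmap (g g' : J -> J) (a a' : J) : Prop :=
  [/\ linear g, linear g', forall u v, gamma (g u) (g' v) = gamma u v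
    & forall x b, qinv mul x b <-> qinv mul (a + g x) (a' + g' b)].

Lemma strmap_id : strmap id id 0 0.
Proof. by split=> // x b; rewrite !add0r. Qed.

Lemma strmap_comp g1 g1' a1 a1' g2 g2' a2 a2' :
  strmap g1 g1' a1 a1' -> strmap g2 g2' a2 a2' ->
  strmap (g2 \o g1) (g2' \o g1') (a2 + g2 a1) (a2' + g2' a1').
Proof.
move=> [l1 l1' d1 q1] [l2 l2' d2 q2]; split.
- by move=> a u v; rewrite /= l1 l2.
- by move=> a u v; rewrite /= l1' l2'.
- by move=> u v; rewrite /= d2 d1.
move=> x b; rewrite (q1 x b) (q2 (a1 + g1 x) (a1' + g1' b)).
by rewrite (linD l2) (linD l2') !addrA.
Qed.

Lemma strmap_inj g g' a a' : strmap g g' a a' ->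
  (forall u, g u = 0 -> u = 0) /\ (forall u, g' u = 0 -> u = 0).
Proof.
move=> [l l' d _]; have [gC _] := hgamma; split=> u gu; apply: gamma_nd => v.
  by rewrite -d gu; exact: (lin0 (gamma_linearl _)).
by rewrite gC -d gu; exact: (lin0 (gamma_linearr _)).
Qed.

Lemma strmap_inv g g' a a' : strmap g g' a a' ->
  exists h h', [/\ strmap h h' (- h a) (- h' a'), cancel g h, cancel h g,
    cancel g' h' & cancel h' g'].
Proof.
move=> S; have [i i'] := strmap_inj S; have [l l' d q] := S.
have [h [lh gh hg]] := lin_inj_bij B l i; have [h' [lh' gh' hg']] := lin_inj_bij B l' i'.
exists h, h'; split=> //; split=> //; first by move=> u v; rewrite -d hg hg'.
move=> x b; rewrite (q (- h a + h x) (- h' a' + h' b)).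
by rewrite (linD l) (linD l') (linN l) (linN l') hg hg' hg hg' !addNKr.
Qed.

(** [flow_op'] is minus the adjoint of [flow_op], so the pairing is constant along the flow.
    [flow_qinv] carries [qinv] forward; backward, it is restarted at time [t] and run for time
    [-t]. *)
Lemma flow_strmap c p q t :
  strmap (fun x => expsum 0 (flow_op c p q) x t) (fun x => expsum 0 (flow_op' c p q) x t)
    (expsum 1 (flow_op c p q) c t) (expsum 1 (flow_op' c p q) c t).
Proof.
have lA := flow_op_linear c p q; have lA' := flow_op'_linear c p q.
split; [exact: (expsum_linear B)|exact: (expsum_linear B)| |].
  move=> u v; have [gC gA] := hgamma.
  have gb : bilin gamma by exact: (fbasis_bilin B B).
  have := @curve_const R (fun t => gamma (expsum 0 (flow_op c p q) u t)
    (expsum 0 (flow_op' c p q) v t)) _ t.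
  rewrite !(expsum0 B)// !scale1r; apply => s.
  apply: curve_diff_eq (curve_diff_bilin gb (expsum_diff0 B u s lA) (expsum_diff0 B v s lA')).
  move: (expsum 0 _ u s) (expsum 0 _ v s) => y z; rewrite /flow_op /flow_op' /inner_der.
  rewrite (linB (gamma_linearr y)) (linB (gamma_linearr y)).
  rewrite (linD (gamma_linearl z)) (linB (gamma_linearl z)).
  rewrite (mC c y) (mC q y) (mC p y) (mC p (y ** q)) (mC q (y ** p)) !gA.
  by ring.
move=> x b.
pose X s := expsum 1 (flow_op c p q) c s + expsum 0 (flow_op c p q) x s.
pose Y s := expsum 1 (flow_op' c p q) c s + expsum 0 (flow_op' c p q) b s.
have dX s : curve_diff X s (c + flow_op c p q (X s)).
  apply: curve_diff_eq (curve_diffD (expsum_diff1 B c s lA) (expsum_diff0 B x s lA)).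
  by rewrite -addrA -(linD lA).
have dY s : curve_diff Y s (c + flow_op' c p q (Y s)).
  apply: curve_diff_eq (curve_diffD (expsum_diff1 B c s lA') (expsum_diff0 B b s lA')).
  by rewrite -addrA -(linD lA').
have X0 : X 0 = x by rewrite /X !(expsum0 B)// scale0r scale1r add0r.
have Y0 : Y 0 = b by rewrite /Y !(expsum0 B)// scale0r scale1r add0r.
split=> [h|h]; first by apply: (flow_qinv dX dY); rewrite X0 Y0.
have := @flow_qinv c p q (fun s => X (t + s)) (fun s => Y (t + s))
  (fun s => curve_diff_shift (dX _)) (fun s => curve_diff_shift (dY _)).
by rewrite addr0 => /(_ h (- t)); rewrite subrr X0 Y0.
Qed.

(** The field [c + c x + [L_b0, L_u] x] with [c = u - u b0] takes the value [u] at [x0]: this uses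
    both halves of [qinv x0 b0]. Every direction is thus reached infinitesimally, and the time-one
    maps of these flows cover a ball, by the quantitative surjectivity of small perturbations of the
    identity. *)
Lemma local_transitive x0 b0 : qinv mul x0 b0 ->
  exists2 r : R, 0 < r & forall x, `|x - x0| <= r ->
    exists g g' a a', strmap g g' a a' /\ a + g x0 = x.
Proof.
move=> [q1 q2].
pose A u := flow_op (u - u ** b0) b0 u.
have lA u : linear (A u) by exact: flow_op_linear.
have lAl x : linear (A^~ x).
  move=> a u v; rewrite /A /flow_op /inner_der mul_linearl.
  rewrite !(linB (mul_linearl x)) !(mul_linearl x) !(mul_linearl (b0 ** x)).
  rewrite (mul_linearr b0).
  move: (u ** x) (v ** x) (u ** b0 ** x) (v ** b0 ** x) => e1 e2 e3 e4.
  move: (b0 ** e1) (b0 ** e2) (u ** (b0 ** x)) (v ** (b0 ** x)) => e5 e6 e7 e8.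
  by apply: (fc_ext (B := B)) => i; rewrite !fcE; ring.
have Ax0 u : (u - u ** b0) + A u x0 = u.
  have e1 : (u ** b0) ** x0 = b0 ** (u ** x0) by rewrite mC (mC u b0) q2 (mC x0 u).
  have e2 : u ** (b0 ** x0) = u ** x0 - u ** b0 by rewrite (mC b0 x0) -q1 mBr.
  rewrite /A /flow_op /inner_der mBl e1 e2; jlra.
have [M M0 hM] : exists2 M : R, 0 < M & forall u x, `|A u x| <= M * `|u| * `|x|.
  exact: bilin_bound (fbasis_bilin B B lAl lA).
(* The time-one displacement of [x0]: since [c + A u x0 = u], it is the sum of the series started at
   [u], that is, [u] plus terms of order two. *)
pose Phi u := expsum 1 (A u) u 1.
have PhiE u : Phi u = u + expsum 2 (A u) (A u u) 1.
  by rewrite /Phi (expsumS B)// expr1 divr1 scale1r (expsum_map B).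
have PhiS u : expsum 1 (A u) (u - u ** b0) 1 + expsum 0 (A u) x0 1 = x0 + Phi u.
  rewrite (expsumS B 0)// expr0 fact0 divr1 scale1r (expsum_map B)//.
  rewrite addrCA -(linD (expsum_linear B 1 1 (lA u))) Ax0.
  by [].
(* On this ball [A u] has norm at most 1/3, which makes the total Lipschitz constant of the terms of
   order at least two equal to [1/3 + 1/9 + ... = 1/2]. *)
pose r : R := (3 * M)^-1.
have r0 : 0 < r by rewrite invr_gt0 mulr_gt0.
have Mr : M * r = 3^-1 by rewrite /r invfM mulrCA mulfV ?gt_eqF// mulr1.
have iter_diff k u v : `|u| <= r -> `|v| <= r ->
    `|iter k (A u) (A u u) - iter k (A v) (A v v)| <= k.+2%:R * 3^-1 ^+ k.+1 * `|u - v|.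
  move=> ur vr.
  have step x y : `|A u x - A v y| <= 3^-1 * `|x - y| + M * `|y| * `|u - v|.
    have -> : A u x - A v y = A u (x - y) + A (u - v) y.
      by rewrite (linB (lA u)) (linB (lAl y)) addrA subrK.
    apply: (le_trans (ler_normD _ _)); apply: lerD; apply: (le_trans (hM _ _)).
      by apply: ler_wpM2r => //; rewrite -Mr ler_pM2l.
    by rewrite mulrAC.
  have nv m : `|iter m (A v) v| <= 3^-1 ^+ m * r.
    apply: (@le_trans _ _ (3^-1 ^+ m * `|v|)); last first.
      by apply: ler_wpM2l => //; rewrite exprn_ge0.
    apply: iter_bound => // y; apply: (le_trans (hM _ _)).
    by apply: ler_wpM2r => //; rewrite -Mr ler_pM2l.
  suff H m : `|iter m (A u) u - iter m (A v) v| <= m.+1%:R * 3^-1 ^+ m * `|u - v|.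
    by rewrite -!iterSr; exact: H.
  elim: m => [|m IH]; first by rewrite expr0 !mul1r.
  rewrite !iterS; apply: (le_trans (step _ _)).
  have h2 : M * `|iter m (A v) v| * `|u - v| <= 3^-1 ^+ m.+1 * `|u - v|.
    apply: ler_wpM2r => //; apply: (@le_trans _ _ (M * (3^-1 ^+ m * r))).
      by rewrite ler_pM2l.
    by rewrite mulrCA Mr exprSr.
  have h1 : 3^-1 * `|iter m (A u) u - iter m (A v) v| <= 3^-1 * (m.+1%:R * 3^-1 ^+ m * `|u - v|).
    by apply: ler_wpM2l.
  apply: (le_trans (lerD h1 h2)); rewrite le_eqVlt; apply/orP; left; apply/eqP.
  by rewrite exprS -[m.+2%:R]natr1; ring.
have strict u v : `|u| <= r -> `|v| <= r ->
    `|Phi u - Phi v - (u - v)| <= 2^-1 * `|u - v|.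
  move=> ur vr; rewrite !PhiE.
  have -> : u + expsum 2 (A u) (A u u) 1 - (v + expsum 2 (A v) (A v v) 1) - (u - v) =
      expsum 2 (A u) (A u u) 1 - expsum 2 (A v) (A v v) 1 - 0.
    move: (expsum _ _ _ _) (expsum _ _ _ _) => e1 e2; jlra.
  pose s w := series (fun j => (1 : R) ^+ j *: expcoef 2 (A w) (A w w) j).
  apply: (@cvg_norm_le _ _ (fun N => s u N - s v N)).
    by apply: cvgB; exact: (expsum_cvg B).
  exists 2%N => // N /= N2; rewrite subr0.
  have coef j : `|(1 : R) ^+ j *: expcoef 2 (A u) (A u u) j - (1 : R) ^+ j *: expcoef 2 (A v) (A v v) j|
      <= (1 < j)%N%:R * 3^-1 ^+ j.-1 * `|u - v|.
    rewrite expr1n !scale1r /expcoef -scalerBr normrZ; case: j => [|[|k]].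
    - by rewrite ltn0 mul0r normr0 !mul0r.
    - by rewrite ltnn mul0r normr0 !mul0r.
    rewrite !ltnS leq0n mul1r /= !subSS subn0 ger0_norm ?invr_ge0// mul1r.
    (* The factor [k + 2] of [iter_diff] is absorbed by [(k+2)!]. *)
    rewrite ler_pdivrMl ?ltr0n ?fact_gt0//; apply: (le_trans (iter_diff k u v ur vr)).
    rewrite -mulrA; apply: ler_wpM2r; first by rewrite mulr_ge0// exprn_ge0.
    by rewrite ler_nat factS leq_pmulr// fact_gt0.
  rewrite /s /series /= -sumrB; apply: (le_trans (ler_norm_sum _ _ _)).
  apply: (@le_trans _ _ (\sum_(0 <= j < N) (1 < j)%N%:R * 3^-1 ^+ j.-1 * `|u - v|)).
    by apply: ler_sum => j _; exact: coef.
  rewrite -mulr_suml; apply: ler_wpM2r => //.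
  have geo m : \sum_(0 <= j < m.+2) (1 < j)%N%:R * 3^-1 ^+ j.-1 = 2^-1 - 2^-1 * 3^-1 ^+ m :> R.
    elim: m => [|m IH]; first by rewrite !big_nat_recr//= big_geq// !mul0r !addr0 expr0; lra.
    rewrite big_nat_recr//= IH mul1r exprS; lra.
  case: N N2 => [//|[//|N]] _; rewrite geo lerBlDr lerDl mulr_ge0// exprn_ge0//.
have surj := strict_surjective B r0 strict.
have Phi0 : Phi 0 = 0 by exact: (lin0 (expsum_linear B 1 1 (lA 0))).
exists (r / 8); first by rewrite divr_gt0// ltr0n.
move=> x hx; have [|u ur Pu] := surj (x - x0); first by rewrite Phi0 subr0.
have := flow_strmap (u - u ** b0) b0 u 1; rewrite -/(A u) => S.
do 4 eexists; split; first exact: S.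
by rewrite -/(A u) PhiS Pu addrC subrK.
Qed.

End StructureMaps.

(** * The quasi-inverse *)

Section QuasiDomain.
Context {R : realType} {J : normedModType R} {n : nat} (B : fbasis J n).
Context (mul : J -> J -> J) (mul_linearl : forall y, linear (mul^~ y))
  (mul_linearr : forall x, linear (mul x)) (hJ : jordan_product mul).
Context (gamma : J -> J -> R^o) (gamma_linearl : forall y, linear (gamma^~ y))
  (gamma_linearr : forall x, linear (gamma x)) (hgamma : trace_form mul gamma)
  (gamma_nd : nondegenerate_form gamma).
Local Notation "x ** y" := (mul x y) (at level 40, left associativity).
Local Notation strmap := (strmap mul gamma).
Local Notation qinv := (qinv mul).

Let strmap_inv := strmap_inv B gamma_linearl gamma_linearr hgamma gamma_nd.

Definition invertible_set : set J := [set x | exists b, qinv x b].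
Local Notation Y := (quasi_domain mul).
Local Notation Om := invertible_set.

Lemma quasi_domainE : Y = connected_component Om 0.
Proof.
rewrite /quasi_domain; congr connected_component; apply/seteqP; split=> a /=.
  move=> [[y1 y2] /=]; rewrite opprK => h.
  have y11 : y1 = 1 by case: h => /(congr1 fst); rewrite /= mul1r.
  exists (- y2); apply/(qinvP B mul_linearl mul_linearr hJ).
  by rewrite opprK; rewrite y11 in h.
move=> [b /(qinvP B mul_linearl mul_linearr hJ) h].
by exists (1, - b); rewrite opprK.
Qed.

Lemma qinv00 : qinv 0 0.
Proof.
split=> [|u]; first by rewrite subrr (mulJ0l mul_linearl).
by rewrite !(mulJ0l mul_linearl).
Qed.

Lemma quasi_domain0 : Y 0.
Proof. by rewrite quasi_domainE; apply: connected_component_refl; exists 0; exact: qinv00. Qed.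

Lemma quasi_domain_qinv x : Y x -> exists b, qinv x b.
Proof. by rewrite quasi_domainE => /connected_component_sub. Qed.

Lemma quasi_domain_max (C : set J) x : connected C -> C `<=` Om -> C x -> Y x -> C `<=` Y.
Proof.
rewrite quasi_domainE => cC COm Cx Yx.
rewrite (same_connected_component Yx).
exact: connected_component_max.
Qed.

Lemma quasi_domain_connected : connected Y.
Proof. by rewrite quasi_domainE; exact: component_connected. Qed.

(** Near [x] every point is the image of [x] under a structure map and so has a quasi-inverse; the
    ball is connected, hence lies in the component of [x]. *)
Lemma quasi_domain_local x : Y x -> exists2 r : R, 0 < r & forall y, ball x r y ->
  Y y /\ exists g g' a a', strmap g g' a a' /\ a + g x = y.
Proof.
move=> Yx; have [b qx] := quasi_domain_qinv Yx.
have [r r0 hr] := local_transitive B mul_linearl mul_linearr hJ gamma_linearl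
  gamma_linearr hgamma qx.
exists r => // y xy.
have H z : ball x r z -> exists g g' a a', strmap g g' a a' /\ a + g x = z.
  by rewrite -ball_normE /= distrC => /ltW; exact: hr.
split; last exact: H.
apply: (@quasi_domain_max (ball x r) x _ _ (ballxx _ r0) Yx) => //; first exact: ball_connected.
move=> z /H[g [g' [a [a' [[_ _ _ q] <-]]]]]; exists (a' + g' b); exact: (proj1 (q x b) qx).
Qed.

Lemma quasi_domain_open : open Y.
Proof.
rewrite openE => x /quasi_domain_local[r r0 hr]; apply/nbhs_ballP; exists r => // y /hr[].
by [].
Qed.

(** A structure map with translation part [x] sends [0] to [x]. Reachability passes to nearby points
    and back by composition with a local map or its inverse. *)
Lemma quasi_domain_orbit x : Y x -> exists g g' a', strmap g g' x a'.
Proof.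
apply: (@connected_ind _ Y (fun x => exists g g' a', strmap g g' x a') 0 quasi_domain_connected).
- move=> {}x /quasi_domain_local[r r0 hr].
  have := nbhsx_ballx x r r0; apply: filterS => y /hr[_ [g [g' [a [a' [S <-]]]]]] _.
  split=> -[k [k' [c' T]]].
    have [h [h' [S' gh hg gh' hg']]] := strmap_inv S; have [lh _ _ _] := S'.
    have := strmap_comp T S'; rewrite (linD lh) gh addKr => U.
    by do 3 eexists; exact: U.
  by have := strmap_comp T S => U; do 3 eexists; exact: U.
- exact: quasi_domain0.
- by do 3 eexists; exact: strmap_id.
Qed.

Lemma qinv0_eq b : qinv 0 b -> b = 0.
Proof. by case; rewrite (mulJ0l mul_linearl) sub0r => /eqP; rewrite oppr_eq0 => /eqP. Qed.

(** A structure map moves the question to [0], where [0 - b = 0] forces [b = 0]. *)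
Lemma qinv_unique x b b' : Y x -> qinv x b -> qinv x b' -> b = b'.
Proof.
move=> /quasi_domain_orbit[g [g' [a' S]]]; have [h [h' [[_ _ _ q] gh hg gh' hg']]] := strmap_inv S.
have [_ lg' _ _] := S.
move=> /q + /q; rewrite [in qinv _](_ : - h x + h x = 0) ?addNr//.
move=> /qinv0_eq e1 /qinv0_eq e2; rewrite -[b]hg' -[b']hg'; congr g'.
by apply: (addrI (- h' a')); rewrite e1 e2.
Qed.

Definition bq x := quasi_inverse mul (- x).

Lemma bqP x : Y x -> qinv x (bq x).
Proof.
move=> /quasi_domain_qinv[b qb]; rewrite /bq /quasi_inverse opprK; apply/(qinvP B mul_linearl mul_linearr hJ).
set P := [set b | _]; have : P (xget 0 P); last by [].
by apply: xgetPex; exists b; apply/(qinvP B mul_linearl mul_linearr hJ).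
Qed.

Lemma bq_uniq x b : Y x -> qinv x b -> b = bq x.
Proof. by move=> Yx qb; apply: (qinv_unique Yx qb); exact: bqP. Qed.

Lemma bq0 : bq 0 = 0.
Proof. exact/qinv0_eq/bqP/quasi_domain0. Qed.

(** The image of the domain is connected, consists of points with a quasi-inverse, and meets the
    domain. *)
Lemma strmap_quasi_domain_sub g g' a a' y : strmap g g' a a' -> Y y -> Y (a + g y) ->
  forall x, Y x -> Y (a + g x).
Proof.
move=> [lg _ _ q] Yy Ygy x Yx.
apply: (@quasi_domain_max ((fun x => a + g x) @` Y) (a + g y)) => //; last by exists x.
- apply: connected_continuous_connected; first exact: quasi_domain_connected.
  apply: continuous_subspaceT => z; apply: cvgD; first exact: cvg_cst.
  exact: (lin_continuous B lg).
- by move=> _ [z /quasi_domain_qinv[b qb] <-]; exists (a' + g' b); exact: (proj1 (q z b) qb).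
- by exists y.
Qed.

Lemma strmap_quasi_domain g g' a a' x : strmap g g' a a' -> Y a -> Y (a + g x) <-> Y x.
Proof.
move=> S Ya; have [lg _ _ _] := S; have g0 : a + g 0 = a by rewrite (lin0 lg) addr0.
split=> [Yx|]; last by apply: (strmap_quasi_domain_sub S quasi_domain0); rewrite g0.
have [h [h' [S' gh hg _ _]]] := strmap_inv S; have [lh _ _ _] := S'.
have <- : - h a + h (a + g x) = x by rewrite (linD lh) gh addKr.
by apply: (strmap_quasi_domain_sub S' Ya) => //; rewrite addNr; exact: quasi_domain0.
Qed.

Lemma bq_strmap g g' a a' x : strmap g g' a a' -> Y a -> Y x ->
  bq (a + g x) = a' + g' (bq x).
Proof.
move=> S Ya Yx; apply/esym/bq_uniq; first exact/(strmap_quasi_domain _ S).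
by have [_ _ _ q] := S; exact: (proj1 (q x _) (bqP Yx)).
Qed.

Lemma strmap_bq g g' a a' : strmap g g' a a' -> Y a -> a' = bq a.
Proof.
move=> S Ya; have [lg lg' _ _] := S.
by have := bq_strmap S Ya quasi_domain0; rewrite bq0 (lin0 lg) (lin0 lg') !addr0.
Qed.

End QuasiDomain.

(** * Smoothness and Taylor coefficients of the quasi-inverse *)

Section QuasiInverseCalculus.
Context {R : realType} {J : normedModType R} {n : nat} (B : fbasis J n).
Context (mul : J -> J -> J) (mul_linearl : forall y, linear (mul^~ y))
  (mul_linearr : forall x, linear (mul x)) (hJ : jordan_product mul).
Context (gamma : J -> J -> R^o) (gamma_linearl : forall y, linear (gamma^~ y))
  (gamma_linearr : forall x, linear (gamma x)) (hgamma : trace_form mul gamma)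
  (gamma_nd : nondegenerate_form gamma).
Local Notation "x ** y" := (mul x y) (at level 40, left associativity).
Local Notation strmap := (strmap mul gamma).
Local Notation qinv := (qinv mul).
Local Notation Y := (quasi_domain mul).
Local Notation bq := (bq mul).

Let mC := mulJC hJ.
Let mDr := mulJDr mul_linearr.
Let mNr := mulJNr mul_linearr.
Let m0l := mulJ0l mul_linearl.
Let m0r := mulJ0r mul_linearr.
Let mb := mul_bilin B mul_linearl mul_linearr.
Let strmap_inv := strmap_inv B gamma_linearl gamma_linearr hgamma gamma_nd.
Let Yopen : open Y := quasi_domain_open B mul_linearl mul_linearr hJ gamma_linearl gamma_linearr hgamma.
Let Yorbit := quasi_domain_orbit B mul_linearl mul_linearr hJ gamma_linearl gamma_linearr hgamma gamma_nd.
Let YP := bqP B mul_linearl mul_linearr hJ.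
Let Yzero := quasi_domain0 B mul_linearl mul_linearr hJ.
Let b0 : bq 0 = 0 := bq0 B mul_linearl mul_linearr hJ.
Let b_str := bq_strmap B mul_linearl mul_linearr hJ gamma_linearl gamma_linearr hgamma gamma_nd.
Let Y_str := strmap_quasi_domain B mul_linearl mul_linearr hJ gamma_linearl gamma_linearr hgamma gamma_nd.

Lemma bq_eq x : Y x -> bq x + x ** bq x = x.
Proof. by move=> /YP[<- _]; rewrite addrC subrK. Qed.

(* On this ball [x |-> (1 + L_x)^-1 x] is given by the Neumann series. *)
Lemma small_ball : exists r C : R, [/\ 0 < r, 0 < C, ball 0 r `<=` Y,
  (forall x y, `|x ** y| <= C * `|x| * `|y|) & C * r <= 2^-1].
Proof.
have [C C0 hC] := bilin_bound mb.
have /nbhs_ballP[s /= s0 sY] := open_nbhs_nbhs (conj Yopen Yzero).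
exists (Num.min s (2 * C)^-1), C; split => //.
- by rewrite lt_min s0 invr_gt0 mulr_gt0.
- by move=> x /(@le_ball _ _ _ _ s) -/(_ _)/sY; apply; rewrite ge_min lexx.
rewrite mulrC -ler_pdivlMr//.
by rewrite ge_min; apply/orP; right; rewrite invfM.
Qed.

(** On the ball [L_x] has norm at most 1/2, so [1 + L_x] is bounded below by 1/2. *)
Lemma small_estimate (r C : R) x v : (forall x y, `|x ** y| <= C * `|x| * `|y|) ->
  0 < C -> C * r <= 2^-1 -> ball 0 r x -> `|v| <= 2 * `|v + x ** v|.
Proof.
move=> hC C0 Cr; rewrite -ball_normE /= sub0r normrN => xr.
have h1 : `|x ** v| <= 2^-1 * `|v|.
  apply: (le_trans (hC _ _)); apply: ler_wpM2r => //; apply: le_trans Cr.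
  by rewrite ler_pM2l// ltW.
have h2 : `|v| <= `|v + x ** v| + `|x ** v|.
  by rewrite -{1}(addrK (x ** v) v); exact: ler_normB.
lra.
Qed.

(** Near [0] the element [bq x] is the solution of [(1 + L_x) b = x], smooth by Cramer's rule; a
    structure map carries this to any other point. *)
Lemma Ck_bq k : Ck_on k Y bq.
Proof.
have [r [C [r0 C0 rY hC Cr]]] := small_ball.
have est x v := small_estimate v hC C0 Cr (x := x).
have inj x v : ball 0 r x -> v + x ** v = 0 -> v = 0.
  by move=> /est h e; have := h v; rewrite e normr0 mulr0 normr_le0 => /eqP.
have lA x : linear (fun v => v + x ** v).
  by move=> a u v; rewrite mul_linearr scalerDr addrACA.
have /choice[N hN] : forall x, exists N, ball 0 r x -> forall v, N v + x ** N v = v.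
  move=> x; have [xr|nxr] := pselect (ball 0 r x); last by exists id.
  have [N [_ _ NK]] := lin_inj_bij B (lA x) (fun v => inj x v xr).
  by exists N.
have CN v : Ck_on k (ball 0 r) (fun x => N x v).
  apply: (Ck_inverse B (A := fun x v => v + x ** v)) => //; first exact: ball_open.
    by move=> x xr w; exact: inj.
  move=> w; apply: Ck_D; [exact: ball_open|exact: Ck_cst|].
  by apply: (Ck_bilin mb); [exact: ball_open|exact: Ck_id|exact: Ck_cst].
have Cb : Ck_on k (ball 0 r) bq.
  apply: (Ck_eq (f := fun x => \sum_(i < n) (fc B i x : R) *: N x (fb B i))).
  - exact: ball_open.
  - move=> x xr; apply/eqP; rewrite -subr_eq0; apply/eqP/(inj x _ xr).
    rewrite (linB (mul_linearr x)) addrACA -opprD bq_eq; last exact: rY.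
    apply/eqP; rewrite subr_eq0; apply/eqP; rewrite (lin_sum (mul_linearr x)) -big_split /=.
    rewrite [RHS](fbK B); apply: eq_bigr => i _.
    by rewrite (linZ (mul_linearr x)) -scalerDr hN.
  - apply: Ck_sum; first exact: ball_open.
    move=> i; apply: Ck_scale; [exact: ball_open| |exact: CN].
    by apply: (@Ck_lin _ J R^o); [exact: linearP|exact: fc_continuous].
apply: Ck_local => x Yx; have [g [g' [a' S]]] := Yorbit Yx.
have [h [h' [[lh _ _ _] gh hg _ _]]] := strmap_inv S; have [lg lg' _ _] := S.
pose V := [set y | ball 0 r (h (y - x))].
have ch : continuous (fun y => h (y - x)).
  move=> y; apply: (@continuous_comp _ _ _ (fun y => y - x) h).
    by apply: cvgB; [exact: cvg_id|exact: cvg_cst].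
  exact: (lin_continuous B lh).
have oV : open V.
  by apply: (open_comp _ (ball_open 0 r)) => y _; exact: ch.
exists V; first by rewrite /V /= subrr (lin0 lh); exact: ballxx.
apply: (Ck_eq (f := fun y => a' + g' (bq (h (y - x))))) => //.
  by move=> y Vy; rewrite -(b_str S Yx); [rewrite hg addrC subrK|exact: rY].
apply: Ck_D => //; first exact: Ck_cst.
apply: Ck_lin_comp => //; first exact: (lin_continuous B lg').
apply: (Ck_comp B (f := fun y => h (y - x)) oV (ball_open 0 r)) => //.
apply: (@Ck_lin_comp _ _ _ _ _ _ h (fun y => y - x)) => //.
  exact: (lin_continuous B lh).
by apply: Ck_B => //; [exact: Ck_id|exact: Ck_cst].
Qed.

Lemma bq_diff x : Y x -> differentiable bq x.
Proof. by have [H _] := Ck_bq 1; exact: H. Qed.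

Lemma bq_diff1 u x : Y x -> differentiable ('D_u bq) x.
Proof. by have [_ /(_ u)[H _]] := Ck_bq 2; exact: H. Qed.

Lemma bq_diff2 v u x : Y x -> differentiable ('D_v ('D_u bq)) x.
Proof. by have [_ /(_ u)[_ /(_ v)[H _]]] := Ck_bq 3; exact: H. Qed.

(** An equation of the shape [(1 + L_w) G + H = K] keeps this shape under differentiation, with the
    new term [t ** G] joining [H]. The equation of [bq] can therefore be differentiated
    repeatedly. *)
Lemma derive_implicit (G H K : J -> J) t (U : set J) : open U ->
  (forall w, U w -> differentiable G w) -> (forall w, U w -> differentiable H w) ->
  (forall w, U w -> G w + (H w + w ** G w) = K w) -> forall w, U w ->
  'D_t G w + ('D_t H w + (t ** G w + w ** 'D_t G w)) = 'D_t K w.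
Proof.
move=> oU dG dH GHK w Uw.
have dm : is_diff w (fun w => w ** G w) (fun t => w ** 'd G w t + t ** G w).
  by apply: (bilin_is_diff mb (is_diff_id w)); exact/differentiableP/dG.
have D : is_diff w (G + (H + (fun w => w ** G w)))
    (('d G w : J -> J) + (('d H w : J -> J) + (fun t => w ** 'd G w t + t ** G w))).
  exact: (is_diffD (differentiableP (dG w Uw)) (is_diffD (differentiableP (dH w Uw)) dm)).
have <- : 'D_t (G + (H + (fun w => w ** G w))) w = 'D_t K w.
  apply: near_eq_derive; near=> y; apply: GHK; near: y; exact: open_nbhs_nbhs.
have [d dE] := D; rewrite (deriveE t d) dE !fctE (deriveE t (dG w Uw)) (deriveE t (dH w Uw)).
by congr (_ + (_ + _)); rewrite addrC.
Unshelve. all: by end_near. Qed.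

(** Three successive derivatives of [b + x b = x], read at [x = 0], where [b = 0]. *)
Lemma bq_jet0 : [/\ forall u, 'D_u bq 0 = u,
  forall v u, 'D_v ('D_u bq) 0 = - (u ** v) *+ 2
  & forall t v u, 'D_t ('D_v ('D_u bq)) 0 =
      (u ** (v ** t) + v ** (u ** t) + t ** (u ** v)) *+ 2].
Proof.
have d0 w : differentiable (0 : J -> J) w by exact: differentiable_cst.
have E1 u w : Y w -> 'D_u bq w + (u ** bq w + w ** 'D_u bq w) = u.
  move=> Yw; have := derive_implicit u Yopen bq_diff (fun w _ => d0 w)
    (K := id) _ Yw; rewrite derive_id derive_cst add0r; apply.
  by move=> y Yy; rewrite add0r bq_eq.
have dmul u (G : J -> J) w : differentiable G w ->
    differentiable (fun w => u ** G w) w /\ forall t, 'D_t (fun w => u ** G w) w = u ** 'D_t G w.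
  move=> dG; have D : is_diff w (mul u \o G) (mul u \o 'd G w).
    apply: is_diff_comp; first exact/differentiableP.
    by apply: is_diff_lin => //; exact: (lin_continuous B).
  have [d dE] := D; split => // t; rewrite (deriveE t dG).
  by rewrite -[LHS]/('D_t (mul u \o G) w) (deriveE t d) dE.
have E2 v u w : Y w -> 'D_v ('D_u bq) w +
    (u ** 'D_v bq w + (v ** 'D_u bq w + w ** 'D_v ('D_u bq) w)) = 0.
  move=> Yw; have := derive_implicit (G := 'D_u bq) (H := fun w => u ** bq w) v Yopen
    (bq_diff1 u) (fun w Yw => (dmul u bq w (bq_diff Yw)).1) (E1 u) Yw.
  by rewrite derive_cst ((dmul u bq w (bq_diff Yw)).2 v).
have E3 t v u : 'D_t ('D_v ('D_u bq)) 0 + (u ** 'D_t ('D_v bq) 0 + v ** 'D_t ('D_u bq) 0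
    + t ** 'D_v ('D_u bq) 0) = 0.
  have dH w : Y w -> is_diff w ((fun w => u ** 'D_v bq w) + (fun w => v ** 'D_u bq w))
      (('d (fun w => u ** 'D_v bq w) w : J -> J) + ('d (fun w => v ** 'D_u bq w) w : J -> J)).
    by move=> Yw; apply: is_diffD; apply/differentiableP;
      [exact: (dmul u _ w (bq_diff1 v Yw)).1|exact: (dmul v _ w (bq_diff1 u Yw)).1].
  have hyp w : Y w -> 'D_v ('D_u bq) w + (((fun w => u ** 'D_v bq w) +
      (fun w => v ** 'D_u bq w)) w + w ** 'D_v ('D_u bq) w) = (fun=> 0) w.
    by move=> Yw; rewrite -[RHS](E2 v u w Yw) [X in _ = _ + X]addrA.
  have [d1 e1] := dmul u _ 0 (bq_diff1 v Yzero).
  have [d2 e2] := dmul v _ 0 (bq_diff1 u Yzero).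
  have := derive_implicit t Yopen (bq_diff2 v u)
    (fun w Yw => let: DiffDef d _ := dH w Yw in d) hyp Yzero.
  rewrite [X in _ = X -> _](derive_cst (0 : J) 0 t) (m0l ('D_t _ 0)) [X in _ + (_ + X)]addr0.
  rewrite [X in _ + (X + _)]deriveD; [|exact: diff_derivable|exact: diff_derivable].
  by rewrite e1 e2.
have J1 u : 'D_u bq 0 = u by have := E1 u 0 Yzero; rewrite b0 m0r m0l !addr0.
have J2 v u : 'D_v ('D_u bq) 0 = - (u ** v) *+ 2.
  have := E2 v u 0 Yzero; rewrite !J1 m0l addr0 (mC v u) => /eqP.
  by rewrite addr_eq0 => /eqP ->; rewrite mulr2n opprD.
split; [exact: J1|exact: J2|move=> t v u].
have h := E3 t v u; rewrite (J2 t v) (J2 t u) (J2 v u) in h.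
apply: oppr_inj; rewrite (addr0_eq h).
rewrite !mulr2n !mDr !mNr (mC v t) (mC u t).
by clear h; apply: (fc_ext (B := B)) => i; rewrite !fcE; ring.
Qed.

(** The chain rule for an intertwining identity. Iterated, it carries the jet of [bq] from [0] to
    [a]; the constant [c] is the translation part for [bq] itself and [0] for its derivatives. *)
Lemma derive_transport g g' a a' (F G : J -> J) c u : strmap g g' a a' -> Y a ->
  (forall w, Y w -> differentiable F w) -> (forall w, Y w -> differentiable G w) ->
  (forall w, Y w -> F (a + g w) = c + g' (G w)) ->
  forall w, Y w -> 'D_(g u) F (a + g w) = g' ('D_u G w).
Proof.
move=> S Ya dF dG FG w Yw; have [lg lg' _ _] := S.
have Yg : Y (a + g w) by exact/(Y_str _ S Ya).
have dphi : is_diff w (cst a + g) (0 + g).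
  by apply: is_diffD; apply: is_diff_lin => //; exact: (lin_continuous B).
have D1 : is_diff w (F \o (cst a + g)) ('d F (a + g w) \o (0 + g)).
  by apply: is_diff_comp; exact/differentiableP/dF.
have D2 : is_diff w (cst c + (g' \o G)) (0 + (g' \o 'd G w)).
  apply: is_diffD; apply: is_diff_comp; first exact/differentiableP/dG.
  by apply: is_diff_lin => //; exact: (lin_continuous B).
have e : 'D_u (F \o (cst a + g)) w = 'D_u (cst c + (g' \o G)) w.
  apply: near_eq_derive; near=> y; apply: FG; near: y; exact: open_nbhs_nbhs.
have [d1 e1] := D1; have [d2 e2] := D2.
move: e; rewrite (deriveE u d1) (deriveE u d2) e1 e2 !fctE /= !add0r.
by rewrite (deriveE _ (dF _ Yg)) (deriveE _ (dG _ Yw)).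
Unshelve. all: by end_near. Qed.

Lemma bq_jet g g' x a' : strmap g g' x a' -> Y x ->
  [/\ forall u, 'D_(g u) bq x = g' u,
  forall v u, 'D_(g v) ('D_(g u) bq) x = g' (- (u ** v) *+ 2)
  & forall t v u, 'D_(g t) ('D_(g v) ('D_(g u) bq)) x =
      g' ((u ** (v ** t) + v ** (u ** t) + t ** (u ** v)) *+ 2)].
Proof.
move=> S Yx; have [lg lg' _ _] := S; have [J1 J2 J3] := bq_jet0.
have x0 : x = x + g 0 by rewrite (lin0 lg) addr0.
have T1 u w : Y w -> 'D_(g u) bq (x + g w) = 0 + g' ('D_u bq w).
  move=> Yw; rewrite add0r; apply: (derive_transport (c := a') u S Yx bq_diff bq_diff) => // y.
  exact: (b_str S Yx).
have T2 v u w : Y w -> 'D_(g v) ('D_(g u) bq) (x + g w) = 0 + g' ('D_v ('D_u bq) w).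
  by move=> Yw; rewrite add0r; apply: (derive_transport v S Yx (bq_diff1 _) (bq_diff1 _) (T1 u)).
split=> [u|v u|t v u]; rewrite {1}x0.
- by rewrite T1// add0r J1.
- by rewrite T2// add0r J2.
by rewrite (derive_transport t S Yx (bq_diff2 _ _) (bq_diff2 _ _) (T2 v u) Yzero) J3.
Qed.

End QuasiInverseCalculus.

(** The mean value theorem controls the increments of each [f k] by its differential along the
    segment, and uniform convergence of the differentials lets the bound pass to the limit. *)
Lemma is_diff_limit (R : realType) (E : normedModType R) (U : set E)
    (f : nat -> E -> R) (l : E -> R) (df : nat -> E -> E -> R) (dl : E -> E -> R) :
  open U -> (forall k x, U x -> is_diff x (f k) (df k x)) ->
  (forall x, U x -> f^~ x @ \oo --> l x) ->
  (forall e : R, 0 < e -> \forall k \near \oo, forall x u, U x ->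
     `|df k x u - dl x u| <= e * `|u|) ->
  (forall x, U x -> linear (dl x : E -> R^o) /\ continuous (dl x)) ->
  (forall x (e : R), U x -> 0 < e -> \forall y \near x, forall u,
     `|dl y u - dl x u| <= e * `|u|) ->
  forall x, U x -> is_diff x l (dl x).
Proof.
move=> oU df_ fl dfl ldl cdl x Ux; have [lx cx] := ldl x Ux.
apply: is_diff_near => // e e0; have e2 : 0 < e / 2 by rewrite divr_gt0.
have /nbhs_ballP[r /= r0 hr] : nbhs x [set y | U y /\
    forall u, `|dl y u - dl x u| <= e / 2 * `|u|].
  by apply: filterI; [exact: open_nbhs_nbhs|exact: cdl].
apply/nbhs_ballP; exists r => // h; rewrite /= -ball_normE /= sub0r normrN => hr'.
have bs (t : R) : 0 <= t <= 1 -> ball x r (x + t *: h).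
  move=> /andP[t0 t1]; rewrite -ball_normE /= opprD addrA subrr sub0r normrN normrZ.
  by apply: le_lt_trans hr'; rewrite ger0_norm// ler_piMl.
have Uxh : U (x + h) by have := bs 1; rewrite scale1r ler01 lexx => /(_ isT)/hr[].
have cl : (fun k => f k (x + h) - f k x) @ \oo --> l (x + h) - l x.
  by apply: cvgB; exact: fl.
apply: (@cvg_norm_le R R^o _ _ _ _ cl).
have := dfl _ e2; apply: filterS => k hk.
have [t t01|t /andP[t0 t1]] := @segment_MVT R E (f k) x h.
  by have [] := df_ k _ (hr _ (bs t t01)).1.
have t01 : 0 <= t <= 1 by rewrite !ltW.
have [Ut ht] := hr _ (bs t t01).
have [_ ->] := df_ k _ Ut => ->.
rewrite -[X in `|X|](subrKA (dl (x + t *: h) h)); apply: (le_trans (ler_normD _ _)).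
by have := hk _ h Ut; have := ht h; lra.
Qed.

(** * Local primitives of the form gamma(dx, b) *)

Section Primitive.
Context {R : realType} {J : normedModType R} {n : nat} (B : fbasis J n).
Context (mul : J -> J -> J) (mul_linearl : forall y, linear (mul^~ y))
  (mul_linearr : forall x, linear (mul x)) (hJ : jordan_product mul).
Context (gamma : J -> J -> R^o) (gamma_linearl : forall y, linear (gamma^~ y))
  (gamma_linearr : forall x, linear (gamma x)) (hgamma : trace_form mul gamma)
  (gamma_nd : nondegenerate_form gamma).
Local Notation "x ** y" := (mul x y) (at level 40, left associativity).
Local Notation strmap := (strmap mul gamma).
Local Notation Y := (quasi_domain mul).
Local Notation bq := (bq mul).

Let mC := mulJC hJ.
Let mb := mul_bilin B mul_linearl mul_linearr.
Let gb : bilin gamma := fbasis_bilin B B gamma_linearl gamma_linearr.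
Let strmap_inv := strmap_inv B gamma_linearl gamma_linearr hgamma gamma_nd.

(** The power [w^(k+1)]; the exponent is shifted because [J] need not contain a unit. *)
Definition jpow (k : nat) (w : J) : J := iter k (mul w) w.

Lemma jpowS k w : jpow k.+1 w = w ** jpow k w. Proof. by []. Qed.

(** The linearized identity for [(jpow m w, w, w)] expresses the multiplication by [jpow m.+2 w]
    through those by [jpow m.+1 w], [jpow m w], [w] and [w ** w]. As [L_w] commutes with [L_(w^2)],
    commutation with both passes on by a two-step induction. *)
Lemma jpow_commute k w v :
  w ** (jpow k w ** v) = jpow k w ** (w ** v) /\
  (w ** w) ** (jpow k w ** v) = jpow k w ** ((w ** w) ** v).
Proof.
have [_ jord] := hJ.
pose P k := forall v, w ** (jpow k w ** v) = jpow k w ** (w ** v) /\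
  (w ** w) ** (jpow k w ** v) = jpow k w ** ((w ** w) ** v).
suff H m : P m /\ P m.+1 by exact: (H k).1.
elim: m => [|m [P0 P1]].
  by split=> {}v; split; rewrite /jpow //= ?jord.
split=> // {}v.
have rec u : jpow m.+2 w ** u = w ** (jpow m.+1 w ** u) + w ** (jpow m.+1 w ** u)
    + jpow m w ** ((w ** w) ** u) - w ** (w ** (jpow m w ** u)) - jpow m w ** (w ** (w ** u)).
  have e1 := jordan_linearized B mul_linearl mul_linearr hJ (jpow m w) w w u.
  have e2 := jordan_linearized B mul_linearl mul_linearr hJ (jpow m w) u w w.
  have j1 : jpow m w ** w = jpow m.+1 w by rewrite mC.
  have j2 : jpow m.+1 w ** w = jpow m.+2 w by rewrite mC.
  move: e1 e2; rewrite j1 j2 (mC (jpow m w ** u) (w ** w)) (mC u w) (mC (w ** u) w).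
  rewrite (mC (jpow m w ** u) w) (mC u (jpow m.+2 w)).
  rewrite (mC (w ** w) (jpow m w ** u)) (mC (w ** u) (jpow m.+1 w)).
  move: (jpow m.+2 w ** u) (jpow m.+1 w ** (w ** u)) => X1 X2.
  move: (w ** (jpow m.+1 w ** u)) ((jpow m w ** u) ** (w ** w)) => X3 X4.
  move: (jpow m w ** ((w ** w) ** u)) (w ** (w ** (jpow m w ** u))) => X5 X6.
  move: (jpow m w ** (w ** (w ** u))) => X7 E1 E2.
  apply: (fc_ext (B := B)) => i.
  move: (congr1 (fun z : J => fc B i z : R) E1) (congr1 (fun z : J => fc B i z : R) E2).
  rewrite !fcE; lra.
have c0 u : w ** (jpow m w ** u) = jpow m w ** (w ** u) := (P0 u).1.
have c1 u : w ** (jpow m.+1 w ** u) = jpow m.+1 w ** (w ** u) := (P1 u).1.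
have s0 u : (w ** w) ** (jpow m w ** u) = jpow m w ** ((w ** w) ** u) := (P0 u).2.
have s1 u : (w ** w) ** (jpow m.+1 w ** u) = jpow m.+1 w ** ((w ** w) ** u) := (P1 u).2.
have ww u : (w ** w) ** (w ** u) = w ** ((w ** w) ** u) by rewrite jord.
move: (jpow m w) (jpow m.+1 w) (jpow m.+2 w) rec c0 c1 s0 s1 => a b c rec c0 c1 s0 s1.
rewrite !rec !(mulJNr mul_linearr, mulJDr mul_linearr); split.
  by rewrite !(c0, c1, ww).
by rewrite !(s0, s1, ww).
Qed.

(** Power associativity: since [L_w] commutes with multiplication by a power of [w], the factors of
    the second power move out one at a time. *)
Lemma jpowM m k w : jpow m w ** jpow k w = jpow (m + k).+1 w.
Proof.
elim: k => [|k IH]; first by rewrite mC addn0.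
by rewrite jpowS -(jpow_commute m w _).1 IH addnS.
Qed.

(** Paired with a power of [w], the [k + 1] contributions to the differential of [w^(k+1)] all
    become equal, by the invariance of the trace form and power associativity. *)
Lemma jpow_diff k w : differentiable (jpow k) w /\
  forall m u, gamma (jpow m w) ('d (jpow k) w u) = k.+1%:R * gamma u (jpow (m + k) w).
Proof.
have [gC gA] := hgamma; elim: k => [|k [dk IH]].
  have [d dE] := is_diff_id w; split=> // m u.
  by rewrite addn0 mul1r -[jpow 0]/(@id J) dE gC.
have D : is_diff w (jpow k.+1) (fun u => w ** 'd (jpow k) w u + u ** jpow k w).
  exact: (bilin_is_diff mb (is_diff_id w) (differentiableP dk)).
have [d dE] := D; split=> // m u; rewrite dE (linD (gamma_linearr _)).
rewrite -gA (mC _ w) -jpowS IH.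
rewrite [gamma (jpow m w) _]gC gA (mC (jpow k w)) jpowM addSnnS -addnS.
by rewrite -[k.+2%:R]natr1 mulrDl mul1r.
Qed.

Definition neumann (N : nat) (w : J) : J := \sum_(k < N) (-1) ^+ k *: jpow k w.
(** [gamma w (jpow k w)] is homogeneous of degree [k + 2], whence the divisor. For [J = R] with its
    usual product as pairing, the terms sum to [w - ln(1 + w)]. *)
Definition pot_term (k : nat) (w : J) : R := (-1) ^+ k / k.+2%:R * gamma w (jpow k w).
Definition pot_sum (N : nat) (w : J) : R := \sum_(k < N) pot_term k w.

Lemma pot_term_diff k w :
  is_diff w (pot_term k) (fun u => gamma u ((-1) ^+ k *: jpow k w)).
Proof.
have [dk hk] := jpow_diff k w; have [gC _] := hgamma.
have D := bilin_is_diff gb (is_diff_id w) (differentiableP dk).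
have D2 := is_diffZ ((-1) ^+ k / k.+2%:R) D.
apply: is_diff_congr D2 => // u; have := hk 0%N u; rewrite -[jpow 0 w]/w add0n => hk0.
rewrite (linZ (gamma_linearr u)) -[RHS]/(_ * _).
rewrite -[LHS]/(((-1) ^+ k / k.+2%:R) * (gamma w ('d (jpow k) w u) + gamma u (jpow k w))) hk0.
rewrite -[X in _ * (_ + X)]mul1r -mulrDl natr1 mulrA divfK ?pnatr_eq0//.
Qed.

Lemma pot_sum_diff N w : is_diff w (pot_sum N) (fun u => gamma u (neumann N w)).
Proof.
apply: is_diff_congr (is_diff_sum (index_enum 'I_N) (fun k : 'I_N => pot_term_diff k w)) => // u.
by rewrite /neumann (lin_sum (gamma_linearr u)).
Qed.

Section SmallBall.
Context (r C : R) (r0 : 0 < r) (C0 : 0 < C) (rY : ball 0 r `<=` Y)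
  (hC : forall x y, `|x ** y| <= C * `|x| * `|y|) (Cr : C * r <= 2^-1).

Lemma jpow_bound k w : ball 0 r w -> `|jpow k w| <= 2^-1 ^+ k * `|w|.
Proof.
rewrite -ball_normE /= sub0r normrN => wr; apply: iter_bound => // y.
apply: (le_trans (hC _ _)); apply: ler_wpM2r => //; apply: le_trans Cr.
by rewrite ler_pM2l// ltW.
Qed.

(** In the equation [b + w b = w] the partial sum leaves the residual [w^(N+1)] up to sign, and
    [small_estimate] turns the residual into an error. *)
Lemma neumann_bound N w : ball 0 r w -> `|neumann N w - bq w| <= 2^-1 ^+ N * (2 * r).
Proof.
move=> wr; have h := small_estimate (neumann N w - bq w) hC C0 Cr wr.
apply: (le_trans h).
have nS M : neumann M w + w ** neumann M w = w - (-1) ^+ M *: jpow M w.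
  elim: M => [|M IH].
    by rewrite /neumann big_ord0 (mulJ0r mul_linearr) expr0 scale1r addr0 subrr.
  have -> : neumann M.+1 w = neumann M w + (-1) ^+ M *: jpow M w by rewrite /neumann big_ord_recr.
  rewrite (linD (mul_linearr w)) addrACA IH (linZ (mul_linearr w)).
  by rewrite -jpowS exprS mulN1r scaleNr opprK addrA subrK.
have -> : neumann N w - bq w + w ** (neumann N w - bq w) = - ((-1) ^+ N *: jpow N w).
  rewrite (linB (mul_linearr w)) addrACA nS -opprD.
  rewrite (bq_eq B mul_linearl mul_linearr hJ (rY wr)).
  by rewrite addrAC subrr add0r.
rewrite normrN normrZ normrX normrN1 expr1n mul1r.
rewrite mulrCA; apply: ler_wpM2l => //; apply: (le_trans (jpow_bound N wr)).
apply: ler_wpM2l; first by rewrite exprn_ge0.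
by move: wr; rewrite -ball_normE /= sub0r normrN => /ltW.
Qed.

Definition pot (w : J) : R := limn (pot_sum^~ w).

Lemma pot_cvg w : ball 0 r w -> pot_sum^~ w @ \oo --> pot w.
Proof.
move=> wr; have [D D0 hD] := bilin_bound gb.
suff : cvgn (series (fun k => pot_term k w)).
  rewrite (_ : series _ = pot_sum^~ w)//.
  by apply/funext => N; rewrite /series /= big_mkord.
apply: normed_cvg; apply: (@series_le_cvg _ _ (geometric (D * `|w| * `|w|) 2^-1)) => [k|k|k|] //=.
- by rewrite !mulr_ge0// ?exprn_ge0// ltW.
- rewrite /pot_term normrM normrM normrX normrN1 expr1n mul1r.
  rewrite ger0_norm ?invr_ge0// ler_pdivrMl ?ltr0n//.
  apply: (le_trans (hD _ _)); apply: (@le_trans _ _ (D * `|w| * `|w| * 2^-1 ^+ k)).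
    rewrite -[leRHS]mulrA; apply: ler_wpM2l; first by rewrite mulr_ge0// ltW.
    by rewrite mulrC; exact: jpow_bound.
  rewrite ler_peMl// ?ler1n// !mulr_ge0// ?exprn_ge0//; exact: ltW.
apply: is_cvg_geometric_series; rewrite ger0_norm//.
by rewrite invf_lt1// ltr1n.
Qed.

Lemma pot_diff w : ball 0 r w -> is_diff w pot (fun u => gamma u (bq w)).
Proof.
have [D D0 hD] := bilin_bound gb.
apply: (is_diff_limit (ball_open 0 r) (f := pot_sum)
  (df := fun N w u => gamma u (neumann N w)) (dl := fun w u => gamma u (bq w))).
- by move=> k x _; exact: pot_sum_diff.
- exact: pot_cvg.
- move=> e e0.
  have c : D * (2^-1 ^+ N * (2 * r)) @[N --> \oo] --> (0 : R).
    rewrite -[X in _ --> X](mulr0 D); apply: cvgMr.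
    rewrite -[X in _ --> X](mul0r (2 * r)); apply: cvgMl.
    by apply: cvg_expr; rewrite ger0_norm// invf_lt1// ltr1n.
  have /cvgrPdist_le/(_ _ e0) := c; apply: filterS => N; rewrite sub0r normrN => hN x u xr.
  rewrite -(linB (gamma_linearr u)); apply: (le_trans (hD _ _)).
  rewrite mulrAC; apply: ler_wpM2r => //; apply: le_trans (le_trans (ler_norm _) hN).
  by rewrite ler_pM2l//; exact: neumann_bound.
- by move=> x xr; split; [exact: gamma_linearl|exact: (lin_continuous B (gamma_linearl _))].
move=> x e xr e0.
have cb : {for x, continuous bq}.
  apply: (Ck_continuous (Ck_bq B mul_linearl mul_linearr hJ gamma_linearl gamma_linearr
    hgamma gamma_nd 0)); exact: rY.
have e' : 0 < e / D by rewrite divr_gt0.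
have /cvgrPdist_le/(_ _ e') := cb; apply: filterS => y hy u.
rewrite -(linB (gamma_linearr u)); apply: (le_trans (hD _ _)).
rewrite mulrAC; apply: ler_wpM2r => //.
by rewrite mulrC -ler_pdivlMr// distrC.
Qed.

End SmallBall.

End Primitive.

Lemma cvg_shift (T : topologicalType) (f : nat -> T) (k : nat) (l : T) :
  (fun N => f (N + k)%N) @ \oo --> l -> f @ \oo --> l.
Proof.
move=> h P /h [M _ hM]; exists (M + k)%N => // N /= MN.
have kN : (k <= N)%N by apply: leq_trans MN; exact: leq_addl.
by rewrite -(subnK kN); apply: hM; rewrite /= leq_subRL// addnC.
Qed.

(** * Power series expansions *)

Section Analytic.
Context {R : realType}.
Implicit Types E F G : normedModType R.

Lemma multilinear_cons E F G k (b : E -> F -> G) (m : ('I_k -> E) -> F) :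
  (forall y, linear (b^~ y)) -> (forall x, linear (b x)) -> multilinear m ->
  multilinear (fun v : 'I_k.+1 -> E => b (v ord0) (m (fun j => v (lift ord0 j)))).
Proof.
move=> bl br hm i v; case: (unliftP ord0 i) => [i' ->|->].
  move=> a u w; rewrite !(negPf (neq_lift _ _)).
  have e x : (fun j => if lift ord0 j == lift ord0 i' then x else v (lift ord0 j)) =
      (fun j => if j == i' then x else v (lift ord0 j)).
    by apply/funext => j; rewrite (inj_eq lift_inj).
  by rewrite !e hm br.
have e x : (fun j : 'I_k => if lift ord0 j == ord0 then x else v (lift ord0 j)) =
    (fun j => v (lift ord0 j)).
  by apply/funext => j; rewrite eq_sym (negPf (neq_lift _ _)).
have H x : b (if ord0 == ord0 :> 'I_k.+1 then x else v ord0)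
    (m (fun j => if lift ord0 j == ord0 then x else v (lift ord0 j))) =
    b x (m (fun j => v (lift ord0 j))).
  exact: (congr1 (b x) (congr1 m (e x))).
by move=> a u w; rewrite [LHS]H bl; congr (_ *: _ + _); exact/esym/H.
Qed.

Lemma multilinear_lin E F k (h : E -> E) (m : ('I_k -> E) -> F) : linear h ->
  multilinear m -> multilinear (fun v => m (fun j => h (v j))).
Proof.
move=> lh hm i v a u w.
have e x : (fun j => h (if j == i then x else v j)) = (fun j => if j == i then h x else h (v j)).
  by apply/funext => j; case: ifP.
by rewrite !e lh hm.
Qed.

Lemma multilinear_post E F G k (l : F -> G) (m : ('I_k -> E) -> F) : linear l ->
  multilinear m -> multilinear (fun v => l (m v)).
Proof. by move=> ll hm i v a u w; rewrite hm ll. Qed.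

Lemma multilinear1 E : multilinear (fun v : 'I_1 -> E => v ord0).
Proof. by move=> i v a u w; rewrite (ord1 i) !eqxx. Qed.

Lemma analytic_near_eq E F (U : set E) (f g : E -> F) :
  (forall x, U x -> \forall y \near x, f y = g y) -> analytic_on U f -> analytic_on U g.
Proof.
move=> fg fa x Ux; have [m [C [rho [r [r0 hm hb hs]]]]] := fa x Ux.
have /nbhs_ballP[s /= s0 hfg] := fg x Ux.
exists m, C, rho, (Num.min r s); split => //; first by rewrite lt_min r0.
move=> v; rewrite lt_min => /andP[vr vs]; rewrite -hfg; first exact: hs.
by rewrite -ball_normE /= opprD addrA subrr sub0r normrN.
Qed.

Lemma analytic_addc E F (U : set E) (f : E -> F) (a : F) :
  analytic_on U f -> analytic_on U (fun x => f x + a).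
Proof.
move=> fa x Ux; have [m [C [rho [r [r0 hm hb hs]]]]] := fa x Ux.
pose m' k : ('I_k -> E) -> F := match k return ('I_k -> E) -> F with
  | 0 => fun v => m 0%N v + a | k'.+1 => @m k'.+1 end.
(* Absolute values, since the given [C] and [rho] may be negative. *)
exists m', (`|C| + `|a|), `|rho|, r; split => //.
- by case=> [|k]; [case|exact: hm].
- have h k (v : 'I_k -> E) : `|m k v| <= `|C| * `|rho| ^+ k * \prod_(i < k) `|v i|.
    apply: (le_trans (hb k v)); apply: ler_wpM2r; first exact: prodr_ge0.
    by rewrite -normrX -normrM ler_norm.
  move=> [|k] v.
    apply: (le_trans (ler_normD _ _)); rewrite big_ord0 expr0 !mulr1 lerD2r.
    by have := h 0%N v; rewrite big_ord0 expr0 !mulr1.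
  apply: (le_trans (h k.+1 v)); apply: ler_wpM2r; first exact: prodr_ge0.
  by apply: ler_wpM2r; [exact: exprn_ge0|rewrite lerDl].
move=> v vr; apply: (@cvg_shift _ _ 1).
have -> : (fun N => series (fun k => m' k (fun=> v)) (N + 1)%N) =
    (fun N => series (fun k => m k (fun=> v)) (N + 1)%N + a).
  apply/funext => N; rewrite addn1 /series /= !big_nat_recl//= addrAC.
  by [].
apply: cvgD; last exact: cvg_cst.
by have := hs v vr; rewrite -(cvg_shiftn 1).
Qed.

Lemma analytic_id E (U : set E) : analytic_on U id.
Proof.
move=> x _; pose m k : ('I_k -> E) -> E := match k return ('I_k -> E) -> E with
  | 0 => fun=> x | 1 => fun v => v ord0 | _.+2 => fun=> 0 end.
exists m, (`|x| + 1), 1, 1; split => //.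
- case=> [|[|k]]; first by move=> [].
    exact: multilinear1.
  by move=> i v a u w; rewrite /= scaler0 addr0.
- move=> k v; rewrite expr1n mulr1.
  case: k v => [|[|k]] v /=.
  + by rewrite big_ord0 mulr1 lerDl.
  + by rewrite big_ord1 mulrDl mul1r lerDr mulr_ge0.
  + by rewrite normr0 mulr_ge0 ?addr_ge0// prodr_ge0.
move=> v _; apply: cvg_near_cst; exists 2%N => // -[//|[//|N]] _.
by rewrite /series /= big_nat_recl// big_nat_recl// big1 ?addr0.
Qed.

End Analytic.

Section PrimitiveExpansion.
Context {R : realType} {J : normedModType R} {n : nat} (B : fbasis J n).
Context (mul : J -> J -> J) (mul_linearl : forall y, linear (mul^~ y))
  (mul_linearr : forall x, linear (mul x)) (hJ : jordan_product mul).
Context (gamma : J -> J -> R^o) (gamma_linearl : forall y, linear (gamma^~ y))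
  (gamma_linearr : forall x, linear (gamma x)) (hgamma : trace_form mul gamma)
  (gamma_nd : nondegenerate_form gamma).
Local Notation "x ** y" := (mul x y) (at level 40, left associativity).
Local Notation strmap := (strmap mul gamma).
Local Notation Y := (quasi_domain mul).
Local Notation bq := (bq mul).

Let gb : bilin gamma := fbasis_bilin B B gamma_linearl gamma_linearr.
Let strmap_inv := strmap_inv B gamma_linearl gamma_linearr hgamma gamma_nd.
Let Yorbit := quasi_domain_orbit B mul_linearl mul_linearr hJ gamma_linearl gamma_linearr hgamma gamma_nd.
Let b_str := bq_strmap B mul_linearl mul_linearr hJ gamma_linearl gamma_linearr hgamma gamma_nd.
Let Yopen : open Y := quasi_domain_open B mul_linearl mul_linearr hJ gamma_linearl gamma_linearr hgamma.

(** A multilinear map whose diagonal is [jpow k], hence with [k + 1] arguments. *)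
Fixpoint jnest (k : nat) : ('I_k.+1 -> J) -> J :=
  match k return ('I_k.+1 -> J) -> J with
  | 0 => fun v => v ord0
  | k'.+1 => fun v => v ord0 ** jnest (fun j => v (lift ord0 j))
  end.

Lemma jnest_multilinear k : multilinear (@jnest k).
Proof.
elim: k => [|k IH]; first exact: multilinear1.
exact: (@multilinear_cons R J J J k.+1 mul (@jnest k)).
Qed.

Lemma jnest_cst k w : @jnest k (fun=> w) = jpow mul k w.
Proof. by elim: k => //= k ->. Qed.

Lemma jnest_bound (C : R) k v : 0 < C -> (forall x y, `|x ** y| <= C * `|x| * `|y|) ->
  `|@jnest k v| <= C ^+ k * \prod_(i < k.+1) `|v i|.
Proof.
move=> C0 hC; elim: k v => [|k IH] v /=; first by rewrite expr0 mul1r big_ord1.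
apply: (le_trans (hC _ _)); rewrite big_ord_recl exprS -!mulrA ler_pM2l//.
by rewrite mulrCA; apply: ler_wpM2l => //; exact: IH.
Qed.

(** With [h] inverse to the linear part [g], [bq y = bq x + g' (bq (h (y - x)))] near [x]. The
    constant part has the linear primitive [gamma y (bq x)], and the rest is the pullback of [pot]
    by [y |-> h (y - x)]. The series of [pot] also yields the expansion of the graph map. *)
Lemma local_primitive x : Y x -> exists (psi : J -> R) (r : R),
  [/\ 0 < r, ball x r `<=` Y,
    forall y, ball x r y -> is_diff y psi (fun u => gamma u (bq y))
  & exists (m : forall k, ('I_k -> J) -> (J * R^o)%type) (C rho : R),
    [/\ forall k, multilinear (@m k),
      forall k (v : 'I_k -> J), `|m k v| <= C * rho ^+ k * \prod_(i < k) `|v i|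
    & forall v, `|v| < r ->
      series (fun k => m k (fun=> v)) @ \oo --> ((x + v, psi (x + v)) : J * R^o)]].
Proof.
move=> Yx; have [g [g' [a' S]]] := Yorbit Yx.
have [h [h' [S' gh hg gh' hg']]] := strmap_inv S.
have [lh _ _ _] := S'; have [lg lg' dg _] := S.
have [H H0 hH] := lin_bounded B lh; have [D D0 hD] := bilin_bound gb.
have [s [C [s0 C0 sY hC Cs]]] := small_ball B mul_linearl mul_linearr hJ gamma_linearl
  gamma_linearr hgamma.
have /nbhs_ballP[t /= t0 tY] := open_nbhs_nbhs (conj Yopen Yx).
pose psi (y : J) : R := gamma y (bq x) + pot mul gamma (h (y - x)).
pose r := Num.min t (s / H).
have r0 : 0 < r by rewrite lt_min t0 divr_gt0.
have hr v : `|v| < r -> ball 0 s (h v).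
  rewrite lt_min => /andP[_ vs]; rewrite -ball_normE /= sub0r normrN.
  by apply: (le_lt_trans (hH _)); rewrite mulrC -ltr_pdivlMr.
exists psi, r; split => //.
- by move=> y xy; apply: tY; apply: le_ball xy; rewrite ge_min lexx.
- move=> y xy; have hs : ball 0 s (h (y - x)).
    by apply: hr; move: xy; rewrite -ball_normE /= distrC.
  have D1 : is_diff y (fun y => gamma y (bq x) : R^o) (fun u => gamma u (bq x)).
    by apply: is_diff_lin => //; exact: (lin_continuous B).
  have Dh : is_diff y (fun y => h (y - x)) h.
    have D0' : is_diff y (fun y => y - x) id.
      by apply: is_diff_congr (is_diffB (is_diff_id y) (is_diff_cst x y)) => // u; exact: subr0.
    have := is_diff_comp D0' (is_diff_lin (y - x) lh (lin_continuous B lh)).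
    exact: is_diff_congr.
  have Dp := pot_diff B mul_linearl mul_linearr hJ gamma_linearl gamma_linearr hgamma
    gamma_nd C0 sY hC Cs hs.
  have := is_diffD D1 (is_diff_comp Dh Dp); apply: is_diff_congr => // u.
  have Ys := sY _ hs; have := b_str S Yx Ys; rewrite hg addrC subrK => ->.
  rewrite (strmap_bq B mul_linearl mul_linearr hJ gamma_linearl gamma_linearr hgamma gamma_nd S Yx).
  have e z : gamma u (g' z) = gamma (h u) z by rewrite -[in LHS](hg u) dg.
  by rewrite (linD (gamma_linearr u)) e.
pose c k : R := (-1) ^+ k / k.+2%:R.
(* Degrees 0 and 1 come from the point and the linear primitive; degree [k + 2] comes from the term
   [k] of the potential. *)
pose m k : ('I_k -> J) -> (J * R^o)%type := match k return ('I_k -> J) -> (J * R^o)%type with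
  | 0 => fun=> (x, gamma x (bq x) : R^o)
  | 1 => fun v => (v ord0, gamma (v ord0) (bq x) : R^o)
  | k'.+2 => fun v => (0, c k' *: gamma (h (v ord0)) (jnest (fun j : 'I_k'.+1 => h (v (lift ord0 j)))))
  end.
(* The three summands of the constant bound degree 0, degree 1 and the potential; the ratio
   dominates both 1 and [H (1 + C)], hence [H^(k+2) C^k] in degree [k + 2]. *)
exists m, (`|((x, gamma x (bq x)) : J * R^o)| + (1 + D * `|bq x|) + D), (1 + H * (1 + C)).
have rho1 : 1 <= 1 + H * (1 + C).
  by rewrite lerDl mulr_ge0 ?addr_ge0//; exact: ltW.
split.
- case=> [|[|k]]; first by move=> [].
    apply: (@multilinear_post _ J J (J * R^o)%type 1 (fun y => (y, gamma y (bq x) : R^o)) _ _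
      (@multilinear1 R J)).
    by move=> a u v; congr pair; exact: gamma_linearl.
  apply: (@multilinear_lin _ J (J * R^o)%type k.+2 h (fun v => (0, c k *: gamma (v ord0)
    (jnest (fun j : 'I_k.+1 => v (lift ord0 j)))))) => //.
  apply: (@multilinear_post _ J R^o (J * R^o)%type k.+2 (fun y : R^o => (0, c k *: y)) (fun v =>
    gamma (v ord0) (jnest (fun j : 'I_k.+1 => v (lift ord0 j))))).
    move=> a u v; rewrite -[RHS]/(a *: 0 + 0, a *: (c k *: u) + c k *: v).
    by rewrite scaler0 addr0 scalerDr !scalerA mulrC.
  by apply: multilinear_cons => //; exact: jnest_multilinear.
- have CC0 : 0 <= D * `|bq x| by rewrite mulr_ge0// ltW.
  case=> [|[|k]] v.
  + by rewrite expr0 big_ord0 !mulr1 /m -addrA lerDl !addr_ge0// ltW.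
  + rewrite big_ord1; apply: (@le_trans _ _ ((1 + D * `|bq x|) * `|v ord0|)).
      rewrite /m prod_normE /= ge_max mulrDl mul1r lerDl mulr_ge0//=.
      apply: (le_trans (hD _ _)); rewrite mulrAC ler_wpDl//.
    apply: ler_wpM2r => //; rewrite expr1.
    apply: (@le_trans _ _ ((1 + D * `|bq x|) * 1)); first by rewrite mulr1.
    apply: ler_pM => //; first by rewrite addr_ge0.
    move: (normr_ge0 ((x, gamma x (bq x)) : J * R^o)) D0 (D * _).
    by move: `|(x, _)| => c0 c00 D0 d; lra.
  + rewrite /m prod_normE /= normr0 ge_max.
    have P0 : 0 <= \prod_(i < k.+2) `|v i| by exact: prodr_ge0.
    have K0 : 0 <= `|((x, gamma x (bq x)) : J * R^o)| + (1 + D * `|bq x|) + D.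
      by rewrite !addr_ge0// ltW.
    apply/andP; split.
      apply: mulr_ge0 => //; apply: mulr_ge0 => //; apply: exprn_ge0.
      exact: le_trans rho1.
    have cb : `|c k| <= 1.
      rewrite /c normrM normrX normrN1 expr1n mul1r ger0_norm ?invr_ge0//.
      by rewrite invf_le1 ?ltr0n// ler1n.
    rewrite normrZ; apply: (le_trans (ler_piMl _ cb)) => //.
    apply: (le_trans (hD _ _)).
    have hj := jnest_bound (fun j : 'I_k.+1 => h (v (lift ord0 j))) C0 hC.
    have hj2 : `|jnest (fun j : 'I_k.+1 => h (v (lift ord0 j)))| <=
        C ^+ k * (H ^+ k.+1 * \prod_(i < k.+1) `|v (lift ord0 i)|).
      apply: (le_trans hj); apply: ler_wpM2l; first by rewrite exprn_ge0// ltW.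
      apply: (@le_trans _ _ (\prod_(i < k.+1) (H * `|v (lift ord0 i)|))).
        by apply: ler_prod => i _; rewrite normr_ge0 /=; exact: hH.
      by rewrite big_split /= prodr_const card_ord.
    apply: (@le_trans _ _ (D * (H * `|v ord0|) *
        (C ^+ k * (H ^+ k.+1 * \prod_(i < k.+1) `|v (lift ord0 i)|)))).
      apply: ler_pM => //; first by rewrite mulr_ge0// ltW.
      by rewrite ler_pM2l.
    rewrite [\prod_(i < k.+2) _]big_ord_recl.
    set p := \prod_(i < k.+1) _.
    have -> : D * (H * `|v ord0|) * (C ^+ k * (H ^+ k.+1 * p)) =
        (D * (H ^+ k.+2 * C ^+ k)) * (`|v ord0| * p) by rewrite !exprS; ring.
    apply: ler_wpM2r; first by rewrite mulr_ge0// prodr_ge0.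
    apply: ler_pM; first exact: ltW.
    * by rewrite mulr_ge0// exprn_ge0// ltW.
    * by rewrite lerDr !addr_ge0.
    apply: (@le_trans _ _ ((H * (1 + C)) ^+ k.+2)).
      rewrite exprMn; apply: ler_wpM2l; first by rewrite exprn_ge0// ltW.
      apply: (@le_trans _ _ ((1 + C) ^+ k)).
        by apply: lerXn2r; rewrite ?nnegrE ?addr_ge0// ?lerDr//; exact: ltW.
      by apply: ler_weXn2l; rewrite ?lerDl ?leqW//; exact: ltW.
    apply: lerXn2r; rewrite ?nnegrE ?addr_ge0// ?mulr_ge0 ?addr_ge0 ?lerDr//; exact: ltW.
move=> v vr.
(* From two terms on, the partial sums are the linear part plus [pot_sum N]. *)
apply: (@cvg_shift _ _ 2).
have -> : (fun N => series (fun k => m k (fun=> v)) (N + 2)%N) = (fun N =>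
    (x + v, (gamma x (bq x) + gamma v (bq x)) + pot_sum mul gamma N (h v)) : J * R^o).
  apply/funext => N; rewrite addn2 /series /= big_nat_recl// big_nat_recl// addrA.
  have e : \sum_(0 <= i < N) m i.+2 (fun=> v) = ((0, pot_sum mul gamma N (h v)) : J * R^o).
    rewrite /pot_sum -(big_mkord xpredT (fun k => pot_term mul gamma k (h v))).
    elim: N => [|N IH]; first by rewrite !big_geq.
    rewrite !big_nat_recr//= IH jnest_cst; congr pair; exact: addr0.
  by rewrite e; congr pair; exact: addr0.
apply: (@cvg_pair nat J R^o \oo (nbhs (x + v)) (nbhs (psi (x + v) : R^o)) _ _ _ (fun=> x + v)
  (fun N => gamma x (bq x) + gamma v (bq x) + pot_sum mul gamma N (h v))); first exact: cvg_cst.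
rewrite /psi [x + v]addrC addrK [v + x]addrC (linD (gamma_linearl (bq x))).
apply: cvgD; first exact: cvg_cst.
exact: (pot_cvg B gamma_linearl gamma_linearr C0 hC Cs (hr v vr)).
Qed.

End PrimitiveExpansion.

(** * Integral leaves *)

Section NormedTopology.
Context {R : realType}.

Lemma inj_continuous_hausdorff (S T : topologicalType) (f : S -> T) :
  continuous f -> injective f -> hausdorff_space T -> hausdorff_space S.
Proof.
move=> cf inj hT x y xy; apply/inj/hT => A B fA fB.
have [z [Az Bz]] := xy _ _ (cf _ _ fA) (cf _ _ fB).
by exists (f z).
Qed.

Lemma fst_continuous (S T : topologicalType) : continuous (@fst S T).
Proof. by move=> x; exact: cvg_fst. Qed.

Lemma snd_continuous (S T : topologicalType) : continuous (@snd S T).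
Proof. by move=> x; exact: cvg_snd. Qed.

(** Boxes in coordinates with rational centres and radii [1/(k+1)] form a countable base. *)
Lemma normed_second_countable (E : normedModType R) n (B : fbasis E n) :
  @second_countable E.
Proof.
pose D (kq : nat * {ffun 'I_n -> rat}) :=
  [set y : E | forall i, `|(fc B i y : R) - ratr (kq.2 i)| < kq.1.+1%:R^-1].
have oD kq : open (D kq).
  rewrite openE => y Dy; apply: filter_forall => i /=.
  have e0 : 0 < kq.1.+1%:R^-1 - `|(fc B i y : R) - ratr (kq.2 i)|.
    by rewrite subr_gt0; exact: Dy.
  have /(_ (nbhs_filter y) _ e0) := @cvgr_dist_lt _ _ _ _ _ (fun z => fc B i z : R^o) _ (@fc_continuous _ _ _ B i y).
  apply: filterS => z; rewrite /=.
  rewrite ltrBrDr distrC; apply: le_lt_trans.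
  by rewrite (le_trans _ (ler_normD _ _))// addrA subrK.
exists (range D); first exact: (sub_countable (card_image_le _ _)) (countableP _).
split=> [_ [kq _ <-]//|x W /nbhs_ballP[e /= e0 eW]].
have [C C0 hC] := norm_fc B.
have d0 : 0 < e / (C * (2 * n.+1%:R)) by rewrite divr_gt0// !mulr_gt0.
have [k hk] : exists k : nat, k.+1%:R^-1 < e / (C * (2 * n.+1%:R)).
  exists (Num.truncn (e / (C * (2 * n.+1%:R)))^-1).
  by rewrite invf_plt ?posrE// Num.Theory.truncnS_gt.
have k0 : (0 : R) < k.+1%:R^-1 by rewrite invr_gt0.
have /choice[q hq] : forall i, exists q : rat, `|(fc B i x : R) - ratr q| < k.+1%:R^-1.
  move=> i; have [|q] := @rat_in_itvoo R (fc B i x - k.+1%:R^-1) (fc B i x + k.+1%:R^-1).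
    by rewrite ltrD2l gtrN.
  by rewrite in_itv /= -ltr_distlC => hq; exists q.
exists (D (k, finfun q)); first by split; [exists (k, finfun q)|move=> i /=; rewrite ffunE].
move=> y Dy; apply: eW; rewrite -ball_normE /=; apply: (le_lt_trans (hC _)).
have : \sum_(i < n) `|fc B i (x - y) : R| <= \sum_(i < n) (2 * k.+1%:R^-1).
  apply: ler_sum => i _; rewrite fcB.
  have := Dy i; have := hq i; rewrite /= ffunE => h1 h2.
  have -> : (fc B i x - fc B i y : R) = (fc B i x - ratr (q i)) - (fc B i y - ratr (q i)).
    by rewrite opprB addrA subrK.
  by apply: (le_trans (ler_normB _ _)); rewrite mulr_natl mulr2n lerD// ltW.
rewrite sumr_const card_ord -[_ *+ n]mulr_natr => h.
apply: (@le_lt_trans _ _ (C * (2 * k.+1%:R^-1 * n.+1%:R))).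
  apply: ler_wpM2l; first exact: ltW.
  apply: (le_trans h); apply: ler_wpM2l; first by rewrite mulr_ge0// ltW.
  by rewrite ler_nat.
by move: hk; rewrite ltr_pdivlMr ?mulr_gt0//; congr (_ < _); ring.
Qed.

End NormedTopology.

Section Leaf.
Context {R : realType} {J : normedModType R} {n : nat} (B : fbasis J n).
Local Notation V := (J * R^o)%type.
Context (Y : set J) (omega : J -> J -> R^o).

(** Leaves are studied for a general form [omega], the leaf through a point being a graph of a local
    primitive; the form of the Jordan algebra is substituted later. *)
Definition leaf_field (p : V) : set V := [set w | omega p.1 w.1 - w.2 = 0].

Definition local_prim (x0 : J) (r : R) (psi : J -> R^o) : Prop :=
  [/\ 0 < r, ball x0 r `<=` Y & forall y, ball x0 r y -> is_diff y psi (omega y)].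

Lemma local_prim_Ck x0 r psi k : (forall k u, Ck_on k Y (omega^~ u)) ->
  local_prim x0 r psi -> Ck_on k (ball x0 r) psi.
Proof.
move=> oCk [r0 rY psid]; have oU : open (ball x0 r) := @ball_open _ _ x0 r.
have dpsi y : ball x0 r y -> differentiable psi y by move=> /psid[].
case: k => [y yr|k]; first exact/differentiable_continuous/dpsi.
split=> // u; apply: (Ck_eq oU (f := omega^~ u)); last exact: (Ck_sub rY).
by move=> y yr; rewrite deriveE; [have [_ ->] := psid y yr|exact: dpsi].
Qed.

Context (M : smoothManifold J) (f : M -> V)
  (hI : integral_manifold (Y `*` [set: R^o]) leaf_field f).
Local Notation p := (fst \o f).

Lemma leaf_inj : injective f. Proof. by have [_ _ ] := hI. Qed.

Lemma leaf_domain m : Y (f m).1.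
Proof. by have [_ _ _ fY _] := hI; have [] := fY (f m) (imageT f m). Qed.

Lemma leaf_diff c x : atlas c -> cimg c x ->
  is_diff x (f \o cinv c) ('d (f \o cinv c) x).
Proof.
by have [_ fi _ _ _] := hI => ac cx; have [/(_ 1%N)[df _] _] := fi c ac; apply/differentiableP/df.
Qed.

Lemma leaf_diff1 c x : atlas c -> cimg c x ->
  is_diff x (p \o cinv c) (fst \o 'd (f \o cinv c) x).
Proof.
move=> ac cx; apply: (is_diff_comp (f := f \o cinv c) (g := fst)); first exact: leaf_diff.
by apply: is_diff_lin; [|exact: fst_continuous].
Qed.

Lemma leaf_diff2 c x : atlas c -> cimg c x ->
  is_diff x (snd \o f \o cinv c) (snd \o 'd (f \o cinv c) x).
Proof.
move=> ac cx; apply: (is_diff_comp (f := f \o cinv c) (g := snd)); first exact: leaf_diff.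
by apply: is_diff_lin; [|exact: snd_continuous].
Qed.

Lemma leaf_tangent c x w : atlas c -> cimg c x ->
  ('d (f \o cinv c) x w).2 = omega (f (cinv c x)).1 ('d (f \o cinv c) x w).1.
Proof.
move=> ac cx; have [_ _ _ _ /(_ c x ac cx) fD] := hI.
have : leaf_field (f (cinv c x)) ('d (f \o cinv c) x w) by rewrite -fD; exact: imageT.
by move=> /eqP; rewrite /= subr_eq0 => /eqP ->.
Qed.

Lemma leaf_smooth c : atlas c -> smooth_on (cimg c) (p \o cinv c).
Proof.
move=> ac k; have [_ fi _ _ _] := hI; have [/(_ k) ck _] := fi c ac.
by apply: (Ck_lin_comp (l := fst) _ _ _ ck) => //; [exact: cimg_open|exact: fst_continuous].
Qed.

(** A tangent vector of the leaf is determined by its component in [J], since the other one is its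
    image under [omega]. The projection is thus a local diffeomorphism. *)
Lemma leaf_immersion c x : atlas c -> cimg c x -> injective ('d (p \o cinv c) x).
Proof.
move=> ac cx u v; have [_ ->] := leaf_diff1 ac cx => /= e.
have [_ fi _ _ _] := hI; have [_ /(_ x cx)] := fi c ac; apply.
have := leaf_tangent u ac cx; have := leaf_tangent v ac cx; rewrite -e => <-.
by case: ('d _ x u) ('d _ x v) e => [a b] [a' b'] /= -> ->.
Qed.

Lemma chart_nbhs c m (W : set M) : atlas c -> cdom c m -> nbhs m W ->
  nbhs (cmap c m) [set x | cimg c x /\ W (cinv c x)].
Proof.
move=> ac cm mW; apply: filterI.
  by apply: open_nbhs_nbhs; split; [exact: cimg_open|exact: cmap_img].
by apply: (cinv_continuous (cmap_img cm)); rewrite cmapK.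
Qed.

Lemma leaf_continuous : continuous f.
Proof.
move=> m; have [c ac cm] := @atlas_cover _ _ M m.
have h : {for m, continuous ((f \o cinv c) \o cmap c)}.
  apply: continuous_comp; first exact: cmap_continuous.
  by apply: differentiable_continuous; have [] := leaf_diff ac (cmap_img cm).
have e : \forall m' \near m, ((f \o cinv c) \o cmap c) m' = f m'.
  near=> m'; rewrite /= cmapK//; near: m'.
  by apply: open_nbhs_nbhs; split=> //; exact: cdom_open.
move: h; rewrite /prop_for /continuous_at (nbhs_singleton e); apply: cvg_trans.
by apply: near_eq_cvg; apply: filterS e => m' ->.
Unshelve. all: by end_near. Qed.

Lemma leaf_proj_continuous : continuous p.
Proof. by move=> m; apply: continuous_comp; [exact: leaf_continuous|exact: fst_continuous]. Qed.

Lemma leaf_proj_open (m : M) W : nbhs m W -> nbhs (p m) (p @` W).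
Proof.
move=> mW; have [c ac cm] := @atlas_cover _ _ M m.
have cx := cmap_img cm.
have [h _] := local_inverse B (@cimg_open _ _ _ c) cx (leaf_smooth ac 1%N) (leaf_immersion ac cx).
have := h _ (chart_nbhs ac cm mW); rewrite /= cmapK//; apply: filterS => _ [x [_ Wx] <-].
by exists (cinv c x).
Qed.

(** By tangency, the height minus [psi] has zero differential in a chart. *)
Lemma leaf_prim x0 r psi m : local_prim x0 r psi -> ball x0 r (p m) ->
  \forall m' \near m, (f m').2 - psi (p m') = (f m).2 - psi (p m).
Proof.
move=> [r0 rY psid] rm; have [c ac cm] := @atlas_cover _ _ M m; have cx := cmap_img cm.
have := chart_nbhs ac cm (leaf_proj_continuous (open_nbhs_nbhs (conj (ball_open x0 r) rm))).
move=> /nbhs_ballP[s /= s0 hs].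
have D y : ball (cmap c m) s y ->
    is_diff y (fun y => (f (cinv c y)).2 - psi (f (cinv c y)).1 : R^o) 0.
  move=> sy; have [cy ry] := hs y sy.
  have D1 := leaf_diff2 ac cy; have D2 := is_diff_comp (leaf_diff1 ac cy) (psid _ ry).
  refine (is_diff_congr _ _ (is_diffB D1 D2)) => // w.
  rewrite -[LHS]/(('d (f \o cinv c) y w).2 - omega (f (cinv c y)).1 ('d (f \o cinv c) y w).1).
  by rewrite leaf_tangent//; exact: subrr.
near=> m'; have cm' : cdom c m'.
  by near: m'; apply: open_nbhs_nbhs; split=> //; exact: cdom_open.
rewrite -{1 2}(cmapK cm') -{1 2}(cmapK cm); apply: (ball_diff0 D); last exact: ballxx.
by near: m'; exact: (cmap_continuous cm (nbhsx_ballx _ _ s0)).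
Unshelve. all: by end_near. Qed.

End Leaf.

(** * Gluing two spaces along an open overlap *)

Definition glued (T : choiceType) (S1 S2 : topologicalType) (U : set S2)
  (i : S1 -> T) (j : S2 -> T) (oU : open U) : Type := T.

Section GluedTopology.
Context (T : choiceType) (S1 S2 : topologicalType) (U : set S2) (i : S1 -> T) (j : S2 -> T) (oU : open U).
Local Notation N := (glued i j oU).

HB.instance Definition _ := Choice.copy N T.

(** The final topology for [i] and for [j] restricted to [U]. A leaf is only immersed, so a subspace
    topology could be too coarse. *)
Definition glued_open (A : set N) : Prop :=
  open (i @^-1` A) /\ open (U `&` j @^-1` A).

Lemma glued_openT : glued_open setT.
Proof. by split; rewrite preimage_setT ?setIT//; exact: openT. Qed.

Lemma glued_openI : setI_closed glued_open.
Proof.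
move=> A A' [iA jA] [iA' jA']; split; first by rewrite preimage_setI; exact: openI.
by rewrite preimage_setI -[U]setIid setIACA; exact: openI.
Qed.

Lemma glued_open_bigU (I : Type) (A : I -> set N) :
  (forall k, glued_open (A k)) -> glued_open (\bigcup_k A k).
Proof.
move=> h; split; rewrite preimage_bigcup ?setI_bigcupr; apply: bigcup_open => k _.
  by have [] := h k.
by have [] := h k.
Qed.

HB.instance Definition _ := isOpenTopological.Build N glued_openT glued_openI glued_open_bigU.

Lemma glued_continuousl : continuous (i : S1 -> N).
Proof. by apply/continuousP => A []. Qed.

Lemma glued_continuousr x : U x -> {for x, continuous (j : S2 -> N)}.
Proof.
move=> Ux A; rewrite nbhsE => -[A' [[_ oA'] A'x] A'A].
apply: filterS (open_nbhs_nbhs (conj oA' (conj Ux A'x))) => y [_ /A'A]; exact.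
Qed.

(** [opi] and [opj] say that the overlap is open in both pieces, compatibly with their topologies;
    they make [i] and the restriction of [j] open embeddings. *)
Context (cover : forall t, range i t \/ (j @` U) t) (iinj : injective i)
  (jinj : {in U &, injective j})
  (opi : forall W, open W -> open (U `&` j @^-1` (i @` W)))
  (opj : forall O, open O -> O `<=` U -> open (i @^-1` (j @` O))).

Lemma glued_openl (W : set S1) : open W -> open (i @` W : set N).
Proof.
move=> oW; split; last exact: opi.
rewrite (_ : _ @^-1` _ = W)//; apply/seteqP; split=> [x [y Wy /iinj <-]//|x Wx].
by exists x.
Qed.

Lemma glued_openr (O : set S2) : open O -> O `<=` U -> open (j @` O : set N).
Proof.
move=> oO OU; split; first exact: opj.
rewrite (_ : U `&` _ = O)//; apply/seteqP; split=> [x [Ux [y Oy]]|x Ox].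
  by move=> e; rewrite -(jinj _ _ e) ?inE//; exact: OU.
by split; [exact: OU|exists x].
Qed.

Lemma glued_second_countable : @second_countable S1 -> @second_countable S2 ->
  @second_countable N.
Proof.
move=> [D1 cD1 [oD1 bD1]] [D2 cD2 [oD2 bD2]].
exists ([set (i @` W : set N) | W in D1] `|` [set j @` O | O in D2 `&` [set O | O `<=` U]]).
  rewrite -bigcup2E; apply: bigcup_countable => // -[|[|k]] _; last exact: countable0.
    exact: (sub_countable (card_image_le _ _)).
  apply: (sub_countable (card_image_le _ _)).
  by apply: sub_countable cD2; apply: subset_card_le; exact: subIsetl.
split=> [A [[W /oD1 oW <-]|[Q [/oD2 oQ QU] <-]]|].
- exact: glued_openl.
- exact: glued_openr.
move=> t A; have [[m _ <-]|[x Ux <-]] := cover t => nA.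
  have [W [DW Wm] WA] := bD1 m _ (glued_continuousl nA).
  exists (i @` W); first by split; [left; exists W|exists m].
  by move=> _ [m' /WA ? <-].
have [Q [DO Ox] OA] := bD2 x _ (filterI (open_nbhs_nbhs (conj oU Ux)) (glued_continuousr Ux nA)).
exists (j @` Q).
  by split; [right; exists Q => //; split=> // y /OA[]|exists x].
by move=> _ [m' /OA[_ ?] <-].
Qed.

Lemma glued_connected : connected [set: S1] -> connected U -> (exists2 x, U x & range i (j x)) ->
  connected [set: N].
Proof.
move=> cS cU [x Ux ix].
have -> : [set: N] = range i `|` j @` U by apply/seteqP; split=> // t _; exact: cover.
apply: connectedU; first by exists (j x); split=> //; exists x.
  by apply: connected_continuous_connected => //; apply: continuous_subspaceT; exact: glued_continuousl.
apply: connected_continuous_connected => //; apply: continuous_in_subspaceT => y /set_mem Uy.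
exact: glued_continuousr.
Qed.

End GluedTopology.

(** * Extending a leaf by the graph of a primitive *)

Section LeafExtension.
Context {R : realType} {J : normedModType R} {n : nat} (B : fbasis J n).
Local Notation V := (J * R^o)%type.
Context (Y : set J) (omega : J -> J -> R^o)
  (omega_Ck : forall k u, Ck_on k Y (omega^~ u)).
Context (M : smoothManifold J) (f : M -> V)
  (hI : integral_manifold (Y `*` [set: R^o]) (leaf_field omega) f).
Context (x0 : J) (r : R) (psi : J -> R^o) (hpsi : local_prim Y omega x0 r psi).
Context (m0 : M) (hm0 : ball x0 r (f m0).1).
Local Notation p := (fst \o f).
Local Notation U := (ball x0 r : set J).
Let k : R := (f m0).2 - psi (f m0).1.
Let s x : V := (x, k + psi x).
(** The union is formed inside [V]: its inclusion is then injective, and Hausdorffness is inherited.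
    Outside the ball [j] takes the default value [i m0]. *)
Let T := {v : V | v \in range f `|` s @` U}.
Let i (m : M) : T := exist _ (f m) (mem_set (or_introl (imageT f m))).
Let j (x : J) : T := insubd (i m0) (s x).
Let oU : open U := @ball_open _ _ x0 r.
Let N := glued i j oU.
Let v : N -> V := val.

Let jE x : U x -> v (j x) = s x.
Proof. by move=> Ux; apply: insubdK; apply/mem_set; right; exists x. Qed.

Let iinj : injective i.
Proof. by move=> a b /(congr1 val) /= /(leaf_inj hI). Qed.

Let jinj : {in U &, injective j}.
Proof. by move=> a b /set_mem Ua /set_mem Ub /(congr1 v); rewrite !jE// => -[]. Qed.

Let cover t : range i t \/ (j @` U) t.
Proof.
case: t => t ht; have [[m _ e]|[x Ux e]] := set_mem ht.
  by left; exists m => //; exact: val_inj.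
by right; exists x => //; apply: val_inj; rewrite [LHS]jE.
Qed.

Let sP m : (f m).2 - psi (p m) = k -> f m = s (p m).
Proof. by rewrite /s => <-; rewrite subrK /=; case: (f m) => a b. Qed.

Let psiK m x : U x -> f m = s x -> (f m).2 - psi (p m) = k.
Proof. by move=> Ux /= ->; rewrite /s/= addrK. Qed.

(** Where the leaf meets the graph it stays on it nearby, by [leaf_prim], and its projection is
    open; hence the overlap is open in the ball. The companion [opj] is the same on the side of the
    leaf, by continuity of the projection. *)
Let opi W : open W -> open (U `&` j @^-1` (i @` W)).
Proof.
move=> oW; rewrite openE => x [Ux [m Wm e]]; have {}e : f m = s x by rewrite -jE// -e.
have pm : p m = x by rewrite /= e.
have Um : U (p m) by rewrite pm.
have := leaf_proj_open B hI
  (@filterI _ _ (nbhs_filter m) _ _ (open_nbhs_nbhs (conj oW Wm)) (leaf_prim hI hpsi Um)).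
rewrite pm => h.
apply: filterS (filterI h (open_nbhs_nbhs (conj oU Ux))) => y [[m' [Wm' e'] <-] Uy].
split=> //; exists m' => //; apply: val_inj; rewrite [RHS]jE//; apply: sP.
by rewrite e' -pm (psiK Ux e).
Qed.

Let opj (Q : set J) : open Q -> Q `<=` U -> open (i @^-1` (j @` Q)).
Proof.
move=> oQ QU; rewrite openE => m [x Qx e]; have Ux := QU x Qx.
have {}e : f m = s x by rewrite -jE// e.
have Qm : Q (p m) by rewrite /= e.
have h : nbhs m (p @^-1` Q) := leaf_proj_continuous hI (open_nbhs_nbhs (conj oQ Qm)).
apply: filterS (filterI h (leaf_prim hI hpsi (QU _ Qm))) => m' [Qm' e'].
exists (p m') => //; apply: val_inj; rewrite [LHS]jE; last exact: QU.
by rewrite -sP// e' (psiK Ux e).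
Qed.

Let fi (t : N) : M := xget m0 [set m | i m = t].

Let fiK m : fi (i m) = m.
Proof.
by apply: iinj; apply: (@xgetPex _ m0 [set m' | i m' = i m]); exists m.
Qed.

Let fi_continuous m : {for (i m : N), continuous fi}.
Proof.
move=> A; rewrite /= fiK nbhsE => -[W [oW Wm] WA].
have := @glued_openl _ _ _ _ i j oU iinj opi W oW => oiW.
have : nbhs (i m : N) (i @` W : set N) by apply: open_nbhs_nbhs; split=> //; exists m.
by apply: filterS => _ [m' /WA ? <-]; rewrite /= fiK.
Qed.

Let psi_continuous x : U x -> {for x, continuous s}.
Proof.
have [_ _ psid] := hpsi => Ux.
apply: (@cvg_pair J J R^o (nbhs x) (nbhs x) (nbhs (k + psi x)) _ _ _ id (fun y => k + psi y)).
  exact: cvg_id.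
apply: cvgD; first exact: cvg_cst.
by apply: differentiable_continuous; have [] := psid x Ux.
Qed.

Let v_continuous : continuous v.
Proof.
apply/continuousP => A oA; split.
  by move/continuousP: (leaf_continuous hI) => /(_ A oA).
rewrite openE => x [Ux /=]; rewrite -/(v (j x)) jE// => Ax.
have h : nbhs x (s @^-1` A) := psi_continuous Ux (open_nbhs_nbhs (conj oA Ax)).
apply: filterS (filterI h (open_nbhs_nbhs (conj oU Ux))) => y [Ay Uy]; split=> //=.
by rewrite -/(v (j y)) jE.
Qed.

Let ic : continuous (i : M -> N) := @glued_continuousl _ _ _ _ i j oU.
Let jc x : U x -> {for x, continuous (j : J -> N)} := @glued_continuousr _ _ _ _ i j oU x.

Let chart0 : chart J N.
Proof.
refine (@Chart R J N (j @` U) U (fst \o v) j (@glued_openr _ _ _ _ i j oU jinj opj _ oU (@subset_refl _ _)) oU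
  _ _ _ _ _ jc).
- by move=> _ [x Ux <-]; rewrite /= jE.
- by move=> x Ux; exists x.
- by move=> _ [x Ux <-]; rewrite /= jE.
- by move=> x Ux; rewrite /= jE.
- by move=> t _; apply: continuous_comp; [exact: v_continuous|exact: fst_continuous].
Defined.

Let chart1 (c : chart J M) : chart J N.
Proof.
refine (@Chart R J N (i @` cdom c) (cimg c) (cmap c \o fi) (i \o cinv c)
  (@glued_openl _ _ _ _ i j oU iinj opi _ (@cdom_open _ _ _ c)) (@cimg_open _ _ _ c) _ _ _ _ _ _).
- by move=> _ [m cm <-]; rewrite /= fiK; exact: cmap_img.
- by move=> x cx; exists (cinv c x) => //; exact: cinv_dom.
- by move=> _ [m cm <-]; rewrite /= fiK cmapK.
- by move=> x cx; rewrite /= fiK cinvK.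
- move=> _ [m cm <-]; apply: continuous_comp; first exact: fi_continuous.
  by rewrite fiK; exact: cmap_continuous.
- by move=> x cx; apply: continuous_comp; [exact: cinv_continuous|exact: ic].
Defined.

Let A : set (chart J N) := [set d | d = chart0 \/ exists2 c, atlas c & d = chart1 c].

Let A_cover : charts_cover A.
Proof.
move=> t; have [[m _ <-]|[x Ux <-]] := cover t.
  have [c ac cm] := @atlas_cover _ _ M m.
  by exists (chart1 c); [right; exists c|exists m].
by exists chart0; [left|exists x].
Qed.

Let A_smooth : smooth_compatible A A.
Proof.
move=> c d [->|[c' ac ->]] [->|[d' ad ->]] h.
- apply: (@Ck_sub _ _ _ _ U) => [x []//|]; apply: (Ck_eq oU (f := id)); last exact: Ck_id.
  by move=> x Ux; rewrite /Defs.coord /= jE.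
- pose D := Defs.coord_dom chart0 (chart1 d') id.
  have DE x : D x -> exists2 m, cdom d' m & i m = j x by move=> [_ [m]]; exists m.
  have oD : open D.
    have [oj1 oj2] : open (i @` cdom d' : set N) := @cdom_open _ _ _ (chart1 d').
    exact: oj2.
  (* The transition from the graph to a chart of the leaf is a continuous right inverse of the
     projection read in that chart. *)
  apply: (@Ck_right_inverse _ _ _ B (cimg d') D (p \o cinv d')) => //.
  - exact: cimg_open.
  - exact: (leaf_smooth hI).
  - by move=> x; exact: (leaf_immersion hI).
  - by move=> x /DE[m dm e]; rewrite /Defs.coord /= -e fiK; exact: cmap_img.
  - move=> x Dx; have [m dm e] := DE x Dx; have [Ux _] := Dx.
    rewrite /Defs.coord /= -e fiK cmapK//.
    have := jE Ux; rewrite -e => /(congr1 fst); exact.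
  - move=> x Dx; have [Ux dx] := Dx; rewrite /Defs.coord.
    apply: continuous_comp; first exact: jc.
    exact: (@cmap_continuous _ _ _ (chart1 d')).
- apply: (@Ck_sub _ _ _ _ (cimg c')) => [x []//|]; exact: (leaf_smooth hI ac).
- have := @atlas_smooth _ _ M c' d' ac ad h.
  rewrite (_ : Defs.coord (chart1 c') (chart1 d') id = Defs.coord c' d' id); last first.
    by apply/funext => x; rewrite /Defs.coord /= fiK.
  by apply: Ck_sub => x [cx [m dm /iinj e]]; split=> //; move: dm; rewrite e.
Qed.

Let N_hausdorff : hausdorff_space N.
Proof.
by apply: (inj_continuous_hausdorff v_continuous val_inj); exact: norm_hausdorff.
Qed.

Let N_second_countable : @second_countable N.
Proof.
have := @glued_second_countable _ _ _ _ i j oU cover iinj jinj opi opj; apply.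
  exact: manifold_second_countable.
exact: (normed_second_countable B).
Qed.

Let NM := SmoothManifold N_hausdorff N_second_countable A_cover A_smooth.

Lemma leaf_extension : exists (N : smoothManifold J) (g : N -> V),
  integral_manifold (Y `*` [set: R^o]) (leaf_field omega) g /\
  range g = range f `|` s @` U.
Proof.
exists NM, v; split; last first.
  apply/seteqP; split=> [_ [t _ <-]|z hz]; first exact: set_mem (valP t).
  by exists (exist _ z (mem_set hz)).
have [_ rY psid] := hpsi.
have D1 x : U x -> is_diff x (v \o j) (fun w => (w, omega x w)).
  move=> Ux; have h : \forall y \near x, s y = (v \o j) y.
    by apply: filterS (open_nbhs_nbhs (conj oU Ux)) => y Uy; rewrite /= jE.
  apply: (is_diff_near_eq h).
  have Dk : is_diff x (fun y => k + psi y : R^o) (omega x).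
    refine (is_diff_congr _ _ (is_diffD (is_diff_cst (k : R^o) x) (psid x Ux))) => // w.
    exact: add0r.
  exact: (is_diff_pair (is_diff_id x) Dk).
split.
- split; first by exists (i m0).
  apply: (@glued_connected _ _ _ _ i j oU cover); [|exact: ball_connected|].
    by have [[]] := hI.
  exists (f m0).1 => //; exists m0 => //; apply: val_inj; rewrite [RHS]jE//; exact: sP.
- move=> c [->|[c' ac ->]]; last by have [_ im _ _ _] := hI; exact: (im c' ac).
  split=> [l|x Ux].
    apply: (Ck_eq oU (f := s)); first by move=> x Ux; rewrite /= jE.
    apply: Ck_pair => //; first exact: Ck_id.
    apply: (@Ck_D R J R^o l U (fun=> k) psi) => //; first exact: Ck_cst.
    exact: (local_prim_Ck l omega_Ck hpsi).
  by have [_ ->] := D1 x Ux => u w [].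
- exact: val_inj.
- move=> _ [t _ <-]; have [[m _ <-]|[x Ux <-]] := cover t.
    by split => //; exact: (leaf_domain hI).
  by rewrite jE//; split=> //; exact: rY.
- move=> c x [->|[c' ac ->]]; last by have [_ _ _ _ fD] := hI; exact: (fD c' x ac).
  move=> Ux; have [_ ->] := D1 x Ux; rewrite /leaf_field [v _]jE//.
  apply/seteqP; split=> [_ [w _ <-]|[w a] /= /eqP]; first exact: subrr.
  by rewrite subr_eq0 => /eqP <-; exists w.
Qed.

End LeafExtension.

Section MaximalLeaf.
Context {R : realType} {J : normedModType R} {n : nat} (B : fbasis J n).
Local Notation V := (J * R^o)%type.
Context (Y : set J) (omega : J -> J -> R^o)
  (omega_Ck : forall k u, Ck_on k Y (omega^~ u)).
Context (M : smoothManifold J) (f : M -> V)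
  (hM : maximal_integral_manifold (Y `*` [set: R^o]) (leaf_field omega) f).

Lemma maximal_leaf_graph x0 r psi (m : M) x : local_prim Y omega x0 r psi ->
  ball x0 r (f m).1 -> ball x0 r x ->
  range f (x, (f m).2 - psi (f m).1 + psi x).
Proof.
move=> hpsi mU xU; have [N [g [hg gE]]] := leaf_extension B omega_Ck hM.1 hpsi mU.
by rewrite -(hM.2 N g hg) gE; [right; exists x|left].
Qed.

End MaximalLeaf.

(** * Lifts, sheets and the covering property *)

Section LeafCovering.
Context {R : realType} {J : normedModType R} {n : nat} (B : fbasis J n).
Local Notation V := (J * R^o)%type.
Context (Y : set J) (omega : J -> J -> R^o)
  (omega_Ck : forall k u, Ck_on k Y (omega^~ u)) (Yc : connected Y)
  (prim_ex : forall x, Y x -> exists psi r, local_prim Y omega x r psi).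
Context (M : smoothManifold J) (f : M -> V)
  (hM : maximal_integral_manifold (Y `*` [set: R^o]) (leaf_field omega) f).
Context (m0 : M).
Local Notation p := (fst \o f).
Local Notation local_prim := (local_prim Y omega).
Let hI := hM.1.

Definition leaf_inv (z : V) : M := xget m0 [set m | f m = z].

Lemma leaf_invK z : range f z -> f (leaf_inv z) = z.
Proof. by move=> [m _ fm]; apply: (@xgetPex _ m0 [set m | f m = z]); exists m. Qed.

Lemma leafK m : leaf_inv (f m) = m.
Proof. by apply: (leaf_inj hI); apply: leaf_invK; exists m. Qed.

(** Continuity in the topology of the leaf: near [m] the leaf lies on one graph and projects openly,
    so a nearby value of [kappa] on the same graph is attained near [m]. *)
Lemma leaf_lift_continuous (X : topologicalType) (kappa : X -> V) t x0 r psi :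
  range f (kappa t) -> {for t, continuous (fst \o kappa)} ->
  local_prim x0 r psi -> ball x0 r (kappa t).1 ->
  (\forall s \near t, (kappa s).2 - psi (kappa s).1 = (kappa t).2 - psi (kappa t).1) ->
  {for t, continuous (leaf_inv \o kappa)}.
Proof.
move=> [m _ fm] ck hpsi tr kc W; rewrite /= -fm leafK => mW.
have pr : ball x0 r (p m) by rewrite /= fm.
have := leaf_proj_open B hI (@filterI _ _ (nbhs_filter m) _ _ mW (leaf_prim hI hpsi pr)).
rewrite {1}[p m]/= fm => /ck; set A := (X in nbhs _ X) => h.
have {}h : nbhs t ((fst \o kappa) @^-1` A) := h.
apply: filterS (filterI h kc) => s [[m' [Wm' e] e'] e2].
suff e3 : f m' = kappa s by rewrite /= -e3 leafK.
move: e e' e2; rewrite /= fm; case: (f m') (kappa s) (kappa t) => [y b] [y' b'] [z d] /= e e' e2.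
by congr pair => //; apply: (addIr (- psi y)); rewrite e e' e2.
Qed.

(** Tangency to the distribution without any differentiability of [X]: it is used on a leaf, for
    automorphisms, and on the real line, for geodesics. *)
Definition horizontal (X : topologicalType) (kappa : X -> V) := forall t,
  [/\ Y (kappa t).1, {for t, continuous (fst \o kappa)} &
    forall x0 r psi, local_prim x0 r psi -> ball x0 r (kappa t).1 ->
    \forall s \near t, (kappa s).2 - psi (kappa s).1 = (kappa t).2 - psi (kappa t).1].

(** Membership in the leaf passes from [kappa s] to nearby values and back, since the leaf contains
    the whole graph in both directions. *)
Lemma horizontal_range (X : topologicalType) (kappa : X -> V) t : connected [set: X] ->
  horizontal kappa -> range f (kappa t) -> forall s, range f (kappa s).
Proof.
move=> cX hk ft s; apply: (connected_ind (P := fun s => range f (kappa s)) cX _ _ ft) => // {}s _.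
have [Ys cs ps] := hk s; have [psi [r hpsi]] := prim_ex Ys; have [r0 _ _] := hpsi.
have rs : ball (kappa s).1 r (kappa s).1 by exact: ballxx.
have h : nbhs s ((fst \o kappa) @^-1` ball (kappa s).1 r) := cs _ (nbhsx_ballx _ _ r0).
apply: filterS (filterI h (ps _ _ _ hpsi rs)) => y [/= ry e] _.
split=> [[m _ fm]|[m _ fm]].
  have := maximal_leaf_graph B omega_Ck hM hpsi (m := m) (x := (kappa s).1).
  by rewrite fm e subrK => /(_ ry rs); case: (kappa s).
have := maximal_leaf_graph B omega_Ck hM hpsi (m := m) (x := (kappa y).1).
by rewrite fm -e subrK => /(_ rs ry); case: (kappa y).
Qed.

Lemma horizontal_lift (X : topologicalType) (kappa : X -> V) :
  horizontal kappa -> (forall s, range f (kappa s)) -> continuous (leaf_inv \o kappa).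
Proof.
move=> hk hr t; have [Yt ct pt] := hk t; have [psi [r hpsi]] := prim_ex Yt.
have tr : ball (kappa t).1 r (kappa t).1 by have [r0 _ _] := hpsi; exact: ballxx.
exact: (leaf_lift_continuous (hr t) ct hpsi tr (pt _ _ _ hpsi tr)).
Qed.

Section Sheet.
Context (x0 : J) (r : R) (psi : J -> R^o) (hpsi : local_prim x0 r psi).
Local Notation U := (ball x0 r : set J).

Definition leaf_sheet (k : R) : set M := [set m | U (p m) /\ (f m).2 - psi (p m) = k].

Definition leaf_section (k : R) (x : J) : M := leaf_inv (x, k + psi x).

Let oU : open U := @ball_open _ _ x0 r.

Lemma leaf_sheet_open k : open (leaf_sheet k).
Proof.
rewrite openE => m [Um mk].
have h : nbhs m (p @^-1` U) := leaf_proj_continuous hI (open_nbhs_nbhs (conj oU Um)).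
apply: filterS (filterI h (leaf_prim hI hpsi Um)) => m' [Um' e].
by split=> //; rewrite e.
Qed.

Lemma leaf_section_sheet k m : leaf_sheet k m -> leaf_section k (p m) = m.
Proof.
move=> [Um <-]; rewrite /leaf_section subrK -[RHS]leafK; congr leaf_inv.
by rewrite /=; case: (f m).
Qed.

Context (k : R) (kne : leaf_sheet k !=set0).

Lemma leaf_sectionK x : U x -> f (leaf_section k x) = (x, k + psi x).
Proof.
move=> Ux; apply: leaf_invK; have [m [Um mk]] := kne.
by have := maximal_leaf_graph B omega_Ck hM hpsi Um Ux; rewrite mk.
Qed.

Lemma leaf_section_in x : U x -> leaf_sheet k (leaf_section k x).
Proof. by move=> Ux; split; rewrite /= leaf_sectionK//= addrK. Qed.

Lemma leaf_section_continuous x : U x -> {for x, continuous (leaf_section k)}.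
Proof.
move=> Ux; apply: (leaf_lift_continuous (kappa := fun x => (x, k + psi x)) _ _ hpsi Ux _).
- by exists (leaf_section k x) => //; exact: (leaf_sectionK Ux).
- by move=> A hA; exact: hA.
by near=> y; rewrite /= !addrK.
Unshelve. all: by end_near. Qed.

Lemma leaf_sheetP : sheet p U (leaf_sheet k).
Proof.
split; first exact: leaf_sheet_open.
  apply/seteqP; split=> [_ [m [Um _] <-]//|x Ux].
  exists (leaf_section k x); first exact: leaf_section_in.
  by rewrite /= leaf_sectionK.
exists (leaf_section k); split.
- by apply: continuous_in_subspaceT => x /set_mem; exact: leaf_section_continuous.
- by move=> x Ux; split; [exact: leaf_section_in|rewrite /= leaf_sectionK].
- exact: leaf_section_sheet.
Qed.

(** In these charts the immersion is the graph of a primitive; they will form the analytic atlas. *)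
Definition proj_chart : chart J M.
Proof.
refine (@Chart R J M (leaf_sheet k) U p (leaf_section k) (leaf_sheet_open k) oU
  _ leaf_section_in (@leaf_section_sheet k) _ _ leaf_section_continuous).
- by move=> m [].
- by move=> x Ux; rewrite /= leaf_sectionK.
- by move=> m _; exact: (leaf_proj_continuous hI).
Defined.

End Sheet.

Lemma leaf_covering : covering_map p Y.
Proof.
split; first exact: (leaf_proj_continuous hI).
  apply/seteqP; split=> [_ [m _ <-]|x Yx]; first exact: (leaf_domain hI).
  (* Surjectivity: over a ball with a primitive, one point of the leaf entails a whole graph, so the
     range of [p] is open and closed in [Y]. *)
  apply: (connected_ind (P := range p) Yc _ (leaf_domain hI m0)) Yx; last by exists m0.
  move=> {}x Yx; have [psi [r hpsi]] := prim_ex Yx; have [r0 _ _] := hpsi.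
  have rx := ballxx x r0.
  near=> y; have ry : ball x r y by near: y; exact: nbhsx_ballx.
  move=> _; split=> [[m _ e]|[m _ e]].
    have ry' : ball x r (f m).1 by rewrite [(f m).1]e.
    have [m' _ e'] := maximal_leaf_graph B omega_Ck hM hpsi ry' rx.
    by exists m' => //; rewrite /= e'.
  have rx' : ball x r (f m).1 by rewrite [(f m).1]e.
  have [m' _ e'] := maximal_leaf_graph B omega_Ck hM hpsi rx' ry.
  by exists m' => //; rewrite /= e'.
move=> y Yy; have [psi [r hpsi]] := prim_ex Yy; have [r0 rY _] := hpsi.
exists (ball y r); split=> //; [exact: ball_open|exact: ballxx|].
exists [set W | exists2 k, W = leaf_sheet y r psi k & W !=set0]; split.
- by move=> _ [k -> kne]; exact: leaf_sheetP.
- by move=> _ _ [k -> _] [k' -> _] [m [[_ <-] [_ <-]]].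
apply/seteqP; split=> [m Um|m [_ [k -> _] []//]].
exists (leaf_sheet y r psi ((f m).2 - psi (p m))); last by [].
by exists ((f m).2 - psi (p m)) => //; exists m.
Unshelve. all: by end_near. Qed.

(** The difference of heights of two sections is locally constant, as each height differs from a
    local primitive by a locally constant function; it is constant because [U] is connected. *)
Lemma leaf_sheets_translated : sheets_translated p f ((0, 1) : V).
Proof.
move=> U W W' oU cU [oW WU [s [cs sU sW]]] [oW' WU' [s' [cs' sU' sW']]].
(* Over the empty set both sheets are empty, and [t = 0] serves. *)
have [[x0 Ux0]|U0] := pselect (U !=set0); last first.
  have U0' (A : set M) : p @` A = U -> A = set0.
    by move=> AU; apply/seteqP; split=> // m Am; apply: U0; exists (p m); rewrite -AU; exists m.
  by exists 0; rewrite (U0' _ WU) (U0' _ WU') !image_set0.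
have near_sec (q : J -> M) y : {within U, continuous q} -> (forall y, U y -> p (q y) = y) -> U y ->
    forall psi r, local_prim y r psi ->
    \forall z \near y, U z -> (f (q z)).2 - psi z = (f (q y)).2 - psi y.
  move=> cq qU Uy psi r hpsi; have [r0 _ _] := hpsi.
  have ry : ball y r (p (q y)) by rewrite qU//; exact: ballxx.
  have qc : {for y, continuous q}.
    by move: cq; rewrite continuous_open_subspace// => /(_ y); apply; exact/mem_set.
  have h : \forall z \near y, (f (q z)).2 - psi (p (q z)) = (f (q y)).2 - psi (p (q y)).
    exact: (qc _ (leaf_prim hI hpsi ry)).
  by apply: filterS h => z; rewrite (qU y Uy) => + Uz; rewrite (qU z Uz).
pose t := (f (s' x0)).2 - (f (s x0)).2.
have ht : forall y, U y -> (f (s' y)).2 - (f (s y)).2 = t.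
  apply: (connected_ind (P := fun y => (f (s' y)).2 - (f (s y)).2 = t) cU _ Ux0) => // y Uy.
  have Yy : Y y by have [_ <-] := sU y Uy; exact: (leaf_domain hI).
  have [psi [r hpsi]] := prim_ex Yy.
  have h1 := near_sec s y cs (fun y Uy => (sU y Uy).2) Uy psi r hpsi.
  have h2 := near_sec s' y cs' (fun y Uy => (sU' y Uy).2) Uy psi r hpsi.
  apply: filterS (filterI h1 h2) => z [e1 e2] Uz.
  have aux (a b c d g q : R) : a - g = b - q -> c - g = d - q -> c - a = d - b by move=> *; lra.
  by rewrite (aux _ _ _ _ _ _ (e1 Uz) (e2 Uz)).
have move_fiber (z z' : V) : z.1 = z'.1 -> z + (z'.2 - z.2) *: (0, 1) = z'.
  case: z z' => [x a] [x' a'] /= ->; congr pair; first by rewrite /= scaler0 addr0.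
  by rewrite /= -[_ *: _]/((a' - a) * 1) mulr1 addrC subrK.
exists t; apply/seteqP; split=> [_ [m Wm <-]|_ [_ [m Wm <-] <-]].
- have Um : U (p m) by rewrite -WU'; exists m.
  exists (f (s (p m))); first by exists (s (p m)) => //; have [] := sU _ Um.
  by have [_ e] := sU _ Um; have := ht _ Um; rewrite (sW' m Wm) => <-; exact: move_fiber.
- have Um : U (p m) by rewrite -WU; exists m.
  exists (s' (p m)); first by have [] := sU' _ Um.
  have [_ e] := sU' _ Um; have := ht _ Um; rewrite (sW m Wm) => <-.
  by rewrite move_fiber.
Qed.

End LeafCovering.

(** * Automorphisms of the distribution acting on a leaf *)

Section LeafMaps.
Context {R : realType} {J : normedModType R} {n : nat} (B : fbasis J n).
Local Notation V := (J * R^o)%type.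
Context (Y : set J) (omega : J -> J -> R^o)
  (omega_Ck : forall k u, Ck_on k Y (omega^~ u)) (Yo : open Y)
  (prim_ex : forall x, Y x -> exists psi r, local_prim Y omega x r psi).
Context (M : smoothManifold J) (f : M -> V)
  (hM : maximal_integral_manifold (Y `*` [set: R^o]) (leaf_field omega) f).
Context (m0 : M).
Local Notation p := (fst \o f).
Local Notation local_prim := (local_prim Y omega).
Local Notation leaf_inv := (leaf_inv f m0).
Let hI := hM.1.

(* A continuous map into the leaf is as smooth as its projection, because the
   sections of [p] are smooth. *)
Lemma leaf_smooth_lift (E : normedModType R) (Q : set E) (q : E -> M) k :
  open Q -> (forall x, Q x -> {for x, continuous q}) -> smooth_on Q (p \o q) ->
  forall d, atlas d -> Ck_on k [set x | Q x /\ cdom d (q x)] (cmap d \o q).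
Proof.
move=> oQ cq sq d ad; apply: Ck_local => x [Qx dx].
have Yx := leaf_domain hI (q x); have [psi [r hpsi]] := prim_ex Yx; have [r0 _ _] := hpsi.
set x0 := (f (q x)).1 in Yx hpsi.
pose a := (f (q x)).2 - psi x0.
have Wx : leaf_sheet f x0 r psi a (q x) by split; [exact: ballxx|].
have ane : leaf_sheet f x0 r psi a !=set0 by exists (q x).
pose S y := leaf_section f m0 psi a y.
have oW := leaf_sheet_open hM hpsi a.
pose D := [set y | ball x0 r y /\ cdom d (S y)].
pose X := [set y | Q y /\ (cdom d `&` leaf_sheet f x0 r psi a) (q y)].
have oD : open D.
  rewrite openE => y [Uy dy]; apply: filterI.
    by apply: open_nbhs_nbhs; split=> //; exact: ball_open.
  have cS := leaf_section_continuous B omega_Ck hM (m0 := m0) hpsi ane Uy.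
  exact: (cS _ (open_nbhs_nbhs (conj (@cdom_open _ _ _ d) dy))).
have oX : open X.
  rewrite openE => y [Qy dWy]; apply: filterI; first exact: open_nbhs_nbhs.
  by apply: (cq y Qy); apply: open_nbhs_nbhs; split=> //; apply: openI => //; exact: cdom_open.
exists X => //.
have CD : Ck_on k D (cmap d \o S).
  apply: (@Ck_right_inverse _ _ _ B (cimg d) D (p \o cinv d)) => //.
  - exact: cimg_open.
  - exact: (leaf_smooth hI ad).
  - by move=> y; exact: (leaf_immersion hI ad).
  - by move=> y [_ dy]; exact: cmap_img.
  - move=> y [Uy dy]; rewrite /= cmapK//.
    by rewrite /S (leaf_sectionK B omega_Ck hM m0 hpsi ane Uy).
  - move=> y [Uy dy]; apply: continuous_comp; last exact: cmap_continuous.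
    exact: (leaf_section_continuous B omega_Ck hM (m0 := m0) hpsi ane Uy).
apply: (Ck_eq oX (f := fun y => (cmap d \o S) (p (q y)))).
  by move=> y [_ [_ Wy]]; rewrite /S /= (leaf_section_sheet hM m0 Wy).
apply: (Ck_comp B oX oD) CD => [y [_ [dy Wy]]|].
  by split; [have [] := Wy|rewrite /S (leaf_section_sheet hM m0 Wy)].
by apply: Ck_sub (sq k) => y [].
Qed.

(** The condition [dE = phi^* omega - eps omega] says that the map of [leaf_auto_map] pulls
    [omega - d alpha] back to [eps] times itself. *)
Definition leaf_auto (phi : J -> J) (eps : R) (E : J -> R^o) : Prop :=
  [/\ forall x, Y x -> Y (phi x), smooth_on Y phi &
    forall x, Y x -> is_diff x E (fun u => omega (phi x) ('d phi x u) - eps *: omega x u)].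

Definition leaf_auto_map (phi : J -> J) (eps : R) (E : J -> R^o) (z : V) : V :=
  (phi z.1, eps *: z.2 + E z.1).

Lemma leaf_auto_horizontal phi eps E : leaf_auto phi eps E ->
  horizontal Y omega (leaf_auto_map phi eps E \o f).
Proof.
move=> [Yphi sphi dE] m; have Ym := leaf_domain hI m.
have cphi : {for p m, continuous phi} by apply: (Ck_continuous (sphi 0%N)).
split; first exact: Yphi.
  by apply: (continuous_comp (f := p) (g := phi)) => //; exact: (leaf_proj_continuous hI).
move=> x0 r psi [r0 rY psid] rm.
have [psi1 [r1 hpsi1]] := prim_ex Ym; have [r10 r1Y psi1d] := hpsi1.
have /nbhs_ballP[s /= s0 hs] : \forall y \near p m, ball (p m) r1 y /\ ball x0 r (phi y).
  apply: filterI; first exact: nbhsx_ballx.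
  by apply: cphi; apply: open_nbhs_nbhs; split=> //; exact: ball_open.
(* Along the leaf the height varies like [psi1], so it is enough that [eps psi1 + E - psi o phi] is
   locally constant. *)
pose G y : R^o := (eps *: psi1 y + E y) - psi (phi y).
have dG y : ball (p m) s y -> is_diff y G 0.
  move=> /hs[y1 y2]; have Yy := r1Y _ y1.
  have Dphi : is_diff y phi ('d phi y).
    by apply/differentiableP; have [+ _] := sphi 1%N; apply.
  have D := is_diffB (is_diffD (is_diffZ eps (psi1d y y1)) (dE y Yy)) (is_diff_comp Dphi (psid _ y2)).
  refine (is_diff_congr _ _ D) => // u.
  rewrite -[LHS]/(eps *: omega y u + (omega (phi y) ('d phi y u) - eps *: omega y u) -
    omega (phi y) ('d phi y u)).
  by rewrite [eps *: _ + _]addrC subrK subrr.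
have h1 := leaf_prim hI hpsi1 (ballxx _ r10 : ball (p m) r1 (p m)).
have h2 : nbhs m (p @^-1` ball (p m) s) := leaf_proj_continuous hI (nbhsx_ballx _ _ s0).
apply: filterS (filterI h1 h2) => m' [e1 e2].
have := ball_diff0 dG e2 (ballxx _ s0); rewrite /G /= => e.
have aux (a a' g g' c c' d d' : R) : a' - g' = a - g ->
    eps * g' + c' - d' = eps * g + c - d -> eps * a' + c' - d' = eps * a + c - d.
  by move=> h h'; have -> : a' = a - g + g' by [rewrite -h subrK]; lra.
exact: (aux _ _ _ _ _ _ _ _ e1 e).
Qed.

Section LeafAct.
Context (phi : J -> J) (eps : R) (E : J -> R^o) (ha : leaf_auto phi eps E)
  (hr : exists m, range f (leaf_auto_map phi eps E (f m))).

Definition leaf_act : M -> M := leaf_inv \o (leaf_auto_map phi eps E \o f).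

Let mapr m : range f (leaf_auto_map phi eps E (f m)).
Proof.
have [m1 hm1] := hr; have [[_ cM] _ _ _ _] := hI.
exact: (horizontal_range B omega_Ck prim_ex hM cM (leaf_auto_horizontal ha) hm1 m).
Qed.

Lemma leaf_actE m : f (leaf_act m) = leaf_auto_map phi eps E (f m).
Proof. exact: leaf_invK. Qed.

Lemma leaf_act_continuous : continuous leaf_act.
Proof. exact: (horizontal_lift B prim_ex hM (leaf_auto_horizontal ha) mapr). Qed.

Lemma leaf_act_smooth : smooth_map leaf_act.
Proof.
split; first exact: leaf_act_continuous.
move=> c d ac ad k; have [Yphi sphi _] := ha.
have := @leaf_smooth_lift J (cimg c) (leaf_act \o cinv c) k (@cimg_open _ _ _ c) _ _ d ad.
apply.
  move=> x cx; apply: continuous_comp; first exact: cinv_continuous.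
  exact: leaf_act_continuous.
move=> l; rewrite (_ : p \o _ = fun x => phi (p (cinv c x))); last first.
  by apply/funext => x; rewrite /= leaf_actE.
apply: (Ck_comp B (@cimg_open _ _ _ c) Yo) (leaf_smooth hI ac l) (sphi l) => x _.
exact: (leaf_domain hI).
Qed.

End LeafAct.

Lemma leaf_act_diffeo phi eps E phi' eps' E' : leaf_auto phi eps E -> leaf_auto phi' eps' E' ->
  (exists m, range f (leaf_auto_map phi eps E (f m))) ->
  (forall z, Y z.1 -> leaf_auto_map phi' eps' E' (leaf_auto_map phi eps E z) = z) ->
  (forall z, Y z.1 -> leaf_auto_map phi eps E (leaf_auto_map phi' eps' E' z) = z) ->
  diffeomorphism (leaf_act phi eps E).
Proof.
move=> ha ha' hr K K'; have [m1 hm1] := hr.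
have hr' : exists m, range f (leaf_auto_map phi' eps' E' (f m)).
  have e := leaf_actE ha hr m1.
  by exists (leaf_act phi eps E m1); rewrite e K; [exists m1|exact: (leaf_domain hI)].
split; first exact: leaf_act_smooth.
exists (leaf_act phi' eps' E'); split; first exact: leaf_act_smooth.
  by move=> m; apply: (leaf_inj hI); rewrite !leaf_actE// K//; exact: (leaf_domain hI).
by move=> m; apply: (leaf_inj hI); rewrite !leaf_actE// K'//; exact: (leaf_domain hI).
Qed.

End LeafMaps.

(** * Local geometry of a leaf *)

Section SecondDerivatives.
Context {R : realType} {E : normedModType R}.

Lemma Ck_is_diff (F : normedModType R) k (U : set E) (f : E -> F) x :
  Ck_on k.+1 U f -> U x -> is_diff x f ('d f x).
Proof. by move=> [df _] Ux; apply/differentiableP/df. Qed.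

Lemma is_diff_derive (F : normedModType R) (f df : E -> F) x v :
  is_diff x f df -> 'D_v f x = df v.
Proof. by move=> [dfx <-]; rewrite deriveE. Qed.

Lemma second_difference (f : E -> R) (x u v : E) (r : R) :
  Ck_on 2 (ball x r) f -> `|u| + `|v| < r ->
  exists2 z, ball x r z & f (x + u + v) - f (x + v) - (f (x + u) - f x) = 'D_v ('D_u f) z.
Proof.
move=> cf uvr.
have [df ddf] := cf.
have inb (s t : R) : 0 <= s <= 1 -> 0 <= t <= 1 -> ball x r (x + s *: u + t *: v).
  move=> /andP[s0 s1] /andP[t0 t1]; rewrite -ball_normE /= -addrA opprD addrA subrr sub0r normrN.
  apply: (le_lt_trans (ler_normD _ _)); apply: le_lt_trans uvr.
  by apply: lerD; rewrite normrZ ger0_norm// ler_piMl.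
have inb0 (s : R) : 0 <= s <= 1 -> ball x r (x + s *: u).
  by move=> s01; have := inb s 0 s01; rewrite lexx ler01 scale0r addr0; apply.
have inb1 (s : R) : 0 <= s <= 1 -> ball x r (x + s *: u + v).
  by move=> s01; have := inb s 1 s01; rewrite lexx ler01 scale1r; apply.
pose g y := f (y + v) - f y : R.
have Dg (s : R) : 0 <= s <= 1 -> is_diff (x + s *: u) g
    (fun w => 'd f (x + s *: u + v) w - 'd f (x + s *: u) w).
  move=> s01; have D1 := Ck_is_diff cf (inb1 s s01).
  have D2 := Ck_is_diff cf (inb0 s s01).
  have D3 : is_diff (x + s *: u) (fun y : E => y + v) id.
    refine (is_diff_congr _ _ (is_diffD (is_diff_id (x + s *: u)) (is_diff_cst v (x + s *: u)))) => // w.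
    exact: addr0.
  by refine (is_diff_congr _ _ (is_diffB (is_diff_comp D3 D1) D2)).
have [|s /andP[s0 s1]] := @segment_MVT _ _ g x u.
  by move=> s s01; have [] := Dg s s01.
have s01 : 0 <= s <= 1 by rewrite !ltW.
have [_ ->] := Dg s s01.
rewrite /g => e.
have [t01|t /andP[t0 t1]] := @segment_MVT _ _ ('D_u f) (x + s *: u) v.
  by move=> h; have [/(_ _ (inb s t01 s01 h)) ] := ddf u.
exists (x + s *: u + t *: v); first by apply: inb; rewrite !ltW.
have -> : f (x + u + v) - f (x + v) - (f (x + u) - f x) =
    f (x + u + v) - f (x + u) - (f (x + v) - f x) by ring.
have z01 : 0 <= t <= 1 by rewrite !ltW.
have D1 := Ck_is_diff cf (inb1 s s01); have D2 := Ck_is_diff cf (inb0 s s01).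
have D3 := @Ck_is_diff R 0 _ _ _ (ddf u) (inb s t s01 z01).
rewrite e -(is_diff_derive u D1) -(is_diff_derive u D2) (is_diff_derive v D3).
exact.
Qed.

(** Schwarz's theorem: the second difference along [s u] and [s v] does not depend on their order,
    and by two mean values it is [s^2] times either mixed derivative at some point near [x]. *)
Lemma derive_sym (U : set E) (f : E -> R) (x u v : E) : open U -> U x -> Ck_on 2 U f ->
  'D_u ('D_v f) x = 'D_v ('D_u f) x.
Proof.
move=> oU Ux cf; have [df ddf] := cf.
apply/eqP; rewrite -subr_eq0 -normr_le0; apply/ler_addgt0Pr => e e0; rewrite add0r.
have cont a b : {for x, continuous (fun y => 'D_a ('D_b f) y : R)}.
  by have [_ /(_ a) c] := ddf b; exact: (c x Ux).
have e20 : 0 < e / 2 by rewrite divr_gt0.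
have nearc a b : \forall y \near x, `|'D_a ('D_b f) x - 'D_a ('D_b f) y| < e / 2.
  exact: (@cvgr_dist_lt _ R^o _ _ (nbhs_filter x) _ _ (cont a b) _ e20).
have /nbhs_ballP[r /= r0 hr] : \forall y \near x, U y /\
    (`|'D_u ('D_v f) x - 'D_u ('D_v f) y| < e / 2 /\
     `|'D_v ('D_u f) x - 'D_v ('D_u f) y| < e / 2).
  exact: filterI (open_nbhs_nbhs (conj oU Ux)) (filterI (nearc u v) (nearc v u)).
have cr : Ck_on 2 (ball x r) f by apply: Ck_sub cf => y /hr[].
have [s s0 sr] : exists2 s : R, 0 < s & s * (`|u| + `|v|) < r.
  have k0 : 0 < 2 * (1 + `|u| + `|v|) by rewrite mulr_gt0// !ltr_wpDr.
  exists (r / (2 * (1 + `|u| + `|v|))); first by rewrite divr_gt0.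
  rewrite mulrAC ltr_pdivrMr// ltr_pM2l//.
  by have := normr_ge0 u; have := normr_ge0 v; lra.
have suv : `|s *: u| + `|s *: v| < r by rewrite !normrZ gtr0_norm// -mulrDr.
have [z1 z1r] := second_difference cr suv.
move=> e1.
have [z2 z2r] : exists2 z, ball x r z & f (x + s *: v + s *: u) - f (x + s *: u) -
    (f (x + s *: v) - f x) = 'D_(s *: u) ('D_(s *: v) f) z.
  by apply: second_difference => //; rewrite addrC.
have DZ a b z : ball x r z -> 'D_(s *: a) ('D_(s *: b) f) z = s * s * 'D_a ('D_b f) z.
  move=> zr; have h : \forall y \near z, s *: 'D_b f y = 'D_(s *: b) f y.
    near=> y; have yr : ball x r y.
      by near: y; apply: open_nbhs_nbhs; split=> //; exact: ball_open.
    have D := Ck_is_diff cr yr.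
    by rewrite !(is_diff_derive _ D) linearZ.
  have [_ /(_ b) db] := cr; have D := @Ck_is_diff R 0 _ _ _ db zr.
  have D' := is_diff_near_eq h (is_diffZ s D).
  rewrite (is_diff_derive _ D') (is_diff_derive _ D).
  by rewrite -[LHS]/(s *: 'd ('D_b f) z (s *: a)) linearZ /= scalerA.
move: e1; rewrite (DZ v u z1 z1r) (DZ u v z2 z2r) => e1.
have -> : x + s *: v + s *: u = x + s *: u + s *: v by rewrite addrAC.
move=> e2.
have [_ [_ h1]] := hr z1 z1r; have [_ [h2 _]] := hr z2 z2r.
have e3 : 'D_u ('D_v f) z2 = 'D_v ('D_u f) z1.
  have s20 : s * s != 0 by rewrite mulf_neq0// gt_eqF.
  have aux (a b c d : R) : a - b - (c - d) = a - c - (b - d) by ring.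
  move: e1 e2; set X1 := 'D_v ('D_u f) z1; set X2 := 'D_u ('D_v f) z2.
  move: (f _) (f (x + s *: v)) (f (x + s *: u)) (f x) X1 X2 => a b c d X1 X2 e1 e2.
  by apply: (mulfI s20); rewrite -e1 -e2; exact: aux.
move: h1 h2 e3.
move: ('D_u ('D_v f) x) ('D_v ('D_u f) x) ('D_v ('D_u f) z1) ('D_u ('D_v f) z2) => A1 A2 A3 A4.
move=> h1 h2 e3; rewrite e3 in h2; apply: (le_trans (ler_distD A3 _ _)).
by rewrite (splitr e) lerD// ltW// distrC.
Unshelve. all: by end_near. Qed.

End SecondDerivatives.

Section SlotCalculus.
Context {R : realType} {E J : normedModType R} {n : nat} (B : fbasis J n).

Lemma derive_sym_vec (U : set E) (f : E -> J) (x u v : E) : open U -> U x -> Ck_on 2 U f ->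
  'D_u ('D_v f) x = 'D_v ('D_u f) x.
Proof.
move=> oU Ux cf; have [df ddf] := cf.
have fcl i : linear (fc B i) by move=> a y z; rewrite linearP.
have D i (g : E -> J) w y : differentiable g y -> 'D_w (fun z => fc B i (g z)) y = fc B i ('D_w g y).
  move=> dg; have Dg : is_diff y g ('d g y) by exact/differentiableP.
  have Dl := is_diff_lin (g y) (fcl i) (@fc_continuous _ _ _ B i).
  by rewrite (is_diff_derive w (is_diff_comp Dg Dl)) (is_diff_derive w Dg).
have DD i a b : 'D_a ('D_b (fun z => fc B i (f z))) x = fc B i ('D_a ('D_b f) x).
  have h : \forall y \near x, fc B i ('D_b f y) = 'D_b (fun z => fc B i (f z)) y.
    by apply: filterS (open_nbhs_nbhs (conj oU Ux)) => y Uy; rewrite D//; exact: df.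
  have [/(_ x Ux) dd _] := ddf b; rewrite -D//.
  have Dd : is_diff x ('D_b f) ('d ('D_b f) x) by exact/differentiableP.
  have Dl := is_diff_lin ('D_b f x) (fcl i) (@fc_continuous _ _ _ B i).
  have D1 := is_diff_comp Dd Dl; have D2 := is_diff_near_eq h D1.
  by rewrite (is_diff_derive a D1) (is_diff_derive a D2).
apply: (fc_ext (B := B)) => i; rewrite -!DD.
apply: (derive_sym u v oU Ux).
by apply: (Ck_lin_comp oU (fcl i) (@fc_continuous _ _ _ B i) cf).
Qed.

(** A product rule for evaluating a varying linear map on a varying vector. Expansion of the vector
    in the basis reduces it to the maps [H^~ c] with fixed argument. *)
Lemma slot_diff (F : normedModType R) (H : E -> J -> F) (dH : J -> E -> F) (v dv : E -> J) x :
  (\forall y \near x, linear (H y)) -> (forall c, is_diff x (H^~ c) (dH c)) ->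
  is_diff x v dv -> is_diff x (fun y => H y (v y)) (fun w => dH (v x) w + H x (dv w)).
Proof.
move=> lH DH Dv; have lx := nbhs_singleton lH.
have Hs y c : linear (H y) -> H y c = \sum_(i < n) (fc B i c : R) *: H y (fb B i).
  by move=> l; rewrite {1}(fbK B c) (lin_sum l); apply: eq_bigr => i _; rewrite (linZ l).
have Dfc i : is_diff x (fun y => fc B i (v y) : R^o) (fun w => fc B i (dv w)).
  have fcl : linear (fc B i) by move=> a y z; rewrite linearP.
  exact: (is_diff_comp Dv (is_diff_lin (v x) fcl (@fc_continuous _ _ _ B i))).
have h : \forall y \near x, \sum_(i < n) (fc B i (v y) : R) *: H y (fb B i) = H y (v y).
  by apply: filterS lH => y l; rewrite -Hs.
have D1 := @is_diff_sum R E F x _ (index_enum 'I_n) _ _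
  (fun i => bilin_is_diff (@bilin_scale R F) (Dfc i) (DH (fb B i))).
apply: (is_diff_congr _ _ (is_diff_near_eq h D1)) => // w.
rewrite big_split /= (Hs x (dv w) lx); congr (_ + _).
have h2 : \forall y \near x, \sum_(i < n) (fc B i (v x) : R) *: H y (fb B i) = H y (v x).
  by apply: filterS lH => y l; rewrite -Hs.
have D2 := is_diff_near_eq h2 (@is_diff_sum R E F x _ (index_enum 'I_n) _ _
  (fun i => is_diffZ (fc B i (v x) : R) (DH (fb B i)))).
have [_ <-] := DH (v x); have [_ ->] := D2.
by [].
Qed.

Lemma derive_slot_linear (H : E -> J -> R^o) x w :
  (\forall y \near x, linear (H y)) -> (forall c, differentiable (H^~ c) x) ->
  linear (fun c => 'D_w (H^~ c) x : R^o).
Proof.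
move=> lH dH a u v.
have D c : is_diff x (H^~ c) ('d (H^~ c) x) by exact/differentiableP.
have h : \forall y \near x, a *: H y u + H y v = H y (a *: u + v).
  by apply: filterS lH => y l; rewrite l.
have D1 := is_diff_near_eq h (is_diffD (is_diffZ a (D u)) (D v)).
by rewrite (is_diff_derive w D1) (is_diff_derive w (D u)) (is_diff_derive w (D v)).
Qed.

End SlotCalculus.

Section FormDerivatives.
Context {R : realType} {J : normedModType R}.
Context (Y : set J) (omega : J -> J -> R^o) (omega_lin : forall x, linear (omega x))
  (omega_Ck : forall k u, Ck_on k Y (omega^~ u)) (Yo : open Y).

(** These flat derivatives of [omega] become, on a leaf, the affine form, the cubic form and the
    flat derivative of the cubic form. *)
Definition form1 (y a c : J) : R^o := 'D_a (omega^~ c) y.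
Definition form2 (y w a c : J) : R^o := 'D_w (fun z => form1 z a c) y.
Definition form3 (y w a b c : J) : R^o := 'D_w (fun z => form2 z a b c) y.

Lemma form1_Ck k a c : Ck_on k Y (fun y => form1 y a c).
Proof. by have [_ /(_ a)] := omega_Ck k.+1 c. Qed.

Lemma form2_Ck k w a c : Ck_on k Y (fun y => form2 y w a c).
Proof. by have [_ /(_ w)] := form1_Ck k.+1 a c. Qed.

Lemma Ck_derive_linear (g : J -> R^o) y : Ck_on 1 Y g -> Y y -> linear (fun w => 'D_w g y).
Proof.
move=> cg Yy a u v; have D := Ck_is_diff cg Yy.
by rewrite !(is_diff_derive _ D) linearP.
Qed.

Lemma form1_linearr y a : Y y -> linear (form1 y a).
Proof.
move=> Yy; apply: (derive_slot_linear (H := omega)) => [|c].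
  exact: nearW.
by have [/(_ y Yy)] := omega_Ck 1 c.
Qed.

Lemma form1_linearl y c : Y y -> linear (fun a => form1 y a c).
Proof. by move=> Yy; apply: Ck_derive_linear => //; exact: omega_Ck. Qed.

Let nearY y (P : J -> Prop) : Y y -> (forall z, Y z -> P z) -> \forall z \near y, P z.
Proof. by move=> Yy h; apply: filterS (open_nbhs_nbhs (conj Yo Yy)). Qed.

Lemma form2_linearr y w a : Y y -> linear (form2 y w a).
Proof.
move=> Yy; apply: (derive_slot_linear (H := fun z c => form1 z a c)) => [|c].
  by apply: nearY => // z Yz; exact: form1_linearr.
by have [/(_ y Yy)] := form1_Ck 1 a c.
Qed.

Lemma form2_linearm y w c : Y y -> linear (fun a => form2 y w a c).
Proof.
move=> Yy; apply: (derive_slot_linear (H := fun z a => form1 z a c)) => [|a].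
  by apply: nearY => // z Yz; exact: form1_linearl.
by have [/(_ y Yy)] := form1_Ck 1 a c.
Qed.

Lemma form2_linearl y a c : Y y -> linear (fun w => form2 y w a c).
Proof. by move=> Yy; apply: Ck_derive_linear => //; exact: form1_Ck. Qed.

End FormDerivatives.

(** * The Gauss formula in a chart *)

Section LeafGeometry.
Context {R : realType} {J : normedModType R} {n : nat} (B : fbasis J n).
Local Notation V := (J * R^o)%type.
Context (Y : set J) (omega : J -> J -> R^o) (omega_lin : forall x, linear (omega x))
  (omega_Ck : forall k u, Ck_on k Y (omega^~ u)) (Yo : open Y).
Context (M : smoothManifold J) (f : M -> V)
  (hI : integral_manifold (Y `*` [set: R^o]) (leaf_field omega) f).
Local Notation p := (fst \o f).
Local Notation xi := ((0, 1) : V).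
Local Notation form1 := (form1 omega).
Local Notation form2 := (form2 omega).
Local Notation form3 := (form3 omega).

Section Chart.
Context (c : chart J M) (ac : atlas c).
Local Notation theta := (p \o cinv c).
Local Notation F := (f \o cinv c).

(** The induced connection is the flat connection of [J] seen through [theta]; [hess] is the image
    of its Christoffel symbols under the differential of [theta]. *)
Definition hess (x u v : J) : J := 'D_u (fun y => 'd theta y v) x.

Let oc : open (cimg c) := @cimg_open _ _ _ c.
Let Yth x : Y (theta x). Proof. exact: (leaf_domain hI). Qed.

Let Dth x : cimg c x -> is_diff x theta ('d theta x).
Proof. exact: (Ck_is_diff (leaf_smooth hI ac 1%N)). Qed.

Lemma chart_dE x v : cimg c x -> 'd F x v = ('d theta x v, omega (theta x) ('d theta x v)) :> V.
Proof.
move=> cx; have [_ ->] := leaf_diff1 hI ac cx.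
by rewrite /= -(leaf_tangent hI v ac cx); case: ('d F x v).
Qed.

Lemma chart_d2 x v : cimg c x -> is_diff x (fun y => 'd theta y v) (fun w => hess x w v).
Proof.
move=> cx; have [_ /(_ v) dd] := leaf_smooth hI ac 2%N.
have D := @Ck_is_diff _ _ _ 0 _ _ _ dd cx.
have h : \forall y \near x, 'D_v theta y = 'd theta y v.
  by apply: filterS (open_nbhs_nbhs (conj oc cx)) => y cy; rewrite (is_diff_derive v (Dth cy)).
have D2 := is_diff_near_eq h D; apply: (is_diff_congr _ _ D2) => // w.
by rewrite /hess (is_diff_derive w D2).
Qed.

Lemma hess_sym x u v : cimg c x -> hess x u v = hess x v u.
Proof.
move=> cx; have := derive_sym_vec B u v oc cx (leaf_smooth hI ac 2%N).
have e a b : 'D_a ('D_b theta) x = hess x a b.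
  have h : \forall y \near x, 'd theta y b = 'D_b theta y.
    by apply: filterS (open_nbhs_nbhs (conj oc cx)) => y cy; rewrite (is_diff_derive b (Dth cy)).
  have D := chart_d2 b cx.
  by rewrite (is_diff_derive a (is_diff_near_eq h D)).
by rewrite !e.
Qed.

Lemma chart_surj x : cimg c x -> forall w, exists u, 'd theta x u = w.
Proof.
move=> cx w; have l : linear ('d theta x) by move=> a u v; rewrite linearP.
have i0 u : 'd theta x u = 0 -> u = 0.
  by move=> e; apply: (leaf_immersion hI ac cx); rewrite e linear0.
have [g [_ _ gK]] := lin_inj_bij B l i0.
by exists (g w); rewrite gK.
Qed.

Lemma chart_comp x (g : J -> R^o) : cimg c x -> Ck_on 1 Y g ->
  is_diff x (fun z => g (theta z)) (fun w => 'D_('d theta x w) g (theta x)).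
Proof.
move=> cx cg; have Dg := Ck_is_diff cg (Yth x).
apply: (is_diff_congr _ _ (is_diff_comp (Dth cx) Dg)) => // w.
by rewrite (is_diff_derive _ Dg).
Qed.

Lemma chart_frame_diff x v : cimg c x -> is_diff x (fun y => 'd F y v : V)
  (fun w => (hess x w v,
     form1 (theta x) ('d theta x w) ('d theta x v) + omega (theta x) (hess x w v))).
Proof.
move=> cx; have h : \forall y \near x,
    ('d theta y v, omega (theta y) ('d theta y v)) = 'd F y v :> V.
  by apply: filterS (open_nbhs_nbhs (conj oc cx)) => y cy; rewrite chart_dE.
apply: (is_diff_near_eq h).
have D : is_diff x (fun y => omega (theta y) ('d theta y v)) (fun w =>
    form1 (theta x) ('d theta x w) ('d theta x v) + omega (theta x) (hess x w v)).
  apply: (slot_diff B (H := fun z a => omega (theta z) a)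
    (dH := fun a w => form1 (theta x) ('d theta x w) a)) (chart_d2 v cx) => [|a].
    exact: nearW.
  exact: (chart_comp cx (omega_Ck 1 a)).
exact: (is_diff_pair (chart_d2 v cx) D).
Qed.

Lemma gauss_split x (z : V) : cimg c x -> exists w t, z = 'd F x w + t *: xi.
Proof.
move=> cx; have [w e] := chart_surj cx z.1.
exists w, (z.2 - omega (theta x) z.1); rewrite chart_dE// e; case: z e => a b /= e.
by congr pair; rewrite /= ?scaler0 ?addr0// [X in _ + X]mulr1 addrC subrK.
Qed.

Lemma gauss_partsE x (z : V) w t : cimg c x -> z = 'd F x w + t *: xi ->
  'd theta x w = z.1 /\ t = z.2 - omega (theta x) z.1.
Proof.
move=> cx ->; rewrite chart_dE//=.
have -> : 'd theta x w + t *: (0 : J) = 'd theta x w by rewrite scaler0 addr0.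
by split=> //; rewrite [t *: _]mulr1 [omega _ _ + t]addrC addrK.
Qed.

Lemma tangential_partE x z : cimg c x -> 'd theta x (tangential_part xi F x z) = z.1.
Proof.
move=> cx; have [w [t e]] := gauss_split z cx.
have [t' e'] : exists t, z = 'd F x (tangential_part xi F x z) + t *: xi.
  by apply: (@xgetPex _ 0 [set w | exists t : R, z = 'd F x w + t *: xi]); exists w, t.
by have [] := gauss_partsE cx e'.
Qed.

Lemma transversal_partE x z : cimg c x -> transversal_part xi F x z = z.2 - omega (theta x) z.1.
Proof.
move=> cx; have [w [t e]] := gauss_split z cx.
have [w' e'] : exists w, z = 'd F x w + transversal_part xi F x z *: xi.
  by apply: (@xgetPex _ 0 [set t | exists w, z = 'd F x w + t *: xi]); exists t, w.
by have [_ ] := gauss_partsE cx e'.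
Qed.

Lemma induced_connE x u v : cimg c x -> 'd theta x (induced_conn xi F x u v) = hess x u v.
Proof.
by move=> cx; rewrite tangential_partE// (is_diff_derive u (chart_frame_diff v cx)).
Qed.

Lemma affine_formE x u v : cimg c x ->
  affine_form xi F x u v = form1 (theta x) ('d theta x u) ('d theta x v).
Proof.
move=> cx; rewrite /affine_form transversal_partE// (is_diff_derive u (chart_frame_diff v cx)) /=.
by rewrite addrK.
Qed.

(** [slot_diff] is applied to one vector argument after the other, until only the base point
    varies. *)
Lemma affine_form_diff x u v : cimg c x -> is_diff x (fun y => affine_form xi F y u v : R^o)
  (fun w => form2 (theta x) ('d theta x w) ('d theta x u) ('d theta x v)
     + form1 (theta x) (hess x w u) ('d theta x v)
     + form1 (theta x) ('d theta x u) (hess x w v)).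
Proof.
move=> cx; have h : \forall y \near x,
    form1 (theta y) ('d theta y u) ('d theta y v) = affine_form xi F y u v.
  by apply: filterS (open_nbhs_nbhs (conj oc cx)) => y cy; rewrite affine_formE.
apply: (is_diff_near_eq h).
apply: (slot_diff B (H := fun z a => form1 (theta z) ('d theta z u) a)
  (dH := fun a w => form2 (theta x) ('d theta x w) ('d theta x u) a + form1 (theta x) (hess x w u) a))
  (chart_d2 v cx) => [|a].
  by apply: nearW => z; exact: (form1_linearr omega_lin omega_Ck _ (Yth z)).
apply: (slot_diff B (H := fun z b => form1 (theta z) b a)
  (dH := fun b w => form2 (theta x) ('d theta x w) b a)) (chart_d2 u cx) => [|b].
  by apply: nearW => z; exact: (form1_linearl omega_Ck _ (Yth z)).
exact: (chart_comp cx (form1_Ck omega_Ck 1 b a)).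
Qed.

(** The terms with [hess] in the derivative of the affine form cancel those of the induced
    connection. *)
Lemma cubic_formE x w u v : cimg c x -> cubic_form xi F x w u v =
  form2 (theta x) ('d theta x w) ('d theta x u) ('d theta x v).
Proof.
move=> cx; rewrite /cubic_form (is_diff_derive w (affine_form_diff u v cx)).
have aux k1 k2 : 'd theta x k1 = hess x w u -> 'd theta x k2 = hess x w v ->
    form2 (theta x) ('d theta x w) ('d theta x u) ('d theta x v)
     + form1 (theta x) (hess x w u) ('d theta x v) + form1 (theta x) ('d theta x u) (hess x w v)
     - affine_form xi F x k1 v - affine_form xi F x u k2 =
    form2 (theta x) ('d theta x w) ('d theta x u) ('d theta x v).
  move=> e1 e2; have -> := affine_formE k1 v cx; have -> := affine_formE u k2 cx.
  by rewrite e1 e2; move: (form2 _ _ _ _) (form1 _ _ _) (form1 _ _ _) => a1 a2 a3;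
    rewrite addrAC addrK addrK.
exact: aux (induced_connE w u cx) (induced_connE w v cx).
Qed.

Lemma cubic_form_diff x u1 u2 u3 : cimg c x ->
  is_diff x (fun y => cubic_form xi F y u1 u2 u3 : R^o)
  (fun w => form3 (theta x) ('d theta x w) ('d theta x u1) ('d theta x u2) ('d theta x u3)
     + form2 (theta x) (hess x w u1) ('d theta x u2) ('d theta x u3)
     + form2 (theta x) ('d theta x u1) (hess x w u2) ('d theta x u3)
     + form2 (theta x) ('d theta x u1) ('d theta x u2) (hess x w u3)).
Proof.
move=> cx; have h : \forall y \near x,
    form2 (theta y) ('d theta y u1) ('d theta y u2) ('d theta y u3) = cubic_form xi F y u1 u2 u3.
  by apply: filterS (open_nbhs_nbhs (conj oc cx)) => y cy; rewrite cubic_formE.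
apply: (is_diff_near_eq h).
apply: (slot_diff B (H := fun z a => form2 (theta z) ('d theta z u1) ('d theta z u2) a)
  (dH := fun a w => form3 (theta x) ('d theta x w) ('d theta x u1) ('d theta x u2) a
    + form2 (theta x) (hess x w u1) ('d theta x u2) a
    + form2 (theta x) ('d theta x u1) (hess x w u2) a))
  (chart_d2 u3 cx) => [|a].
  by apply: nearW => z; exact: (form2_linearr omega_lin omega_Ck Yo _ _ (Yth z)).
apply: (slot_diff B (H := fun z b => form2 (theta z) ('d theta z u1) b a)
  (dH := fun b w => form3 (theta x) ('d theta x w) ('d theta x u1) b a
    + form2 (theta x) (hess x w u1) b a)) (chart_d2 u2 cx) => [|b].
  by apply: nearW => z; exact: (form2_linearm omega_Ck Yo _ _ (Yth z)).
apply: (slot_diff B (H := fun z d => form2 (theta z) d b a)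
  (dH := fun d w => form3 (theta x) ('d theta x w) d b a)) (chart_d2 u1 cx) => [|d].
  by apply: nearW => z; exact: (form2_linearl omega_Ck _ _ (Yth z)).
exact: (chart_comp cx (form2_Ck omega_Ck 1 d b a)).
Qed.

End Chart.
End LeafGeometry.

(** * Levi-Civita connection and isometries of a leaf *)

Section LeafMetric.
Context {R : realType} {J : normedModType R} {n : nat} (B : fbasis J n).
Local Notation V := (J * R^o)%type.
Context (Y : set J) (omega : J -> J -> R^o) (omega_lin : forall x, linear (omega x))
  (omega_Ck : forall k u, Ck_on k Y (omega^~ u)) (Yo : open Y).
Context (M : smoothManifold J) (f : M -> V)
  (hI : integral_manifold (Y `*` [set: R^o]) (leaf_field omega) f).
Local Notation p := (fst \o f).
Local Notation xi := ((0, 1) : V).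
Local Notation form1 := (form1 omega).
Local Notation form2 := (form2 omega).
Local Notation form3 := (form3 omega).
Context (form1_sym : forall y a b, Y y -> form1 y a b = form1 y b a)
  (form1_nd : forall y a, Y y -> (forall b, form1 y a b = 0) -> a = 0).

(* [N] is the difference tensor of the Levi-Civita connection of [form1] and
   the flat connection at [y]. *)
Definition parallel_at (y : J) (N : J -> J -> J) : Prop :=
  [/\ forall a b, N a b = N b a,
      forall w a b, form2 y w a b = form1 y (N w a) b + form1 y a (N w b) &
      forall w a b c, form3 y w a b c =
        form2 y (N w a) b c + form2 y a (N w b) c + form2 y a b (N w c)].

Lemma leaf_graph_immersion : graph_immersion xi f.
Proof.
have [_ fi _ _ _] := hI; split=> // c x ac cx; split=> [w|z].
  rewrite (chart_dE hI ac w cx) => -[e]; rewrite e (lin0 (omega_lin _)) => /esym/eqP.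
  by rewrite oner_eq0.
have [w [t ->]] := gauss_split B hI ac z cx; by exists w, t.
Qed.

Lemma leaf_nondegenerate : nondegenerate_immersion xi f.
Proof.
move=> c x ac cx u h; have Yx := leaf_domain hI (cinv c x).
apply: (leaf_immersion hI ac cx); rewrite linear0; apply: (form1_nd Yx) => b.
have [v <-] := chart_surj B hI ac cx b.
by rewrite -(h v) (affine_formE B omega_lin omega_Ck hI ac u v cx).
Qed.

(** The candidate [G0] satisfies the conditions, so the choice in [levi_civita] is not the default
    value. For uniqueness, the difference of two solutions gives a trilinear form symmetric in its
    first two and antisymmetric in its last two arguments; such a form vanishes, and [form1] is
    nondegenerate. *)
Lemma leaf_levi_civita c x N u v : atlas c -> cimg c x -> parallel_at (p (cinv c x)) N ->
  'd (p \o cinv c) x (levi_civita xi (f \o cinv c) x u v) =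
  hess f c x u v + N ('d (p \o cinv c) x u) ('d (p \o cinv c) x v).
Proof.
move=> ac cx [Nsym N2 _]; set F := f \o cinv c; set dth := 'd (p \o cinv c) x.
have Yx : Y (p (cinv c x)) := leaf_domain hI (cinv c x).
set y := p (cinv c x) in N2 Yx *.
have [g [lg gK Kg]] : exists g, [/\ linear g, cancel dth g & cancel g dth].
  apply: (lin_inj_bij B) => [a s t|s e]; first by rewrite linearP.
  by apply: (leaf_immersion hI ac cx); rewrite -/dth e linear0.
pose G0 a b := g (hess f c x a b + N (dth a) (dth b)).
have lcE G : is_levi_civita_at xi F x G -> forall w a b,
    form2 y (dth w) (dth a) (dth b) + form1 y (hess f c x w a) (dth b)
      + form1 y (dth a) (hess f c x w b) =
    form1 y (dth (G w a)) (dth b) + form1 y (dth a) (dth (G w b)).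
  move=> [_ hG] w a b; have := hG w a b.
  rewrite (is_diff_derive w (affine_form_diff B omega_lin omega_Ck hI ac a b cx)) => ->.
  rewrite (affine_formE B omega_lin omega_Ck hI ac (G w a) b cx).
  by rewrite (affine_formE B omega_lin omega_Ck hI ac a (G w b) cx).
have lr a : linear (form1 y a) := form1_linearr omega_lin omega_Ck a Yx.
have ll b : linear (fun a => form1 y a b) := form1_linearl omega_Ck b Yx.
have G0P : is_levi_civita_at xi F x G0.
  split=> [a b|w a b]; first by rewrite /G0 (hess_sym B hI ac a b cx) Nsym.
  rewrite (is_diff_derive w (affine_form_diff B omega_lin omega_Ck hI ac a b cx)).
  rewrite (affine_formE B omega_lin omega_Ck hI ac (G0 w a) b cx).
  rewrite (affine_formE B omega_lin omega_Ck hI ac a (G0 w b) cx).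
  rewrite -/dth -/y /G0 !Kg (linD (ll _)) (linD (lr _)) N2.
  move: (form1 _ _ _) (form1 _ _ _) (form1 _ _ _) (form1 _ _ _) => a1 a2 a3 a4.
  by ring.
have GP : is_levi_civita_at xi F x (levi_civita xi F x).
  by apply: (@xgetPex _ _ [set G | is_levi_civita_at xi F x G]); exists G0.
suff -> : dth (levi_civita xi F x u v) = dth (G0 u v) by rewrite /G0 Kg.
set G := levi_civita xi F x in GP *.
pose a w s t := form1 y (dth (G w s) - dth (G0 w s)) (dth t).
have aC w s t : a w s t = a s w t by rewrite /a GP.1 G0P.1.
have aA w s t : a w s t = - a w t s.
  apply/eqP; rewrite -addr_eq0; apply/eqP; rewrite /a.
  have := lcE _ GP w s t; rewrite (lcE _ G0P w s t) => e.
  rewrite (linB (ll (dth t))) (linB (ll (dth s))).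
  rewrite (form1_sym (dth (G w t)) (dth s) Yx) (form1_sym (dth (G0 w t)) (dth s) Yx).
  move: e; move: (form1 _ _ _) (form1 _ _ _) (form1 _ _ _) (form1 _ _ _) => a1 a2 a3 a4 e.
  by lra.
have a0 w s t : a w s t = 0.
  have : a w s t = - a w s t.
    by rewrite {1}aA aC aA opprK aC aA aC.
  by move: (a w s t) => z ?; lra.
apply/eqP; rewrite -subr_eq0; apply/eqP; apply: (form1_nd Yx) => b.
by have := a0 u v (g b); rewrite /a Kg.
Qed.

(** The terms with [hess] cancel, and the third condition of [parallel_at] cancels the rest. *)
Lemma leaf_parallel : (forall y, Y y -> exists N, parallel_at y N) -> parallel_cubic_form xi f.
Proof.
move=> hN c x ac cx w u1 u2 u3; have Yx : Y (p (cinv c x)) := leaf_domain hI (cinv c x).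
have [N hNx] := hN _ Yx; have [_ _ N3] := hNx.
rewrite /levi_civita_cubic.
rewrite (is_diff_derive w (cubic_form_diff B omega_lin omega_Ck Yo hI ac u1 u2 u3 cx)) N3.
have cE k a b := cubic_formE B omega_lin omega_Ck hI ac k a b cx.
have lc u := leaf_levi_civita w u ac cx hNx.
have -> := cE (levi_civita xi (f \o cinv c) x w u1) u2 u3.
have -> := cE u1 (levi_civita xi (f \o cinv c) x w u2) u3.
have -> := cE u1 u2 (levi_civita xi (f \o cinv c) x w u3).
have -> := lc u1; have -> := lc u2; have -> := lc u3.
rewrite (linD (form2_linearl omega_Ck _ _ Yx)).
rewrite (linD (form2_linearm omega_Ck Yo _ _ Yx)).
rewrite (linD (form2_linearr omega_lin omega_Ck Yo _ _ Yx)).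
move: (form2 _ _ _ _) (form2 _ _ _ _) (form2 _ _ _ _) (form2 _ _ _ _) (form2 _ _ _ _) (form2 _ _ _ _).
move=> a1 a2 a3 a4 a5 a6.
by ring.
Qed.

Lemma coord_dom_open (act : M -> M) (c d : chart J M) : continuous act ->
  open (coord_dom c d act).
Proof.
move=> ca; rewrite openE => y [cy dy].
have cac : {for y, continuous (act \o cinv c)}.
  by apply: continuous_comp; [exact: cinv_continuous|exact: ca].
have h : nbhs y ((act \o cinv c) @^-1` cdom d).
  exact: (cac _ (open_nbhs_nbhs (conj (@cdom_open _ _ _ d) dy))).
exact: filterI (open_nbhs_nbhs (conj (@cimg_open _ _ _ c) cy)) h.
Qed.

Lemma leaf_map_diff (act : M -> M) (phi : J -> J) c d x w : smooth_map act ->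
  (forall m, p (act m) = phi (p m)) -> differentiable phi (p (cinv c x)) ->
  atlas c -> atlas d -> coord_dom c d act x ->
  'd (p \o cinv d) (Defs.coord c d act x) ('d (Defs.coord c d act) x w) =
    'd phi (p (cinv c x)) ('d (p \o cinv c) x w).
Proof.
move=> [ca smact] pact /differentiableP Dphi ac ad [cx dx].
have Dc := Ck_is_diff (smact c d ac ad 1%N) (conj cx dx).
have dx' : cimg d (Defs.coord c d act x) by exact: cmap_img.
have Dth := Ck_is_diff (leaf_smooth hI ac 1%N) cx.
have Dth' := Ck_is_diff (leaf_smooth hI ad 1%N) dx'.
have h : \forall y \near x, (p \o cinv d) (Defs.coord c d act y) = phi ((p \o cinv c) y).
  apply: filterS (open_nbhs_nbhs (conj (@coord_dom_open act c d ca) (conj cx dx))) => y [cy dy].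
  by rewrite /= /Defs.coord cmapK//; exact: pact.
have D1 := is_diff_near_eq h (is_diff_comp Dc Dth').
have D2 := is_diff_comp Dth Dphi.
exact: etrans (esym (is_diff_derive w D1)) (is_diff_derive w D2).
Qed.

Lemma leaf_isometry (act : M -> M) (phi : J -> J) :
  diffeomorphism act -> (forall m, p (act m) = phi (p m)) -> smooth_on Y phi ->
  (forall y a b, Y y -> form1 (phi y) ('d phi y a) ('d phi y b) = form1 y a b) ->
  affine_isometry xi f act.
Proof.
move=> da pact sphi hphi; split; first exact: da.
move=> c d x ac ad cdx u v; have [cx dx] := cdx.
have [sact _] := da.
have dx' : cimg d (Defs.coord c d act x) by exact: cmap_img.
have Yx : Y (p (cinv c x)) := leaf_domain hI (cinv c x).
have dphi : differentiable phi (p (cinv c x)) by have [+ _] := sphi 1%N; apply.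
have E w := leaf_map_diff w sact pact dphi ac ad cdx.
rewrite (affine_formE B omega_lin omega_Ck hI ad _ _ dx').
rewrite (affine_formE B omega_lin omega_Ck hI ac u v cx) !E.
have -> : (p \o cinv d) (Defs.coord c d act x) = phi (p (cinv c x)).
  by rewrite /= /Defs.coord cmapK//; exact: pact.
exact: hphi.
Qed.

End LeafMetric.

Section LeafIsometries.
Context {R : realType} {J : normedModType R} {n : nat} (B : fbasis J n).
Local Notation V := (J * R^o)%type.
Context (Y : set J) (omega : J -> J -> R^o) (omega_lin : forall x, linear (omega x))
  (omega_Ck : forall k u, Ck_on k Y (omega^~ u)) (Yo : open Y)
  (prim_ex : forall x, Y x -> exists psi r, local_prim Y omega x r psi).
Local Notation form1 := (form1 omega).
Local Notation leaf_auto := (leaf_auto Y omega).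

(** Such a map preserves the distribution and the metric, but it may carry the given leaf to another
    one; a common point decides. *)
Definition leaf_isom (Phi : V -> V) : Prop := exists phi eps E,
  [/\ Phi = leaf_auto_map phi eps E, leaf_auto phi eps E &
    forall y a b, Y y -> form1 (phi y) ('d phi y a) ('d phi y b) = form1 y a b].

Lemma leaf_isom_Y Phi z : leaf_isom Phi -> Y z.1 -> Y (Phi z).1.
Proof. by move=> [phi [eps [E [-> [Yphi _ _] _]]]] /Yphi. Qed.

Lemma leaf_isom_comp Phi Psi : leaf_isom Phi -> leaf_isom Psi -> leaf_isom (Phi \o Psi).
Proof.
move=> [phi [eps [E [-> [Yphi sphi dE] iphi]]]] [chi [del [G [-> [Ychi schi dG] ichi]]]].
have D y : Y y -> is_diff y (phi \o chi) ('d phi (chi y) \o 'd chi y).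
  move=> Yy; apply: is_diff_comp; first exact: (Ck_is_diff (schi 1%N)).
  by apply: (Ck_is_diff (sphi 1%N)); exact: Ychi.
exists (phi \o chi), (eps * del), (fun x => eps *: G x + E (chi x)); split.
- apply/funext => z; congr pair.
  by rewrite /= scalerDr scalerA addrA.
- split=> [x Yx|k|x Yx]; first exact/Yphi/Ychi.
    by apply: (Ck_comp B Yo Yo) (schi k) (sphi k).
  have [_ De] := D x Yx.
  have DE := is_diff_comp (Ck_is_diff (schi 1%N) Yx) (dE _ (Ychi x Yx)).
  apply: (is_diff_congr _ _ (is_diffD (is_diffZ eps (dG x Yx)) DE)) => // u.
  rewrite De.
  rewrite -[LHS]/(eps *: (omega (chi x) ('d chi x u) - del *: omega x u) +
    (omega (phi (chi x)) ('d phi (chi x) ('d chi x u)) - eps *: omega (chi x) ('d chi x u))).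
  rewrite -[RHS]/(omega (phi (chi x)) ('d phi (chi x) ('d chi x u)) - (eps * del) *: omega x u).
  by rewrite scalerBr scalerA addrC addrA subrK.
- move=> y a b Yy; have [_ ->] := D y Yy.
  by rewrite /= iphi ?ichi//; exact: Ychi.
Qed.

Lemma leaf_isom_translation (t : R) : leaf_isom (fun z => (z.1, z.2 + t)).
Proof.
have Did (y : J) : 'd id y = id :> (J -> J) by have [_ ->] := is_diff_id y.
exists id, 1, (fun=> t); split.
- by apply/funext => z; rewrite /leaf_auto_map scale1r.
- split=> // [k|x Yx]; first exact: Ck_id.
  apply: (is_diff_congr _ _ (is_diff_cst (t : R^o) x)) => // u.
  by rewrite Did scale1r subrr.
- by move=> y a b Yy; rewrite !Did.
Qed.

Context (M : smoothManifold J) (f : M -> V)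
  (hM : maximal_integral_manifold (Y `*` [set: R^o]) (leaf_field omega) f) (m0 : M).
Local Notation xi := ((0, 1) : V).

Definition leaf_lift (Phi : V -> V) : M -> M := leaf_inv f m0 \o (Phi \o f).

Lemma leaf_isom_range Phi m m' : leaf_isom Phi -> range f (Phi (f m)) -> range f (Phi (f m')).
Proof.
move=> [phi [eps [E [-> ha _]]]] hr; have [[_ cM] _ _ _ _] := hM.1.
have hz := leaf_auto_horizontal prim_ex hM ha.
exact: (horizontal_range (t := m) B omega_Ck prim_ex hM cM hz hr m').
Qed.

Lemma leaf_liftE Phi m m' : leaf_isom Phi -> range f (Phi (f m)) ->
  f (leaf_lift Phi m') = Phi (f m').
Proof. by move=> hP hr; apply: leaf_invK; exact: leaf_isom_range hr. Qed.

Lemma leaf_lift_isometry Phi Psi m : leaf_isom Phi -> leaf_isom Psi ->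
  (forall z, Y z.1 -> Psi (Phi z) = z) -> (forall z, Y z.1 -> Phi (Psi z) = z) ->
  range f (Phi (f m)) -> affine_isometry xi f (leaf_lift Phi).
Proof.
move=> hP hQ K K' hr; have hl := leaf_liftE _ hP hr.
have [phi [eps [E [eP ha ia]]]] := hP; have [psi [del [G [eQ hb _]]]] := hQ.
apply: (leaf_isometry B omega_lin omega_Ck hM.1 (phi := phi)) => //.
- rewrite eP; apply: (leaf_act_diffeo B omega_Ck Yo prim_ex hM m0 ha hb); rewrite -?eP -?eQ //.
  by exists m.
- by move=> m'; rewrite /= hl eP.
- by have [] := ha.
Qed.

End LeafIsometries.

(** * The leaves of a metrised Jordan algebra *)

Section JordanLeaf.
Context {R : realType} {J : normedModType R} {n : nat} (B : fbasis J n).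
Context (mul : J -> J -> J) (mul_linearl : forall y, linear (mul^~ y))
  (mul_linearr : forall x, linear (mul x)) (hJ : jordan_product mul).
Context (gamma : J -> J -> R^o) (gamma_linearl : forall y, linear (gamma^~ y))
  (gamma_linearr : forall x, linear (gamma x)) (hgamma : trace_form mul gamma)
  (gamma_nd : nondegenerate_form gamma).
Local Notation "x ** y" := (mul x y) (at level 40, left associativity).
Local Notation V := (J * R^o)%type.
Local Notation strmap := (strmap mul gamma).
Local Notation qinv := (qinv mul).
Local Notation Y := (quasi_domain mul).
Local Notation bq := (bq mul).

Definition qform (x u : J) : R^o := gamma u (bq x).
Local Notation form1 := (form1 qform).
Local Notation form2 := (form2 qform).
Local Notation form3 := (form3 qform).

Let mC := mulJC hJ.
Let mNl := mulJNl mul_linearl.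
Let mNr := mulJNr mul_linearr.
Let gb : bilin gamma := fbasis_bilin B B gamma_linearl gamma_linearr.
Let gC u v : gamma u v = gamma v u. Proof. by have [] := hgamma. Qed.
Let strmap_inv := strmap_inv B gamma_linearl gamma_linearr hgamma gamma_nd.
Let Yorbit := quasi_domain_orbit B mul_linearl mul_linearr hJ gamma_linearl gamma_linearr hgamma gamma_nd.
Let b_str := bq_strmap B mul_linearl mul_linearr hJ gamma_linearl gamma_linearr hgamma gamma_nd.
Let Y_str := strmap_quasi_domain B mul_linearl mul_linearr hJ gamma_linearl gamma_linearr hgamma gamma_nd.
Let Yopen : open Y := quasi_domain_open B mul_linearl mul_linearr hJ gamma_linearl gamma_linearr hgamma.
Let YP := bqP B mul_linearl mul_linearr hJ.
Let YU := bq_uniq B mul_linearl mul_linearr hJ gamma_linearl gamma_linearr hgamma gamma_nd.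
Let Cbq := Ck_bq B mul_linearl mul_linearr hJ gamma_linearl gamma_linearr hgamma gamma_nd.
Let jet := bq_jet B mul_linearl mul_linearr hJ gamma_linearl gamma_linearr hgamma gamma_nd.
Let transport := derive_transport B mul_linearl mul_linearr hJ gamma_linearl gamma_linearr
  hgamma gamma_nd.

Lemma qform_linear x : linear (qform x).
Proof. exact: gamma_linearl. Qed.

Lemma gamma_Ck (g : J -> J) k u : Ck_on k Y g -> Ck_on k Y (fun x => gamma u (g x)).
Proof. by apply: Ck_lin_comp => //; exact: (lin_continuous B). Qed.

Lemma qform_Ck k u : Ck_on k Y (qform^~ u).
Proof. by apply: gamma_Ck; exact: Cbq. Qed.

Lemma qform_prim x : Y x -> exists psi r, local_prim Y qform x r psi.
Proof.
move=> Yx; have [psi [r [r0 rY D _]]] := local_primitive B mul_linearl mul_linearr hJ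
  gamma_linearl gamma_linearr hgamma gamma_nd Yx.
by exists psi, r.
Qed.

Let gamma_derive (g : J -> J) u w y : Ck_on 1 Y g -> Y y ->
  'D_w (fun x => gamma u (g x)) y = gamma u ('D_w g y).
Proof.
move=> cg Yy; have D := Ck_is_diff cg Yy.
have Dl := is_diff_lin (g y) (gamma_linearr u) (lin_continuous B (gamma_linearr u)).
by rewrite (is_diff_derive w (is_diff_comp D Dl)) (is_diff_derive w D).
Qed.

Lemma qform1E y a b : Y y -> form1 y a b = gamma b ('D_a bq y).
Proof. by move=> Yy; exact: (gamma_derive b a (Cbq 1%N) Yy). Qed.

Let CD k a : Ck_on k Y ('D_a bq).
Proof. by have [_ /(_ a)] := Cbq k.+1. Qed.

Let CDD k a b : Ck_on k Y ('D_a ('D_b bq)).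
Proof. by have [_ /(_ a)] := CD k.+1 b. Qed.

Let derive_on (g h : J -> R^o) y w : Y y -> (forall x, Y x -> g x = h x) -> Ck_on 1 Y h ->
  'D_w g y = 'D_w h y.
Proof.
move=> Yy e ch; have D := Ck_is_diff ch Yy.
have he : \forall x \near y, h x = g x.
  by apply: filterS (open_nbhs_nbhs (conj Yopen Yy)) => x Yx; rewrite e.
by rewrite (is_diff_derive w (is_diff_near_eq he D)) (is_diff_derive w D).
Qed.

Lemma qform2E y w a b : Y y -> form2 y w a b = gamma b ('D_w ('D_a bq) y).
Proof.
move=> Yy; rewrite /form2 (derive_on w Yy (fun x => @qform1E x a b)).
  exact: (gamma_derive b w (CD 1 a) Yy).
exact: (gamma_Ck b (CD 1 a)).
Qed.

Lemma qform3E y w a b c : Y y -> form3 y w a b c = gamma c ('D_w ('D_a ('D_b bq)) y).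
Proof.
move=> Yy; rewrite /form3 (derive_on w Yy (fun x => @qform2E x a b c)).
  exact: (gamma_derive c w (CDD 1 a b) Yy).
exact: (gamma_Ck c (CDD 1 a b)).
Qed.

(** The differential of [bq] at [y] is [g' o h], with [h] inverse to [g] and [g'] inverse adjoint to
    [g]; hence [form1 y a b = gamma (h a) (h b)]. Nondegeneracy follows in the same way. *)
Lemma qform1_sym y a b : Y y -> form1 y a b = form1 y b a.
Proof.
move=> Yy; have [g [g' [a' S]]] := Yorbit Yy; have [h [_ [_ _ hg _ _]]] := strmap_inv S.
have [j _ _] := jet S Yy; have [_ _ d _] := S.
by rewrite !qform1E// -(hg a) -(hg b) !j !d gC.
Qed.

Lemma qform1_nd y a : Y y -> (forall b, form1 y a b = 0) -> a = 0.
Proof.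
move=> Yy; have [g [g' [a' S]]] := Yorbit Yy; have [h [_ [_ _ hg _ _]]] := strmap_inv S.
have [j _ _] := jet S Yy; have [lg _ d _] := S => hb.
rewrite -(hg a); suff -> : h a = 0 by rewrite (lin0 lg).
by apply: gamma_nd => v; rewrite gC -d -j hg -qform1E.
Qed.

(** The jets at [y] are the images under [g'] of the jets at [0], and [g'] is inverse adjoint to
    [g], so all identities reduce to [0], where they follow from the invariance of the trace
    form. *)
Lemma strmap_parallel g g' y a' h : strmap g g' y a' -> Y y -> cancel g h -> cancel h g ->
  parallel_at qform y (fun a b => g (- (h a ** h b))).
Proof.
move=> S Yy gh hg; have [j1 j2 j3] := jet S Yy; have [lg _ d _] := S; have [_ tr] := hgamma.
have gNr u v : gamma u (- v) = - gamma u v by exact: (linN (gamma_linearr u)).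
have gNl u v : gamma (- u) v = - gamma u v by exact: (linN (gamma_linearl v)).
have gDr u v w : gamma u (v + w) = gamma u v + gamma u w by exact: (linD (gamma_linearr u)).
split=> [a b|w a b|w a b c].
- by rewrite mC.
- rewrite !qform2E// !qform1E// -(hg w) -(hg a) -(hg b) !gh j2 !j1 !d mulr2n gDr !gNr !gNl.
  by rewrite [h w ** h a]mC [h w ** h b]mC tr [h w ** h a]mC.
- rewrite qform3E// !qform2E// -(hg w) -(hg a) -(hg b) -(hg c) !gh j3 !j2 !d.
  rewrite !mulr2n !gDr !gNl !gNr !mNr !mNl !gNr !opprK.
  rewrite [h w ** h c]mC tr [h w ** h b ** h a]mC [h w ** h b]mC [h w ** h a]mC.
  by move: (gamma _ _) (gamma _ _) (gamma _ _) => a1 a2 a3; ring.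
Qed.

Lemma qform_parallel y : Y y -> exists N, parallel_at qform y N.
Proof.
move=> Yy; have [g [g' [a' S]]] := Yorbit Yy; have [h [_ [_ gh hg _ _]]] := strmap_inv S.
by exists (fun a b => g (- (h a ** h b))); exact: strmap_parallel S Yy gh hg.
Qed.

(** The map [x |-> - bq x] is the inversion of the hull restricted to [1 + J]: from [qinv x b]
    follows [qinv (- b) (- x)]. It is continuous and fixes [0], so the image of the domain stays in
    the component. *)
Lemma quasi_domain_oppq x : Y x -> Y (- bq x).
Proof.
move=> Yx; have C0 : - bq 0 = 0 by rewrite (bq0 B mul_linearl mul_linearr hJ) oppr0.
have Y0' : Y 0 := quasi_domain0 B mul_linearl mul_linearr hJ.
apply: (quasi_domain_max B mul_linearl mul_linearr hJ (C := [set - bq z | z in Y]) (x := 0)) => //.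
- apply: connected_continuous_connected; first exact: (quasi_domain_connected B mul_linearl mul_linearr hJ).
  apply: continuous_in_subspaceT => z /set_mem Yz.
  by apply: cvgN; exact: (Ck_continuous (Cbq 0%N) Yz).
- move=> _ [z Yz <-]; exists (- z); have [q1 q2] := YP Yz; split=> [|u].
    by rewrite opprK addrC q1 mNl mNr opprK mC.
  by rewrite !(mNl, mNr) q2.
- by exists 0.
- by exists x.
Qed.

Lemma bq_oppq x : Y x -> bq (- bq x) = - x.
Proof.
move=> Yx; apply/esym/YU; first exact: quasi_domain_oppq.
have [q1 q2] := YP Yx; split=> [|u]; first by rewrite opprK addrC q1 mNl mNr opprK mC.
by rewrite !(mNl, mNr) q2.
Qed.

(* The reflection of the leaf at its points over [0]. *)
Definition qrefl (z : V) : V := (- bq z.1, (-1) *: z.2 + gamma z.1 (bq z.1)).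

(** Since [bq (- bq x) = - x], the form pulls back to [gamma(db, x)], and [gamma(db, x) + gamma(dx,
    b) = d gamma(x, b)]: this is the automorphism condition for [eps = -1]. *)
Lemma qrefl_isom : leaf_isom Y qform qrefl.
Proof.
have D x : Y x -> is_diff x (fun y => - bq y) (fun u => - 'd bq x u).
  move=> Yx; exact: (is_diffN (Ck_is_diff (Cbq 1%N) Yx)).
have dE x u : Y x -> 'd (fun y => - bq y) x u = - 'D_u bq x.
  move=> Yx; have [_ ->] := D x Yx.
  by rewrite (is_diff_derive u (Ck_is_diff (Cbq 1%N) Yx)).
(* Differentiate [bq (- bq x) = - x]. *)
have DD x u : Y x -> 'D_('D_u bq x) bq (- bq x) = u.
  move=> Yx; have D2 := Ck_is_diff (Cbq 1%N) (quasi_domain_oppq Yx).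
  have h : \forall y \near x, bq (- bq y) = - y.
    by apply: filterS (open_nbhs_nbhs (conj Yopen Yx)) => y; exact: bq_oppq.
  have D3 := is_diff_near_eq h (is_diff_comp (D x Yx) D2).
  have e := etrans (esym (is_diff_derive u D3)) (is_diff_derive u (is_diffN (is_diff_id x))).
  have De := is_diff_derive u (Ck_is_diff (Cbq 1%N) Yx).
  rewrite De (is_diff_derive _ D2).
  move: e; rewrite /= linearN => /oppr_inj; exact.
exists (fun x => - bq x), (-1), (fun x => gamma x (bq x)); split=> //.
- split=> [x|k|x Yx]; first exact: quasi_domain_oppq.
    by apply: Ck_N => //; exact: Cbq.
  have DE := bilin_is_diff gb (is_diff_id x) (Ck_is_diff (Cbq 1%N) Yx).
  apply: (is_diff_congr _ _ DE) => // u.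
  rewrite /qform bq_oppq// dE// (linN (gamma_linearl _)) (linN (gamma_linearr _)) opprK.
  by rewrite scaleN1r opprK gC (is_diff_derive u (Ck_is_diff (Cbq 1%N) Yx)).
- move=> y a b Yy; rewrite !dE// qform1E; last exact: quasi_domain_oppq.
  have D2 := Ck_is_diff (Cbq 1%N) (quasi_domain_oppq Yy).
  rewrite (is_diff_derive _ D2) linearN -(is_diff_derive _ D2) DD//.
  rewrite (linN (gamma_linearl _)) (linN (gamma_linearr _)) opprK gC.
  by rewrite -qform1E// qform1_sym.
Qed.

Lemma qreflK z : Y z.1 -> qrefl (qrefl z) = z.
Proof.
case: z => x t /= Yx; rewrite /qrefl /= bq_oppq// opprK; congr pair.
rewrite (linN (gamma_linearl _)) (linN (gamma_linearr _)) opprK !scaleN1r opprD opprK gC.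
by rewrite -addrA addNr addr0.
Qed.

(** The term [gamma (g x) a'] compensates the translation part of [b]; the factor [1] is the [eps]
    of [leaf_auto_map]. *)
Definition qaffine (g : J -> J) (a a' : J) (t : R) (z : V) : V :=
  (a + g z.1, 1 *: z.2 + (gamma (g z.1) a' + t)).

Lemma qaffine_isom g g' a a' t : strmap g g' a a' -> Y a -> leaf_isom Y qform (qaffine g a a' t).
Proof.
move=> S Ya; have [lg lg' d _] := S; have cg := lin_continuous B lg.
have Dg x : is_diff x (fun y => a + g y) g.
  refine (is_diff_congr _ _ (is_diffD (is_diff_cst a x) (is_diff_lin x lg cg))) => // w.
  exact: add0r.
have dE x u : 'd (fun y => a + g y) x u = g u by have [_ ->] := Dg x.
exists (fun x => a + g x), 1, (fun x => gamma (g x) a' + t); split=> //.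
- split=> [x Yx|k|x Yx]; first exact/(Y_str _ S Ya).
    apply: Ck_D; [exact: Yopen|exact: Ck_cst|exact: Ck_lin].
  have DE := is_diffD (bilin_is_diff gb (is_diff_lin x lg cg) (is_diff_cst a' x)) (is_diff_cst (t : R^o) x).
  apply: (is_diff_congr _ _ DE) => // u.
  rewrite -[LHS]/(gamma (g x) 0 + gamma (g u) a' + 0) (lin0 (gamma_linearr _)) add0r addr0.
  rewrite /qform dE (b_str S Ya Yx) (linD (gamma_linearr _)) d scale1r.
  by rewrite addrK.
- move=> y u v Yy; rewrite !dE !qform1E//; last exact/(Y_str _ S Ya).
  have dbq w : Y w -> differentiable bq w by have [+ _] := Cbq 1%N; apply.
  by rewrite (transport u S Ya dbq dbq (fun w => b_str S Ya (x := w)) Yy) d.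
Qed.

Lemma qaffine_comp g1 g1' a1 a1' t1 g2 g2' a2 a2' t2 :
  strmap g1 g1' a1 a1' -> strmap g2 g2' a2 a2' ->
  qaffine g2 a2 a2' t2 \o qaffine g1 a1 a1' t1 =
  qaffine (g2 \o g1) (a2 + g2 a1) (a2' + g2' a1') (t1 + t2 + gamma (g2 a1) a2').
Proof.
move=> S1 S2; have [lg2 _ d2 _] := S2; apply/funext => -[x s]; congr pair.
  by rewrite /= (linD lg2) addrA.
rewrite /= !scale1r (linD lg2) (linD (gamma_linearl _)) (linD (gamma_linearr _)) d2.
by move: (gamma _ _) (gamma _ _) (gamma _ _) => b1 b2 b3; ring.
Qed.

Lemma qaffine_inv g g' a a' t : strmap g g' a a' -> Y a -> exists h h' b b' s,
  [/\ strmap h h' b b', Y b, cancel (qaffine g a a' t) (qaffine h b b' s)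
    & cancel (qaffine h b b' s) (qaffine g a a' t)].
Proof.
move=> S Ya; have [lg lg' d _] := S.
have [h [h' [S' gh hg gh' hg']]] := strmap_inv S; have [lh lh' d' _] := S'.
exists h, h', (- h a), (- h' a'), (gamma a a' - t); split=> //.
- apply/(Y_str _ S Ya); rewrite (linN lg) hg subrr.
  exact: (quasi_domain0 B mul_linearl mul_linearr hJ).
- move=> [x s]; congr pair; first by rewrite /= (linD lh) gh addrA addNr add0r.
  rewrite /= !scale1r (linD lh) gh (linD (gamma_linearl _)) !(linN (gamma_linearr _)) d'.
  have -> : gamma x (h' a') = gamma (g x) a' by rewrite -{1}(gh x) d'.
  by move: (gamma _ _) (gamma _ _) => b1 b2; ring.
- move=> [x s]; congr pair; first by rewrite /= (linD lg) (linN lg) !hg addrA subrr add0r.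
  rewrite /= !scale1r (linD lg) (linN lg) !hg (linD (gamma_linearl _)) (linN (gamma_linearl _)).
  rewrite (linN (gamma_linearr _)) d'.
  by move: (gamma _ _) (gamma _ _) => b1 b2; ring.
Qed.

End JordanLeaf.

(** * Homogeneity and symmetry *)

Section JordanSymmetries.
Context {R : realType} {J : normedModType R} {n : nat} (B : fbasis J n).
Context (mul : J -> J -> J) (mul_linearl : forall y, linear (mul^~ y))
  (mul_linearr : forall x, linear (mul x)) (hJ : jordan_product mul).
Context (gamma : J -> J -> R^o) (gamma_linearl : forall y, linear (gamma^~ y))
  (gamma_linearr : forall x, linear (gamma x)) (hgamma : trace_form mul gamma)
  (gamma_nd : nondegenerate_form gamma).
Local Notation "x ** y" := (mul x y) (at level 40, left associativity).
Local Notation V := (J * R^o)%type.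
Local Notation strmap := (strmap mul gamma).
Local Notation Y := (quasi_domain mul).
Local Notation bq := (bq mul).
Local Notation qform := (qform mul gamma).
Local Notation qaffine := (qaffine gamma).
Local Notation leaf_isom := (leaf_isom Y qform).
Local Notation xi := ((0, 1) : V).
Context (M : smoothManifold J) (f : M -> V)
  (hM : maximal_integral_manifold (Y `*` [set: R^o]) (leaf_field qform) f) (m0 : M).
Local Notation leaf_lift := (leaf_lift f m0).

Let hI := hM.1.
Let strmap_inv := strmap_inv B gamma_linearl gamma_linearr hgamma gamma_nd.
Let Yorbit := quasi_domain_orbit B mul_linearl mul_linearr hJ gamma_linearl gamma_linearr hgamma gamma_nd.
Let Y_str := strmap_quasi_domain B mul_linearl mul_linearr hJ gamma_linearl gamma_linearr hgamma gamma_nd.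
Let Yopen : open Y := quasi_domain_open B mul_linearl mul_linearr hJ gamma_linearl gamma_linearr hgamma.
Let Yzero : Y 0 := quasi_domain0 B mul_linearl mul_linearr hJ.
Let b0 : bq 0 = 0 := bq0 B mul_linearl mul_linearr hJ.
Let Cbq := Ck_bq B mul_linearl mul_linearr hJ gamma_linearl gamma_linearr hgamma gamma_nd.
Let jet := bq_jet B mul_linearl mul_linearr hJ gamma_linearl gamma_linearr hgamma gamma_nd.
Let qC := qform_Ck B mul_linearl mul_linearr hJ gamma_linearl gamma_linearr hgamma gamma_nd.
Let qprim := qform_prim B mul_linearl mul_linearr hJ gamma_linearl gamma_linearr hgamma gamma_nd.
Let qlin := qform_linear mul gamma_linearl.
Let aff_isom := qaffine_isom B mul_linearl mul_linearr hJ gamma_linearl gamma_linearr hgamma gamma_nd.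
Let aff_inv := qaffine_inv B mul_linearl mul_linearr hJ gamma_linearl gamma_linearr hgamma gamma_nd.
Let refl_isom := qrefl_isom B mul_linearl mul_linearr hJ gamma_linearl gamma_linearr hgamma gamma_nd.
Let reflK := qreflK B mul_linearl mul_linearr hJ gamma_linearl gamma_linearr hgamma gamma_nd.
Let liftE := leaf_liftE B qC qprim hM m0.
Let lift_isometry := leaf_lift_isometry B qlin qC Yopen qprim hM m0.
Let isom_range := leaf_isom_range B qC qprim hM.

Definition leaf_affine (T : V -> V) : Prop :=
  (exists g g' a a' t, [/\ strmap g g' a a', Y a & T = qaffine g a a' t]) /\
  forall z, range f z -> range f (T z).

(** [leaf_affine] only asks that the leaf be mapped into itself; demanding an inverse of the same
    kind makes the set a group. *)
Definition leaf_group : set (V -> V) := [set T | leaf_affine T /\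
  exists S, [/\ leaf_affine S, cancel T S & cancel S T]].

Let leaf_affine_isom T : leaf_affine T -> leaf_isom T.
Proof. by move=> [[g [g' [a [a' [t [S Ya ->]]]]]] _]; exact: (aff_isom t S Ya). Qed.

Let leaf_affine_id : leaf_affine id.
Proof.
split=> //; exists id, id, 0, 0, 0; split=> //; first exact: strmap_id.
apply/funext => -[x t]; congr pair; rewrite /= ?add0r// scale1r.
by rewrite (lin0 (gamma_linearr _)) !addr0.
Qed.

Let leaf_affine_comp S T : leaf_affine S -> leaf_affine T -> leaf_affine (S \o T).
Proof.
move=> [[g2 [g2' [a2 [a2' [t2 [S2 Ya2 e2]]]]]] h2] [[g1 [g1' [a1 [a1' [t1 [S1 Ya1 e1]]]]]] h1].
split; last by move=> z hz; apply/h2/h1.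
exists (g2 \o g1), (g2' \o g1'), (a2 + g2 a1), (a2' + g2' a1'), (t1 + t2 + gamma (g2 a1) a2').
split; first exact: strmap_comp.
  exact/(Y_str _ S2 Ya2).
by rewrite e1 e2 (qaffine_comp gamma_linearl gamma_linearr t1 t2 S1 S2).
Qed.

Let leaf_affine_trans T : leaf_affine T -> affine_transformation T.
Proof.
move=> [[g [g' [a [a' [t [S Ya ->]]]]]] _]; have [lg _ _ _] := S.
pose L (z : V) : V := (g z.1, z.2 + gamma (g z.1) a').
have lL : linear L.
  move=> k [x s] [y u]; congr pair; rewrite /= lg// (linD (gamma_linearl _)) (linZ (gamma_linearl _)).
  by rewrite scalerDr addrACA.
have [h [h' [b [b' [s [S' _ K1 K2]]]]]] := aff_inv t S Ya.
have TL z : qaffine g a a' t z = L z + (a, t).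
  by case: z => x u; congr pair; rewrite /= ?scale1r ?[g x + a]addrC// addrA.
exists (lin_of lL), (a, t); split=> //.
exists (fun z => qaffine h b b' s (z + (a, t))) => z.
  by change (qaffine h b b' s (L z + (a, t)) = z); rewrite -TL K1.
change (L (qaffine h b b' s (z + (a, t))) = z).
by apply: (addIr (a, t)); rewrite -TL K2.
Qed.

Let leaf_affine_rangeP g g' a a' t m : strmap g g' a a' -> Y a ->
  range f (qaffine g a a' t (f m)) -> leaf_affine (qaffine g a a' t).
Proof.
move=> S Ya hr; split; first by exists g, g', a, a', t.
by move=> _ [m' _ <-]; exact: isom_range (aff_isom t S Ya) hr.
Qed.

Let leaf_group_mem g g' a a' t m m' : strmap g g' a a' -> Y a ->
  qaffine g a a' t (f m) = f m' -> leaf_group (qaffine g a a' t).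
Proof.
move=> S Ya e; split; first by apply: (leaf_affine_rangeP S Ya (m := m)); rewrite e; exists m'.
have [h [h' [b [b' [s [S' Yb K1 K2]]]]]] := aff_inv t S Ya.
exists (qaffine h b b' s); split=> //.
by apply: (leaf_affine_rangeP S' Yb (m := m')); rewrite -e K1; exists m.
Qed.

Let leaf_group_lift T m : leaf_group T -> f (leaf_lift T m) = T (f m).
Proof.
by move=> [hT _]; apply: (liftE m (leaf_affine_isom hT) (m := m0)); apply: hT.2; exists m0.
Qed.

Lemma leaf_homogeneous : homogeneous_immersion xi f.
Proof.
exists leaf_group, leaf_lift; split.
- split; last by move=> T [hT _]; exact: leaf_affine_trans.
  split; first by split=> //; exists id; split.
    move=> S T [hS [S' [hS' S1 S2]]] [hT [T' [hT' T1 T2]]].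
    split; first exact: leaf_affine_comp.
    exists (T' \o S'); split; first exact: leaf_affine_comp.
      by move=> z; rewrite /= S1 T1.
    by move=> z; rewrite /= T2 S2.
  by move=> T [hT [S [hS K1 K2]]]; exists S; split=> //; split=> //; exists T.
- have Gid : leaf_group id by split=> //; exists id; split.
  split=> [|S T GS GT].
    by apply/funext => m; apply: (leaf_inj hI); rewrite leaf_group_lift.
  apply/funext => m; apply: (leaf_inj hI); rewrite /= !leaf_group_lift//.
  have [hS [S' [hS' S1 S2]]] := GS; have [hT [T' [hT' T1 T2]]] := GT.
  split; first exact: leaf_affine_comp.
  exists (T' \o S'); split; first exact: leaf_affine_comp.
    by move=> z; rewrite /= S1 T1.
  by move=> z; rewrite /= T2 S2.
- by move=> T GT m; exact: leaf_group_lift.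
- move=> T [hT [S [hS K1 K2]]].
  apply: (lift_isometry (Psi := S) (m := m0) (leaf_affine_isom hT) (leaf_affine_isom hS)).
  + by move=> z _; exact: K1.
  + by move=> z _; exact: K2.
  + by apply: hT.2; exists m0.
- move=> m m'.
  have Ym := leaf_domain hI m; have Ym' := leaf_domain hI m'.
  have [g1 [g1' [a1' S1]]] := Yorbit Ym; have [g2 [g2' [a2' S2]]] := Yorbit Ym'.
  have [h [h' [S1' gh hg _ _]]] := strmap_inv S1; have [l1 _ _ _] := S1; have [l2 _ _ _] := S2.
  (* Back from the first base point to [0], then on to the second one; [t] below adjusts the
     height. *)
  have S := strmap_comp S1' S2.
  set a := (f m').1 + _ in S; set a' := a2' + _ in S; set g := g2 \o h in S.
  have Yz : Y (- h (f m).1).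
    apply/(Y_str _ S1 Ym); rewrite (linN l1) hg subrr; exact: Yzero.
  have Ya : Y a by apply/(Y_str _ S2 Ym').
  have e1 : a + g (f m).1 = (f m').1.
    by rewrite /a /g /= (linN l2) subrK.
  pose t := (f m').2 - ((f m).2 + gamma (g (f m).1) a').
  have e : qaffine g a a' t (f m) = f m'.
    rewrite /qaffine e1 /t scale1r; case: (f m') => x s; congr pair => /=.
    by rewrite addrA [_ + (s - _)]addrC subrK.
  have GT := leaf_group_mem S Ya e.
  exists (qaffine g a a' t) => //; apply: (leaf_inj hI).
  by rewrite leaf_group_lift.
Qed.

(** The reflection over [0] is conjugated by an affine map moving [0] to the base point of [m], and
    a vertical translation then brings [f m] back to itself. As the reflection is an involution, the
    inverse [Psi] is obtained by undoing the translation first. *)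
Lemma leaf_symmetric : symmetric_immersion xi f.
Proof.
move=> m; have Ym := leaf_domain hI m; set x := (f m).1 in Ym.
have [g [g' [x' S]]] := Yorbit Ym; have [lg _ _ _] := S.
have [h [h' [b [b' [s [S' Yb K1 K2]]]]]] := aff_inv 0 S Ym.
set A := qaffine g x x' 0 in K1 K2; set A' := qaffine h b b' s in K1 K2.
have iA : leaf_isom A := aff_isom 0 S Ym; have iA' : leaf_isom A' := aff_isom s S' Yb.
pose P0 := A \o (qrefl mul gamma \o A').
have iP0 : leaf_isom P0.
  by apply: (leaf_isom_comp B Yopen) => //; apply: (leaf_isom_comp B Yopen) => //; exact: refl_isom.
have P0K z : Y z.1 -> P0 (P0 z) = z.
  move=> Yz; rewrite /P0 /= K1 reflK; first exact: K2.
  exact: leaf_isom_Y iA' Yz.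
pose t := (f m).2 - (P0 (f m)).2.
pose Phi := (fun z : V => (z.1, z.2 + t) : V) \o P0.
pose Psi := P0 \o (fun z : V => (z.1, z.2 + (- t)) : V).
have iPhi : leaf_isom Phi by apply: (leaf_isom_comp B Yopen) => //; exact: leaf_isom_translation.
have iPsi : leaf_isom Psi by apply: (leaf_isom_comp B Yopen) => //; exact: leaf_isom_translation.
have PhiK z : Y z.1 -> Psi (Phi z) = z.
  move=> Yz; have -> : Psi (Phi z) = P0 (P0 z); last exact: P0K.
  change (P0 ((P0 z).1, (P0 z).2 + t - t) = P0 (P0 z)).
  by rewrite addrK; move: (P0 z) => -[y v].
have PsiK z : Y z.1 -> Phi (Psi z) = z.
  move=> Yz; change ((fun z : V => (z.1, z.2 + t) : V) (P0 (P0 (z.1, z.2 - t))) = z).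
  by rewrite P0K//=; case: z {Yz} => y u /=; rewrite subrK.
have hb : b + h x = 0.
  have e : A' (A (0, 0)) = (0, 0) by exact: K1.
  have : A (0, 0) = (x, (A (0, 0)).2) by rewrite /A /qaffine /= (lin0 lg) addr0.
  by move=> e2; move: e; rewrite e2 => /(congr1 fst).
have P0m : (P0 (f m)).1 = x.
  by rewrite /P0 /= hb b0 oppr0 (lin0 lg) addr0.
have Phim : Phi (f m) = f m.
  change (((P0 (f m)).1, (P0 (f m)).2 + t) = f m).
  by rewrite P0m /t addrC subrK /x; case: (f m).
have hr : range f (Phi (f m)) by rewrite Phim; exists m.
have aP := lift_isometry iPhi iPsi PhiK PsiK hr.
have lE m' : f (leaf_lift Phi m') = Phi (f m') := liftE m' iPhi hr.
have sm : leaf_lift Phi m = m by apply: (leaf_inj hI); rewrite lE.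
exists (leaf_lift Phi); split=> // c ac cm u.
have cx := cmap_img cm.
(* The base component of [Phi]. At [x] the argument of [bq] is [0], where the differential of [bq]
   is the identity, so the total differential is [w |-> g (- h w) = - w]. *)
pose phi y := x + g (- bq (b + h y)).
have D : is_diff x phi (fun w => - w).
  have gh w : g (h w) = w.
    have e z : x + g b + g (h z) = z.
      by have /(congr1 fst) := K2 (z, 0); rewrite /= (linD lg) addrA.
    have := e 0; have [lh _ _ _] := S'; rewrite (lin0 lh) (lin0 lg) addr0 => e0.
    by have := e w; rewrite e0 add0r.
  have [lh _ _ _] := S'.
  have Daff (l : J -> J) (a y : J) : linear l -> is_diff y (fun z => a + l z) l.
    move=> ll; have Dl := is_diff_lin y ll (lin_continuous B ll).
    by refine (is_diff_congr _ _ (is_diffD (is_diff_cst a y) Dl)) => // w; exact: add0r.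
  have Db : is_diff (b + h x) (fun y => - bq y) (fun w => - w).
    rewrite hb; have D0 := Ck_is_diff (Cbq 1%N) Yzero.
    refine (is_diff_congr _ _ (is_diffN D0)) => // w.
    have [j _ _] := jet (strmap_id mul gamma) Yzero.
    by rewrite -[LHS]/(- 'd bq 0 w) -(is_diff_derive w D0) j.
  have D1 := is_diff_comp (Daff h b x lh) Db.
  refine (is_diff_congr _ _ (is_diff_comp D1 (Daff g x _ lg))) => // w.
  by rewrite /= (linN lg) gh.
have cs : Defs.coord c c (leaf_lift Phi) (cmap c m) = cmap c m by rewrite /Defs.coord cmapK// sm.
have cdm : coord_dom c c (leaf_lift Phi) (cmap c m) by split=> //; rewrite cmapK// sm.
have pP m' : (f (leaf_lift Phi m')).1 = phi (f m').1 by rewrite lE.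
have dphi : differentiable phi (f (cinv c (cmap c m))).1 by rewrite cmapK//; have [] := D.
have := leaf_map_diff hI u aP.1.1 pP dphi ac ac cdm.
rewrite cs cmapK//; have [_ ->] := D; rewrite -linearN.
exact: (leaf_immersion hI ac cx).
Qed.

End JordanSymmetries.

(** * Geodesics and completeness *)

Section CurveCalculus.
Context {R : realType} {E : normedModType R} {n : nat} (B : fbasis E n).

Lemma real_connected : connected [set: R].
Proof. by apply/connected_intervalP => x y _ _ z _. Qed.

Lemma Ck_curve_diff (F : normedModType R) (Q : set R) (y : R^o -> F) k t :
  Ck_on k.+1 (Q : set R^o) y -> Q t -> curve_diff y t (derive1 y t).
Proof.
move=> cy Qt; have D := Ck_is_diff cy Qt.
apply: (is_diff_congr _ _ D) => // s.
rewrite derive1E (is_diff_derive (1 : R^o) D) -linearZ /=.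
by congr ('d y t _); exact: esym (mulr1 s).
Qed.

Lemma curve_diff_uniq (F : normedModType R) (y : R -> F) t v w :
  curve_diff y t v -> curve_diff y t w -> v = w.
Proof. by move=> /curve_diff_derive1 <- /curve_diff_derive1. Qed.

Lemma curve_diff_near (F : normedModType R) (y z : R -> F) t v :
  (\forall s \near t, y s = z s) -> curve_diff y t v -> curve_diff z t v.
Proof. exact: is_diff_near_eq. Qed.

Lemma expsum_Ck k m (A : E -> E) x : linear A ->
  Ck_on k [set: R^o] (expsum m A x : R^o -> E).
Proof.
move=> lA; have D m' y t : curve_diff (expsum m' A y) t
    (if m' is m''.+1 then expsum m'' A y t else expsum 0 A (A y) t).
  case: m' => [|m']; last exact: (expsum_diffS B).
  by apply: curve_diff_eq (expsum_diff0 B y t lA); rewrite (expsum_map B _ _ _ lA lA).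
elim: k m x => [|k IH] m x /=; first by move=> t _; exact: curve_diff_continuous (D m x t).
split=> [t _|v]; first by have [] := D m x t.
have -> : (fun t : R^o => 'D_v (expsum m A x : R^o -> E) t) = fun t : R^o =>
    (v : R) *: (if m is m'.+1 then expsum m' A x t else expsum 0 A (A x) t).
  by apply/funext => t; rewrite (is_diff_derive v (D m x t)).
apply: Ck_scaler; first exact: openT.
by case: m => [|m]; exact: IH.
Qed.

End CurveCalculus.

Section GeodesicCurve.
Context {R : realType} {J : normedModType R} {n : nat} (B : fbasis J n).
Context (mul : J -> J -> J) (mul_linearl : forall y, linear (mul^~ y))
  (mul_linearr : forall x, linear (mul x)) (hJ : jordan_product mul).
Context (gamma : J -> J -> R^o) (gamma_linearl : forall y, linear (gamma^~ y))
  (gamma_linearr : forall x, linear (gamma x)) (hgamma : trace_form mul gamma)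
  (gamma_nd : nondegenerate_form gamma).
Local Notation "x ** y" := (mul x y) (at level 40, left associativity).
Local Notation V := (J * R^o)%type.
Local Notation strmap := (strmap mul gamma).
Local Notation Y := (quasi_domain mul).
Local Notation bq := (bq mul).
Local Notation qform := (qform mul gamma).
Local Notation qaffine := (qaffine gamma).
Local Notation leaf_isom := (leaf_isom Y qform).
Local Notation xi := ((0, 1) : V).

Let mC := mulJC hJ.
Let m0l := mulJ0l mul_linearl.
Let gb : bilin gamma := fbasis_bilin B B gamma_linearl gamma_linearr.
Let gC u v : gamma u v = gamma v u. Proof. by have [] := hgamma. Qed.
Let strmap_inv := strmap_inv B gamma_linearl gamma_linearr hgamma gamma_nd.
Let Y_str := strmap_quasi_domain B mul_linearl mul_linearr hJ gamma_linearl gamma_linearr hgamma gamma_nd.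
Let Yzero : Y 0 := quasi_domain0 B mul_linearl mul_linearr hJ.

Section Flow.
Context (u : J).
Let A (y : J) := u ** y.
Let A' (y : J) := - (u ** y).
Let lA : linear A. Proof. exact: mul_linearr. Qed.
Let lA' : linear A'.
Proof. by move=> a y z; rewrite /A' mul_linearr opprD scalerN. Qed.

Lemma mul_flow_strmap t : strmap (fun x => expsum 0 A x t) (fun x => expsum 0 A' x t)
  (expsum 1 A u t) (expsum 1 A' u t).
Proof.
have i0 x : inner_der mul 0 0 x = 0 by rewrite /inner_der !m0l subrr.
have e : flow_op mul u 0 0 = A by apply/funext => x; rewrite /flow_op i0 addr0.
have e' : flow_op' mul u 0 0 = A' by apply/funext => x; rewrite /flow_op' i0 sub0r.
have := flow_strmap B mul_linearl mul_linearr hJ gamma_linearl gamma_linearr hgamma u 0 0 t.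
by rewrite e e'.
Qed.

(** The curve is the orbit of [0] under the flow of [u + u x], that is, [e^(tu) - 1] in the hull. It
    is connected and consists of points with a quasi-inverse. *)
Lemma mul_flow_quasi_domain t : Y (expsum 1 A u t).
Proof.
apply: (quasi_domain_max B mul_linearl mul_linearr hJ (C := range (fun t : R => expsum 1 A u t)) (x := 0)) => //.
- apply: connected_continuous_connected; first exact: real_connected.
  by apply: continuous_subspaceT => s; exact: curve_diff_continuous (expsum_diffS B 0 u s lA).
- move=> _ [s _ <-]; exists (expsum 1 A' u s).
  have [l l' _ q] := mul_flow_strmap s.
  have := (proj1 (q 0 0)) (qinv00 mul_linearl).
  by rewrite (lin0 l) (lin0 l') !addr0.
- by exists 0 => //; rewrite (expsum0 B)// scale0r.
Qed.

(** In the hull this reads [gamma(e^(tu) u, 1 - e^(-tu)) = gamma(u, e^(tu) - 1)]; the two sides have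
    equal derivatives and vanish at [0]. It gives the height along a geodesic a closed form. *)
Lemma mul_flow_pairing t :
  gamma (expsum 0 A u t) (expsum 1 A' u t) = gamma u (expsum 1 A u t).
Proof.
have D s : curve_diff (fun s => gamma (expsum 0 A u s) (expsum 1 A' u s) -
    gamma u (expsum 1 A u s) : R) s 0.
  have D1 := curve_diff_bilin gb (expsum_diff0 B u s lA) (expsum_diff1 B u s lA').
  have D2 := curve_diff_lin (gamma_linearr u) (lin_continuous B (gamma_linearr u))
    (expsum_diffS B 0 u s lA).
  apply: curve_diff_eq (curve_diffB D1 D2).
  have [_ tr] := hgamma.
  have e y z : gamma (A y) z = gamma y (u ** z) by rewrite /A mC tr.
  rewrite e (linD (gamma_linearr _)) /A' (linN (gamma_linearr _)).
  by rewrite subrK [gamma _ u]gC subrr.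
have := curve_const D t; rewrite !(expsum0 B)// !scale0r !(lin0 (gamma_linearr _)) subrr.
by move=> /eqP; rewrite subr_eq0 => /eqP.
Qed.

End Flow.

Context (M : smoothManifold J) (f : M -> V)
  (hM : maximal_integral_manifold (Y `*` [set: R^o]) (leaf_field qform) f) (m0 : M).
Local Notation p := (fst \o f).
Let hI := hM.1.
Let Yorbit := quasi_domain_orbit B mul_linearl mul_linearr hJ gamma_linearl gamma_linearr hgamma gamma_nd.
Let qC := qform_Ck B mul_linearl mul_linearr hJ gamma_linearl gamma_linearr hgamma gamma_nd.
Let qprim := qform_prim B mul_linearl mul_linearr hJ gamma_linearl gamma_linearr hgamma gamma_nd.
Let qlin := qform_linear mul gamma_linearl.
Let q1sym := qform1_sym B mul_linearl mul_linearr hJ gamma_linearl gamma_linearr hgamma gamma_nd.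
Let q1nd := qform1_nd B mul_linearl mul_linearr hJ gamma_linearl gamma_linearr hgamma gamma_nd.

(** The curve is horizontal and therefore lifts. With [x] the lift in a chart,
    [X'' = hess(x', x') + d theta(x'')], while [d theta] sends the Levi-Civita term to
    [hess(x', x') + N(X', X')]; so [X'' + N(X', X') = 0] is the geodesic equation. *)
Lemma horizontal_geodesic (X X1 X2 : R -> J) (alpha : R -> R^o) m :
  (forall k, Ck_on k [set: R^o] (X : R^o -> J)) ->
  (forall t, Y (X t)) -> (forall t, curve_diff X t (X1 t)) -> (forall t, curve_diff X1 t (X2 t)) ->
  (forall t, exists2 N, parallel_at qform (X t) N & X2 t + N (X1 t) (X1 t) = 0) ->
  (forall t, curve_diff alpha t (qform (X t) (X1 t))) -> f m = (X 0, alpha 0) ->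
  exists g : R^o -> M, [/\ geodesic xi f g, g 0 = m &
    forall c t, atlas c -> cdom c (g t) ->
      'd (p \o cinv c) (cmap c (g t)) (derive1 (cmap c \o g : R^o -> J) t) = X1 t].
Proof.
move=> CX YX dX dX1 hN da fm.
pose kappa (t : R^o) : V := (X t, alpha t).
have hk : horizontal Y qform kappa.
  move=> t; split; first exact: YX.
    exact: (curve_diff_continuous (dX t)).
  move=> x0 r psi [r0 rY psid] tr.
  have cX : {for t, continuous X} := curve_diff_continuous (dX t).
  have /nbhs_ballP[s /= s0 hs] : nbhs t (X @^-1` ball x0 r).
    by apply: cX; apply: open_nbhs_nbhs; split=> //; exact: ball_open.
  have D y : ball t s y -> is_diff y (fun y : R => alpha y - psi (X y) : R^o) 0.
    move=> /hs yr; have D1 := curve_diffB (da y) (curve_diff_comp (dX y) (psid _ yr)).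
    by apply: (is_diff_congr _ _ D1) => // w; rewrite subrr scaler0.
  apply/nbhs_ballP; exists s => //= y ys.
  exact: (ball_diff0 D ys (ballxx _ s0)).
have hr0 : range f (kappa 0) by exists m.
have hr := horizontal_range B qC qprim hM real_connected hk hr0.
pose g : R^o -> M := leaf_inv f m0 \o kappa.
have fg t : f (g t) = kappa t by exact: leaf_invK.
have cg : continuous g := horizontal_lift B qprim hM hk hr.
have g0 : g 0 = m by rewrite /g /= /kappa -fm (leafK hM m0).
have oQ (c : chart J M) : open [set t | cdom c (g t)].
  by move/continuousP: cg => /(_ _ (@cdom_open _ _ _ c)).
have sx c : atlas c -> smooth_on [set t | cdom c (g t)] (cmap c \o g).
  move=> ac k; have := @leaf_smooth_lift _ _ _ B _ _ qC qprim _ _ hM m0 R^o [set: R^o] g k openT.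
  move=> /(_ (fun x _ => cg x)) h; apply: Ck_sub (h _ c ac) => [t ct|l].
    by split.
  rewrite (_ : p \o g = X)//; apply/funext => t.
  by rewrite /= fg.
have nQ (c : chart J M) (s : R) : cdom c (g s) -> \forall y \near s, cdom c (g y).
  move=> cs; have h : open_nbhs (s : R^o) [set t | cdom c (g t)] by split=> //; exact: oQ.
  exact: (open_nbhs_nbhs h).
have dx c s : atlas c -> cdom c (g s) -> curve_diff (cmap c \o g) s (derive1 (cmap c \o g : R^o -> J) s).
  by move=> ac cs; exact: (Ck_curve_diff (sx c ac 1%N) cs).
have th1 c s : atlas c -> cdom c (g s) ->
    'd (p \o cinv c) (cmap c (g s)) (derive1 (cmap c \o g : R^o -> J) s) = X1 s.
  move=> ac cs.
  have D := curve_diff_comp (dx c s ac cs) (Ck_is_diff (leaf_smooth hI ac 1%N) (cmap_img cs)).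
  apply: curve_diff_uniq (dX s).
  apply: curve_diff_near D; apply: filterS (nQ c s cs) => y cy.
  by rewrite /= cmapK// fg.
exists g; split=> //; split=> // c ac /=; split; first exact: sx.
move=> t ct; set x := cmap c \o g.
have cx : cimg c (x t) by exact: cmap_img.
have thx : (p \o cinv c) (x t) = X t by rewrite /x /= cmapK// fg.
have dx2 : curve_diff (derive1 x) t (derive1 (derive1 x) t).
  apply: (@Ck_curve_diff _ _ [set t | cdom c (g t)] _ 0) ct.
  have [_ /(_ (1 : R^o))] := sx c ac 2%N; congr (Ck_on 1 _ _).
  by apply/funext => s; rewrite derive1E.
have D : curve_diff (fun s => 'd (p \o cinv c) (x s) (derive1 x s)) t
    (hess f c (x t) (derive1 x t) (derive1 x t) + 'd (p \o cinv c) (x t) (derive1 (derive1 x) t)).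
  have DH v := curve_diff_comp (dx c t ac ct) (chart_d2 hI ac v cx).
  have lH : \forall s \near (t : R^o), linear ('d (p \o cinv c) (x s)).
    by apply: (@filterE _ (nbhs (t : R^o))) => s a y z; rewrite linearP.
  have DS := slot_diff B (H := fun s : R^o => 'd (p \o cinv c) (x s)) lH DH dx2.
  by apply: (is_diff_congr _ _ DS) => // s; rewrite scalerDr linearZ.
have e2 : X2 t = hess f c (x t) (derive1 x t) (derive1 x t) +
    'd (p \o cinv c) (x t) (derive1 (derive1 x) t).
  apply: curve_diff_uniq (dX1 t) _.
  by apply: curve_diff_near D; apply: filterS (nQ c t ct) => y cy; exact: th1.
have [N hNt hN2] := hN t.
have lc : 'd (p \o cinv c) (x t) (levi_civita xi (f \o cinv c) (x t) (derive1 x t) (derive1 x t)) =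
    hess f c (x t) (derive1 x t) (derive1 x t) + N (X1 t) (X1 t).
  have hNx : parallel_at qform (p (cinv c (x t))) N by rewrite [p _]thx.
  have := leaf_levi_civita B qlin qC hI q1sym q1nd (derive1 x t) (derive1 x t) ac cx hNx.
  by rewrite !(th1 c t ac ct).
apply: (leaf_immersion hI ac cx); rewrite linear0 linearD /= lc -hN2 e2.
by rewrite addrA [_ + hess _ _ _ _ _]addrC.
Qed.

(** The curve is the orbit of [0] under the flow of [u + u x], moved to the base point by [g]; [u]
    is the initial velocity brought back to [0]. The structure map at time [t] has linear part
    [g e^(tA)], so that the difference tensor on [X1] is [- g e^(tA) (u u)], the opposite of
    [X2]. *)
Lemma leaf_complete : affine_complete xi f.
Proof.
move=> c m v ac cm; have Ym := leaf_domain hI m; set x0 := (f m).1 in Ym.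
have [g [g' [a' S]]] := Yorbit Ym; have [lg lg' d _] := S.
have [h [h' [_ gh hg _ _]]] := strmap_inv S.
pose u := h ('d (p \o cinv c) (cmap c m) v); pose A y := u ** y.
have lA : linear A by exact: mul_linearr.
have cg := lin_continuous B lg.
pose X t := x0 + g (expsum 1 A u t).
pose X1 t := g (expsum 0 A u t).
pose X2 t := g (expsum 0 A (u ** u) t).
(* A primitive of the form along the curve: the linear term comes from [a'], and [expsum 2]
   integrates [gamma u (expsum 1 A u t)] of [mul_flow_pairing]. *)
pose alpha t : R^o := (f m).2 + (gamma (g (expsum 1 A u t)) a' + gamma u (expsum 2 A u t)).
have YX t : Y (X t) by apply/(Y_str _ S Ym); exact: mul_flow_quasi_domain.
have CX k : Ck_on k [set: R^o] (X : R^o -> J).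
  apply: Ck_D; [exact: openT|exact: Ck_cst|].
  exact: (Ck_lin_comp openT lg cg (expsum_Ck B k 1 u lA)).
have dX t : curve_diff X t (X1 t).
  apply: curve_diff_eq (curve_diffD (curve_diff_cst x0 t)
    (curve_diff_lin lg cg (expsum_diffS B 0 u t lA))).
  exact: add0r.
have dX1 t : curve_diff X1 t (X2 t).
  apply: curve_diff_eq (curve_diff_lin lg cg (expsum_diff0 B u t lA)).
  by rewrite (expsum_map B _ _ _ lA lA).
have St t := strmap_comp (mul_flow_strmap u t) S.
have hN t : exists2 N, parallel_at qform (X t) N & X2 t + N (X1 t) (X1 t) = 0.
  have [k [k' [_ ik ki _ _]]] := strmap_inv (St t).
  have hp := strmap_parallel B mul_linearl mul_linearr hJ gamma_linearl gamma_linearr hgamma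
    gamma_nd (St t) (YX t) ik ki.
  exists (fun a b => g (expsum 0 A (- (k a ** k b)) t)); first exact: hp.
  have -> : k (X1 t) = u by exact: ik.
  have [lt _ _ _] := St t.
  by rewrite -[g _]/((g \o (fun x => expsum 0 A x t)) (- (u ** u))) (linN lt) subrr.
have da t : curve_diff alpha t (qform (X t) (X1 t)).
  have D1 := curve_diff_bilin gb (curve_diff_lin lg cg (expsum_diffS B 0 u t lA)) (curve_diff_cst a' t).
  have D2 := curve_diff_lin (gamma_linearr u) (lin_continuous B (gamma_linearr u))
    (expsum_diffS B 1 u t lA).
  apply: curve_diff_eq (curve_diffD (curve_diff_cst ((f m).2 : R^o) t) (curve_diffD D1 D2)).
  have -> : qform (X t) (X1 t) = gamma (X1 t) (a' + g' (expsum 1 (fun y => - (u ** y)) u t)).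
    rewrite /qform; congr (gamma _ _); apply/esym.
    exact: (strmap_bq B mul_linearl mul_linearr hJ gamma_linearl gamma_linearr hgamma gamma_nd
      (St t) (YX t)).
  rewrite add0r (linD (gamma_linearr _)) /X1 d mul_flow_pairing (lin0 (gamma_linearr _)).
  by rewrite add0r.
have fm : f m = (X 0, alpha 0).
  rewrite /X /alpha !(expsum0 B)// !scale0r (lin0 lg) (lin0 (gamma_linearl _)) (lin0 (gamma_linearr _)).
  by rewrite !addr0 /x0; case: (f m).
have [k [kg k0 kx]] := horizontal_geodesic CX YX dX dX1 hN da fm.
exists k; split=> //; have c0 : cdom c (k 0) by rewrite k0.
have := kx c 0 ac c0; rewrite k0 /X1 (expsum0 B)// scale1r /u hg.
exact: (leaf_immersion hI ac (cmap_img cm)).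
Qed.

End GeodesicCurve.

(** * Analyticity *)

Section JordanAnalytic.
Context {R : realType} {J : normedModType R} {n : nat} (B : fbasis J n).
Context (mul : J -> J -> J) (mul_linearl : forall y, linear (mul^~ y))
  (mul_linearr : forall x, linear (mul x)) (hJ : jordan_product mul).
Context (gamma : J -> J -> R^o) (gamma_linearl : forall y, linear (gamma^~ y))
  (gamma_linearr : forall x, linear (gamma x)) (hgamma : trace_form mul gamma)
  (gamma_nd : nondegenerate_form gamma).
Local Notation V := (J * R^o)%type.
Local Notation Y := (quasi_domain mul).
Local Notation qform := (qform mul gamma).
Context (M : smoothManifold J) (f : M -> V)
  (hM : maximal_integral_manifold (Y `*` [set: R^o]) (leaf_field qform) f) (m0 : M).
Local Notation p := (fst \o f).
Let hI := hM.1.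
Let qC := qform_Ck B mul_linearl mul_linearr hJ gamma_linearl gamma_linearr hgamma gamma_nd.
Let qprim := qform_prim B mul_linearl mul_linearr hJ gamma_linearl gamma_linearr hgamma gamma_nd.

(** Near each point the given primitive differs by a constant from the one with an explicit power
    series. *)
Lemma prim_analytic x0 r psi (k : R) : local_prim Y qform x0 r psi ->
  analytic_on (ball x0 r) (fun x => (x, k + psi x) : V).
Proof.
move=> [r0 rY psid] x rx.
have [psi1 [s [s0 sY psi1d [m [C [rho [hm hb hs]]]]]]] := local_primitive B mul_linearl mul_linearr hJ
  gamma_linearl gamma_linearr hgamma gamma_nd (rY x rx).
have h1 : analytic_on [set x] (fun y => (y, psi1 y) : V).
  by move=> _ ->; exists m, C, rho, s.
have /nbhs_ballP[t /= t0 ht] : \forall y \near x, ball x s y /\ ball x0 r y.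
  apply: filterI; first exact: nbhsx_ballx.
  by apply: open_nbhs_nbhs; split=> //; exact: ball_open.
have D y : ball x t y -> is_diff y (fun y => psi y - psi1 y : R^o) 0.
  move=> /ht[ys yr]; refine (is_diff_congr _ _ (is_diffB (psid y yr) (psi1d y ys))) => // w.
  exact: subrr.
suff : analytic_on [set x] (fun y => (y, k + psi y) : V) by move=> /(_ x erefl).
apply: (analytic_near_eq _ (analytic_addc ((0, k + (psi x - psi1 x)) : V) h1)).
move=> _ ->; apply/nbhs_ballP; exists t => //= y yt.
have e := ball_diff0 D yt (ballxx x t0).
congr pair; first exact: addr0.
by rewrite /= -e addrC -addrA subrK.
Qed.

Definition proj_atlas : set (chart J M) := [set c | exists x0 r psi
  (hpsi : local_prim Y qform x0 r psi) k (kne : leaf_sheet f x0 r psi k !=set0),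
  c = proj_chart B qC hM m0 hpsi kne].

(** All charts of [proj_atlas] are restrictions of the same projection, so their transition maps are
    identities; compatibility with the given atlas comes from the smoothness of the projection and
    of its sections. *)
Lemma leaf_analytic : analytic_immersion f.
Proof.
split; first by have [] := hI.
exists proj_atlas; split.
- move=> m; have Ym := leaf_domain hI m; have [psi [r hpsi]] := qprim Ym; have [r0 _ _] := hpsi.
  pose k : R := (f m).2 - psi (p m).
  have hm : leaf_sheet f (f m).1 r psi k m by split; [exact: ballxx|].
  have kne : leaf_sheet f (f m).1 r psi k !=set0 by exists m.
  exists (proj_chart B qC hM m0 hpsi kne); last exact: hm.
  by exists (f m).1, r, psi, hpsi, k, kne.
- move=> _ d [x0 [r [psi [hpsi [k [kne ->]]]]]] [x1 [r1 [psi1 [hpsi1 [k1 [kne1 ->]]]]]].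
  apply: (@analytic_near_eq R J J _ id) => [x cdx|]; last exact: analytic_id.
  have oD := @coord_dom_open _ _ M id (proj_chart B qC hM m0 hpsi kne)
    (proj_chart B qC hM m0 hpsi1 kne1) (fun m => cvg_id).
  apply: filterS (open_nbhs_nbhs (conj oD cdx)) => y [yr _].
  by rewrite /Defs.coord /= (leaf_sectionK B qC hM m0 hpsi kne yr).
- move=> c d ac [x0 [r [psi [hpsi [k [kne ->]]]]]] l.
  by apply: Ck_sub (leaf_smooth hI ac l) => x [].
- move=> c d [x0 [r [psi [hpsi [k [kne ->]]]]]] ad l.
  have := @leaf_smooth_lift _ _ _ B _ _ qC qprim _ _ hM m0 J (ball x0 r) (leaf_section f m0 psi k) l.
  move=> /(_ _ _ _ d ad); apply.
  + exact: ball_open.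
  + by move=> x xr; exact: (leaf_section_continuous B qC hM (m0 := m0) hpsi kne xr).
  + move=> j; apply: (Ck_eq (@ball_open _ _ x0 r) (f := id)); last exact: Ck_id.
    by move=> x xr; rewrite /= (leaf_sectionK B qC hM m0 hpsi kne xr).
- move=> c [x0 [r [psi [hpsi [k [kne ->]]]]]].
  apply: (analytic_near_eq _ (prim_analytic k hpsi)) => x xr.
  have h := open_nbhs_nbhs (conj (@ball_open _ _ x0 r) xr).
  apply: filterS h => y yr.
  by rewrite /= (leaf_sectionK B qC hM m0 hpsi kne yr).
Qed.

End JordanAnalytic.

Theorem theorem4p15 (R : realType) (n : nat) (J : normedModType R)
  (hJ : has_dim J n)
  (mul : {bilinear J -> J -> J}) (gamma : {bilinear J -> J -> R^o})
  (hmetrised : metrised_jordan mul gamma)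
  (M : smoothManifold J) (f : M -> (J * R^o)%type)
  (hM : maximal_integral_manifold
          (quasi_domain mul `*` [set: R^o])
          (fun p => [set w | zeta mul gamma p w = 0]) f) :
  let xi : (J * R^o)%type := (0, 1) in
  [/\ [/\ graph_immersion xi f, nondegenerate_immersion xi f
        & analytic_immersion f],
      parallel_cubic_form xi f /\ affine_complete xi f,
      homogeneous_immersion xi f /\ symmetric_immersion xi f,
      covering_map (fst \o f) (quasi_domain mul)
    & sheets_translated (fst \o f) f xi].
Proof.
have [B] := has_dim_fbasis hJ; have [hmul hgamma gamma_nd] := hmetrised.
have ml y : linear (fun x => mul x y) by move=> a u v; rewrite linearPl.
have mr x : linear (mul x) by move=> a u v; rewrite linearPr.
have gl y : linear (fun x => gamma x y : R^o) by move=> a u v; rewrite linearPl.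
have gr x : linear (gamma x : J -> R^o) by move=> a u v; rewrite linearPr.
(* The kernel of [zeta] is [leaf_field (qform mul gamma)] by conversion. *)
have hI : integral_manifold (quasi_domain mul `*` [set: R^o]) (leaf_field (qform mul gamma)) f := hM.1.
have [[[m0 _] _] _ _ _ _] := hI.
have Yo := quasi_domain_open B ml mr hmul gl gr hgamma.
have Yc := quasi_domain_connected B ml mr hmul.
have qlin := qform_linear mul gl.
have qC := qform_Ck B ml mr hmul gl gr hgamma gamma_nd.
have qprim := qform_prim B ml mr hmul gl gr hgamma gamma_nd.
have q1nd := qform1_nd B ml mr hmul gl gr hgamma gamma_nd.
have q1sym := qform1_sym B ml mr hmul gl gr hgamma gamma_nd.
have qpar := qform_parallel B ml mr hmul gl gr hgamma gamma_nd.
split.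
- split; first exact: (leaf_graph_immersion B qlin hI).
    exact: (leaf_nondegenerate B qlin qC hI q1nd).
  exact: (leaf_analytic B ml mr hmul gl gr hgamma gamma_nd hM m0).
- split; first exact: (leaf_parallel B qlin qC Yo hI q1sym q1nd qpar).
  exact: (leaf_complete B ml mr hmul gl gr hgamma gamma_nd hM m0).
- split; first exact: (leaf_homogeneous B ml mr hmul gl gr hgamma gamma_nd hM m0).
  exact: (leaf_symmetric B ml mr hmul gl gr hgamma gamma_nd hM m0).
- exact: (leaf_covering B qC Yc qprim hM m0).
- exact: (leaf_sheets_translated qprim hM).
Qed.
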